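(* Let $d,k,s \in \mathbb{Z}$ be such that $k \geq 3$, $1 \leq d \leq k-1$, and $0 \leq s \leq k-1$. For every $\gamma > 0$, there exists $C>0$ such that the following holds for $n \in k\mathbb{N} + s$ and $p = p(n) \in [0,1]$ with $p \geq C \log n / n^{k-1}$. If $\mathcal{H}$ is a $k$-uniform $n$-vertex hypergraph with $\delta_{d}(\mathcal{H}) \geq \left(\overline{\mu_d}^{(s)}(k) + \gamma\right) \binom{n-d}{k-d}$, then asymptotically almost surely the random subhypergraph $\mathcal{H}_p$ contains an optimal matching.
   Context: A $k$-uniform hypergraph $\mathcal{H}$ consists of a finite vertex set $V(\mathcal{H})$ and a set of edges, each a $k$-element subset of $V(\mathcal{H})$. A matching is a set of pairwise disjoint edges. An optimal matching of a $k$-uniform hypergraph $\mathcal{H}$ is a matching with exactly $\lfloor |V(\mathcal{H})|/k \rfloor$ edges. The minimum $d$-degree $\delta_d(\mathcal{H})$ is the minimum, over all sets $S$ of $d$ distinct vertices, of the number of edges containing $S$. For $n \geq k > d \geq 1$, $m_d(k,n)$ is the minimum integer $D \geq 0$ such that every $k$-uniform $n$-vertex hypergraph $\mathcal{H}$ with $\delta_d(\mathcal{H}) \geq D$ has an optimal matching. For $s \in \{0,\dots,k-1\}$, $$\overline{\mu_d}^{(s)}(k) := \limsup_{n \to \infty,\; n \equiv s \ (\mathrm{mod}\ k)} \frac{m_d(k,n)}{\binom{n-d}{k-d}}.$$ $\mathcal{H}_p$ is the spanning random subhypergraph of $\mathcal{H}$ obtained by keeping each edge of $\mathcal{H}$ independently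 with probability $p$. ''Asymptotically almost surely'' means with probability $1-o(1)$ as $n \to \infty$. *)

(* Defs.v *)
From mathcomp Require Import all_boot all_order all_algebra.
From mathcomp Require Import all_classical all_reals all_analysis.

Set Implicit Arguments.
Unset Strict Implicit.
Unset Printing Implicit Defensive.

Import Order.TTheory GRing.Theory Num.Theory.

Local Open Scope ring_scope.

(* A hypergraph on the vertex set V is represented by its set of edges,
   E : {set {set V}}; spanning subhypergraphs are subsets of E. *)

Section Hypergraphs.
Variable V : finType.
Implicit Types (E F M : {set {set V}}) (S : {set V}).

Definition uniform (k : nat) E : bool := [forall e in E, #|e| == k].

Definition degree E S : nat := #|[set e in E | S \subset e]%SET|.

(* The initial value #|E| bounds every degree, so for d <= #|V| it does not
   affect the minimum; it is the value of the empty minimum when #|V| < d. *)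
Definition min_degree (d : nat) E : nat :=
  \big[minn/#|E|]_(S : {set V} | #|S| == d) degree E S.

Definition is_matching E M : bool := (M \subset E) && finset.trivIset M.

Definition has_optimal_matching (k : nat) E : bool :=
  [exists M : {set {set V}}, is_matching E M && (#|M| == #|V| %/ k)%N].

(* The law of the random subhypergraph: each edge of E is kept independently
   with probability p, so a given F \subset E has probability
   p ^ #|F| * (1 - p) ^ #|E \ F|. *)
Definition subhypergraph_prob (R : realType) E (p : R)
    (A : pred {set {set V}}) : R :=
  \sum_(F : {set {set V}} | (F \subset E) && A F)
    \prod_(e in E) (if e \in F then p else 1 - p).

End Hypergraphs.

(* Quantifying over hypergraphs on 'I_n loses nothing up to isomorphism. *)
Definition forces_optimal_matching (d k n D : nat) : bool :=
  [forall E : {set {set 'I_n}},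
     uniform k E && (D <= min_degree d E)%N ==> has_optimal_matching k E].

Lemma min_degree_le_card (V : finType) (d : nat) (E : {set {set V}}) :
  (min_degree d E <= #|E|)%N.
Proof.
by apply: (big_rec (fun x => x <= #|E|)%N) => // S x _ hx; rewrite geq_min hx orbT.
Qed.

Lemma forces_optimal_matching_ex (d k n : nat) :
  exists D, forces_optimal_matching d k n D.
Proof.
exists #|{set 'I_n}|.+1; apply/forallP => E; apply/implyP => /andP[_].
by rewrite ltnNge (leq_trans (min_degree_le_card d E)) // max_card.
Qed.

Definition m_threshold (d k n : nat) : nat :=
  ex_minn (forces_optimal_matching_ex d k n).

(* For s < k, the n with n = s mod k are enumerated as n = j * k + s.  The
   finitely many terms with n < k, where the quotient may be 0 / 0 = 0, do not
   affect the limsup. *)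
Definition mu_sup (R : realType) (d k s : nat) : R :=
  limn_sup (fun j : nat => let n := (j * k + s)%N in
    (m_threshold d k n)%:R / 'C(n - d, k - d)%:R : R).

(* Main.v *)
Require Import Defs.
From mathcomp Require Import all_boot all_order all_algebra fingroup perm.
From mathcomp Require Import boolp reals sequences exp.
From mathcomp Require Import zify lra ring.

(** A probability measure on sets of edges is spread if it contains a given set
    S of edges with probability at most the product of weights w(e), e in S.

    Spread implies threshold (Frankston-Kahn-Narayanan-Park), in expectation
    form.  Given W random of density 4w and A drawn from a w-spread law, replace
    A by A' \ W, where A' is a support set inside the union of A and W, no
    larger than A, with |A' \ W| minimal.  The new law is still w-spread, being
    supported on subsets of the old sets, and the expected size halves: for the
    smallest support set A* inside the union of W and T = A' \ W one has T
    included in A*, whence E[4^|T| / 2^|A*|] <= 1.  After 2 log_2 n rounds the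
    expected size drops below 1/n, so with probability at least 1 - 1/n the
    union of the random sets contains a member of the support.

    It remains to find an O(n^(1-k))-spread law on optimal matchings.  Fix a
    random vortex V = R_0 > R_1 > ... in which |R_(i+1)| = |R_i| / h and all
    d-degrees into R_(i+1) keep their density (McDiarmid).  Down the vortex,
    A = R_i \ R_(i+1) minus the vertices already used is cut into random
    clusters of constant size m = s mod k; by definition of the threshold all
    but few clusters have an optimal matching, and the uncovered vertices of A
    are matched greedily and randomly into R_(i+1) \ R_(i+2).  The last R_i has
    bounded size and is matched using the definition of the threshold once more.
    Since an edge lies inside R_i with probability h^(-ik), the contributions of
    the levels to the spread form a geometric series. *)

Set Implicit Arguments.
Unset Strict Implicit.
Unset Printing Implicit Defensive.

Import Order.TTheory GRing.Theory Num.Theory.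
Local Open Scope ring_scope.

(** * Spread measures and thresholds *)

Section SpreadTheorem.
Variables (R : realType) (U : finType).
Implicit Types (x w : U -> R) (mu : {set U} -> R) (A M S T W Z : {set U}).

(** The threshold speaks only about vertex sets whose size is [s] modulo [k]. It is therefore
    applied at two places only: to clusters, whose size is chosen in that class, and to the bottom
    set, which stays in it because every vertex dropped on the way down is covered by a matching. A
    matched cluster leaves up to [s] vertices over, a small fraction when clusters are large; so
    clusters give only a nearly perfect matching and a greedy step has to follow.

    Random objects are conditioned on being good. This ruins no spread bound, because goodness has
    probability at least 1/2 and a factor 2 fits into the weight of a single edge.

    Levels are numbered from the bottom: the density given up at level [j] is of order 2^(-j), while
    the sets there have size of order h^j. For h at least 16 the tail bounds then beat the union
    bounds on all levels at once, with constants independent of n.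

    Degrees are compared with powers, (k-d)! deg against n^(k-d), so that densities in nested sets
    are directly comparable; binomials appear only at both ends. *)

Definition is_dist mu := (forall M, 0 <= mu M) /\ \sum_M mu M = 1.

Definition spread w mu :=
  forall S, \sum_(M : {set U} | S \subset M) mu M <= \prod_(e in S) w e.

Definition bern x W := \prod_e (if e \in W then x e else 1 - x e).

Lemma sum_set_prod (F : U -> bool -> R) :
  \sum_(W : {set U}) \prod_e F e (e \in W) = \prod_e (F e true + F e false).
Proof.
rewrite bigA_distr; apply: eq_big => [W|W _]; first by [].
by apply: eq_bigr => e _; case: (e \in W).
Qed.

Lemma bern_ge0 x W : (forall e, 0 <= x e <= 1) -> 0 <= bern x W.
Proof.
move=> x01; apply: prodr_ge0 => e _; have /andP[? ?] := x01 e.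
by case: ifP => _ //; rewrite subr_ge0.
Qed.

Lemma bern_sum1 x : \sum_W bern x W = 1.
Proof.
rewrite (sum_set_prod (fun e b => if b then x e else 1 - x e)).
by rewrite big1 // => e _; rewrite addrC subrK.
Qed.

(** Union of two independent random sets: an element is absent with probability (1 - x e)(1 - y e).
    Everything, including the indicator of [W1 :|: W2 == W], is a product over the elements. *)
Lemma bern_conv x y (g : {set U} -> R) :
  \sum_W1 \sum_W2 bern x W1 * bern y W2 * g (W1 :|: W2) =
  \sum_W bern (fun e => x e + y e - x e * y e) W * g W.
Proof.
have key W : \sum_W1 \sum_W2 bern x W1 * bern y W2 * (W1 :|: W2 == W)%:R =
    bern (fun e => x e + y e - x e * y e) W.
  pose F W1 e b := (if e \in W1 then x e else 1 - x e) * (if b then y e else 1 - y e) *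
     (((e \in W1) || b) == (e \in W))%:R.
  transitivity (\sum_(W1 : {set U}) \prod_e (F W1 e true + F W1 e false)).
    apply: eq_bigr => W1 _; rewrite -(sum_set_prod (F W1)).
    apply: eq_bigr => W2 _; rewrite /F big_split big_split /=; congr (_ * _).
    have [eqW|neqW] := eqVneq.
      by rewrite big1 // => e _; rewrite -eqW inE eqxx.
    have [e He] : exists e, ((e \in W1) || (e \in W2)) != (e \in W).
      apply/existsP; apply: contraNT neqW; rewrite negb_exists => /forallP H.
      by apply/eqP/setP => e; rewrite inE; apply/eqP; rewrite -[_ == _]negbK H.
    by rewrite (bigD1 e) //= (negbTE He) mul0r.
  pose G e b := (if b then x e else 1 - x e) *
     (y e * ((b || true) == (e \in W))%:R + (1 - y e) * ((b || false) == (e \in W))%:R).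
  transitivity (\sum_(W1 : {set U}) \prod_e G e (e \in W1)).
    by apply: eq_bigr => W1 _; apply: eq_bigr => e _; rewrite /F /G; ring.
  rewrite sum_set_prod; apply: eq_bigr => e _; rewrite /G /=.
  by case: (e \in W) => /=; ring.
under [RHS]eq_bigr => W _ do rewrite -key mulr_suml.
rewrite [RHS]exchange_big /=; apply: eq_bigr => W1 _.
under [RHS]eq_bigr => W _ do rewrite mulr_suml.
rewrite [RHS]exchange_big /=; apply: eq_bigr => W2 _.
rewrite [RHS](bigD1 (W1 :|: W2)) //= eqxx mulr1 big1 ?addr0 // => W neqW.
by rewrite eq_sym (negbTE neqW) mulr0 mul0r.
Qed.

(** For each [e] in [T] the factor 1 - x turns into x, which is at least (1 - x) x. This pays for
    replacing [W] by [W :|: T] in the moment bound below. *)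
Lemma bern_disjointU x W T : (forall e, 0 <= x e <= 1) -> [disjoint T & W] ->
  bern x W * \prod_(e in T) x e <= bern x (W :|: T).
Proof.
move=> x01 dTW; rewrite /bern (big_mkcond (fun e => e \in T)) -big_split /=.
apply: ler_prod => e _; have /andP[x0 x1] := x01 e; rewrite inE.
have [eT|eT] := boolP (e \in T); last first.
  by rewrite orbF mulr1 lexx andbT; case: ifP; rewrite ?subr_ge0.
rewrite orbT (disjointFr dTW eT) mulr_ge0 ?subr_ge0 //=.
by rewrite ler_piMl // gerBl.
Qed.

(* Among the support sets inside [W :|: A] that are no larger than [A], one
   minimising the part outside [W]; comparing sizes with [A] is what makes
   expected sizes, rather than the maximal one, contract by a factor 2. *)
Definition refill mu W A : {set U} :=
  [arg min_(B < A | (mu B != 0) && (B \subset W :|: A) && (#|B| <= #|A|)%N) #|B :\: W|].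

Definition fragment mu W A := refill mu W A :\: W.

(** It depends on [Z] alone. With [Z = W :|: T] this confines [T] to the subsets of one fixed set,
    however [W] and [A] arose. The default [set0] occurs only if [Z] contains no support set. *)
Definition smallest_in mu Z : {set U} :=
  if [pick B : {set U} | (mu B != 0) && (B \subset Z)] is Some B0
  then [arg min_(B < B0 | (mu B != 0) && (B \subset Z)) #|B|] else set0.

Lemma refillP mu W A : mu A != 0 ->
  [/\ mu (refill mu W A) != 0, refill mu W A \subset W :|: A,
      (#|refill mu W A| <= #|A|)%N &
      forall B, mu B != 0 -> B \subset W :|: A -> (#|B| <= #|A|)%N ->
        (#|fragment mu W A| <= #|B :\: W|)%N].
Proof.
move=> A0; rewrite /fragment /refill; case: arg_minnP => [|B /andP[/andP[? ?] ?] H].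
  by rewrite A0 subsetUr leqnn.
by split => // C ? ? ?; apply: H; apply/andP; split => //; apply/andP.
Qed.

Lemma smallest_inP mu Z B : mu B != 0 -> B \subset Z ->
  [/\ mu (smallest_in mu Z) != 0, smallest_in mu Z \subset Z &
      (#|smallest_in mu Z| <= #|B|)%N].
Proof.
move=> B0 BZ; rewrite /smallest_in; case: pickP => [C HC|/(_ B)]; last first.
  by rewrite B0 BZ.
case: arg_minnP => // D /andP[? ?] H; split => //.
by apply: H; rewrite B0.
Qed.

Lemma fragment_sub mu W A : mu A != 0 -> fragment mu W A \subset A.
Proof.
case/(refillP W) => _ sub _ _; apply/subsetP => e; rewrite inE => /andP[eW].
by move=> /(subsetP sub); rewrite inE (negbTE eW).
Qed.

(** Let T be the fragment and B the smallest support set inside W :|: T. The refill lies there too,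
    so B is no larger than [A]. Hence B competes in the choice of the refill, and T has at most |B \
    W| elements. As B \ W lies in T, the two agree. *)
Lemma fragment_smallest mu W A : mu A != 0 ->
  (fragment mu W A \subset smallest_in mu (W :|: fragment mu W A)) /\
  (#|smallest_in mu (W :|: fragment mu W A)| <= #|A|)%N.
Proof.
move=> A0; have [r0 rsub rle rmin] := refillP W A0; set T := fragment mu W A.
have rZ : refill mu W A \subset W :|: T.
  by apply/subsetP => e er; rewrite !inE er andbT orbN.
have [s0 sZ sle] := smallest_inP r0 rZ; set B := smallest_in _ _ in s0 sZ sle *.
have BA : (#|B| <= #|A|)%N by apply: leq_trans rle.
split=> //.
have BWT : B :\: W \subset T.
  by apply/subsetP => e; rewrite inE => /andP[eW /(subsetP sZ)]; rewrite inE (negbTE eW).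
have TB : (#|T| <= #|B :\: W|)%N.
  apply: rmin => //; apply: subset_trans sZ _.
  by rewrite setUS // fragment_sub.
have /eqP <- : B :\: W == T by rewrite eqEcard BWT.
exact: subsetDl.
Qed.

Definition fragment_law mu W T := \sum_(A | fragment mu W A == T) mu A.

Lemma fragment_law_dist mu W : is_dist mu -> is_dist (fragment_law mu W).
Proof.
case=> m0 m1; split=> [T|]; first by apply: sumr_ge0.
by rewrite -[RHS]m1 [RHS](partition_big (fragment mu W) predT) //=.
Qed.

Lemma fragment_law_supp mu W T : fragment_law mu W T != 0 ->
  exists A, mu A != 0 /\ fragment mu W A = T.
Proof.
move=> H; have /existsP[A /andP[A0 /eqP <-]] :
    [exists A, (mu A != 0) && (fragment mu W A == T)].
  apply: contraNT H; rewrite negb_exists => /forallP H; apply/eqP.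
  apply: big1 => A /eqP fA; have := H A; rewrite fA eqxx andbT negbK.
  by move/eqP.
by exists A.
Qed.

Lemma fragment_law_E mu W (f : {set U} -> R) :
  \sum_T fragment_law mu W T * f T = \sum_A mu A * f (fragment mu W A).
Proof.
rewrite [RHS](partition_big (fragment mu W) predT) //=.
apply: eq_bigr => T _; rewrite mulr_suml.
by apply: eq_bigr => A /eqP ->.
Qed.

Lemma fragment_law_spread mu w W : is_dist mu -> spread w mu ->
  spread w (fragment_law mu W).
Proof.
move=> [m0 _] sp S; apply: le_trans (sp S).
rewrite big_mkcond [X in _ <= X]big_mkcond /=.
under eq_bigr => T _ do rewrite -mulrb -[(_ *+ _)]mulr_natr.
rewrite (fragment_law_E mu W (fun T => (S \subset T)%:R)).
apply: ler_sum => A _; have [->|A0] := eqVneq (mu A) 0; first by rewrite mul0r if_same.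
have [sub|_] := boolP (S \subset fragment mu W A); last first.
  by rewrite mulr0; case: ifP.
by rewrite mulr1 (subset_trans sub (fragment_sub W A0)).
Qed.

(** With x = 2t - a this is 1 + x <= 2^x, valid for integers x but not for 0 < x < 1. It turns the
    exponential moment into a bound on expectations without logarithms. *)
Lemma pow4_div_pow2_ge (t a : nat) : 1 + 2 * t%:R - a%:R <= 4 ^+ t / 2 ^+ a :> R.
Proof.
have H (n : nat) : 1 + n%:R <= 2 ^+ n :> R.
  elim: n => [|n IH]; first by rewrite addr0 expr0.
  rewrite exprS -natr1; have : 0 <= n%:R :> R by []; lra.
have -> : (4 : R) = 2 ^+ 2 by rewrite expr2; ring.
rewrite -exprM ler_pdivlMr ?exprn_gt0 //.
have [le|lt] := leqP a (2 * t).
  have -> : (2 * t = (2 * t - a) + a)%N by rewrite subnK.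
  rewrite exprD ler_pM2r ?exprn_gt0 //.
  apply: le_trans (H _); rewrite natrB // natrM; lra.
have E : (a = a - 2 * t + 2 * t)%N by rewrite subnK // ltnW.
rewrite [X in 2 ^+ X]E exprD mulrA.
rewrite -[X in _ <= X]mul1r ler_pM2r ?exprn_gt0 //.
set n := (a - 2 * t)%N.
have -> : 1 + 2 * t%:R - a%:R = 1 - n%:R :> R.
  by rewrite /n natrB ?(ltnW lt) // natrM; ring.
case: n => [|n]; first by rewrite subr0 mul1r expr0.
apply: (@le_trans _ _ 0); last by [].
rewrite mulr_le0_ge0 ?exprn_ge0 //.
by rewrite subr_le0 ler1n.
Qed.

Lemma fragment_size mu w : is_dist mu -> spread w mu ->
  (forall e, 0 <= 4 * w e <= 1) ->
  \sum_W bern (fun e => 4 * w e) W * \sum_T fragment_law mu W T * #|T|%:R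
    <= 2^-1 * \sum_A mu A * #|A|%:R.
Proof.
move=> dm sp x01; set x := (X in bern X).
pose s := smallest_in mu.
pose G W T : R := 4 ^+ #|T| / 2 ^+ #|s (W :|: T)|.
have G0 W T : 0 <= G W T by rewrite divr_ge0 ?exprn_ge0.
(* The bound E[4^|T| / 2^|A*|] <= 1, obtained by summing over Z = W :|: T in place of W. *)
have EY : \sum_W bern x W * \sum_A mu A * G W (fragment mu W A) <= 1.
  under eq_bigr => W _ do rewrite -fragment_law_E mulr_sumr.
  pose F Z T : R := if T \subset s Z then bern x Z / 2 ^+ #|s Z| else 0.
  have F0 Z T : 0 <= F Z T.
    by rewrite /F; case: ifP => // _; rewrite divr_ge0 ?bern_ge0 ?exprn_ge0.
  apply: (@le_trans _ _ (\sum_(W : {set U}) \sum_(T : {set U}) (if [disjoint T & W] then F (W :|: T) T else 0) : R)).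
    apply: ler_sum => W _; apply: ler_sum => T _.
    have [l0|l0] := eqVneq (fragment_law mu W T) 0.
      by rewrite l0 mul0r mulr0; case: ifP.
    have [A [A0 fA]] := fragment_law_supp l0.
    have dTW : [disjoint T & W].
      rewrite -fA /fragment disjoints_subset; apply/subsetP => e.
      by rewrite !inE => /andP[].
    have [sub _] := fragment_smallest W A0; rewrite fA in sub.
    rewrite dTW /F sub /G mulrA mulrA ler_pM2r ?invr_gt0 ?exprn_gt0 //.
    apply: le_trans (bern_disjointU x01 dTW); rewrite -mulrA ler_wpM2l ?bern_ge0 //.
    (* Spread charges w for each element of [T]; the factor 4 per element raises this to x = 4w,
       just what adding [T] to [W] costs. *)
    have -> : \prod_(e in T) x e = 4 ^+ #|T| * \prod_(e in T) w e.
      by rewrite /x big_split /= prodr_const.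
    rewrite mulrC ler_pM2l ?exprn_gt0 //.
    apply: le_trans (fragment_law_spread W dm sp T).
    rewrite (bigD1 T) //= lerDl sumr_ge0 // => B _.
    by have [] := fragment_law_dist W dm.
  rewrite exchange_big /=.
  apply: (@le_trans _ _ (\sum_T \sum_Z F Z T)).
    apply: ler_sum => T _; rewrite -big_mkcond /=.
    rewrite (eq_bigl (fun W : {set U} => W \in [set W : {set U} | [disjoint T & W]])); last first.
      by move=> W; rewrite inE.
    (* For fixed [T], a set [W] disjoint from it is recovered from the union, so nothing is counted
       twice. *)
    rewrite -(big_imset (fun Z => F Z T)) /=; last first.
      move=> W1 W2; rewrite !inE => d1 d2 eqW; apply/setP => e.
      have := congr1 (fun Z : {set U} => e \in Z) eqW; rewrite !inE.
      have [eT|_] := boolP (e \in T); last by rewrite !orbF.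
      by rewrite (disjointFr d1 eT) (disjointFr d2 eT).
    rewrite [X in _ <= X](bigID [in [set W :|: T | W in [set W : {set U} | [disjoint T & W]]]]) /=.
    by rewrite lerDl sumr_ge0.
  rewrite exchange_big /= -(bern_sum1 x); apply: ler_sum => Z _.
  (* Given [Z] there are 2^|s Z| candidates [T], which cancels the denominator. *)
  rewrite -big_mkcond /= sumr_const -[X in X <= _]mulr_natr -mulrA ler_piMr ?bern_ge0 //.
  rewrite (eq_card (B := powerset (s Z))) => [|T]; last by rewrite powersetE.
  by rewrite card_powerset natrX mulVf // expf_neq0 // pnatr_eq0.
have [m0 m1] := dm.
suff : 2 * (\sum_W bern x W * \sum_T fragment_law mu W T * #|T|%:R) -
        \sum_A mu A * #|A|%:R <= 0 by lra.
suff : 1 + (2 * (\sum_W bern x W * \sum_T fragment_law mu W T * #|T|%:R) -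
        \sum_A mu A * #|A|%:R) <= 1 by lra.
apply: le_trans EY.
have -> : 1 + (2 * (\sum_W bern x W * \sum_T fragment_law mu W T * #|T|%:R) -
        \sum_A mu A * #|A|%:R) =
    \sum_W bern x W * \sum_A mu A * (1 + 2 * #|fragment mu W A|%:R - #|A|%:R).
  under [in RHS]eq_bigr => W _.
    under eq_bigr => A _ do rewrite mulrBr mulrDr mulr1 mulrCA.
    rewrite big_split /= big_split /= m1 sumrN -mulr_sumr.
    rewrite -(fragment_law_E mu W (fun T => #|T|%:R)) mulrBr mulrDr mulr1 mulrCA.
    over.
  by rewrite big_split big_split /= sumrN -mulr_suml bern_sum1 mul1r -mulr_sumr addrA.
apply: ler_sum => W _; rewrite ler_wpM2l ?bern_ge0 //.
apply: ler_sum => A _; have [->|A0] := eqVneq (mu A) 0; first by rewrite !mul0r.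
rewrite ler_wpM2l //; apply: le_trans (pow4_div_pow2_ge _ _).
by rewrite lerD2l lerN2 ler_nat; have [_] := fragment_smallest W A0.
Qed.

Definition misses mu W := [forall A : {set U}, (mu A != 0) ==> ~~ (A \subset W)].

Lemma bern0 W : bern (fun=> 0) W = (W == set0)%:R.
Proof.
rewrite /bern; have [->|/set0Pn[e eW]] := eqVneq.
  by rewrite big1 // => e _; rewrite inE subr0.
by rewrite (bigD1 e) //= eW mul0r.
Qed.

(** One random round is exposed and the law is replaced by that of its fragments, which halves the
    expected size; the remaining rounds are left to the induction. *)
Lemma misses_bound (N : nat) w : (forall e, 0 <= 4 * w e <= 1) ->
  forall mu, is_dist mu -> spread w mu ->
  \sum_(W | misses mu W) bern (fun e => 1 - (1 - 4 * w e) ^+ N) W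
    <= 2^-1 ^+ N * \sum_A mu A * #|A|%:R.
Proof.
move=> x01; elim: N => [|N IH] mu dm sp.
  under eq_bigr => W _.
    have -> : (fun e => 1 - (1 - 4 * w e) ^+ 0) = fun=> 0.
      by apply/funext => e; rewrite expr0 subrr.
    rewrite bern0; over.
  rewrite expr0 mul1r; have [m0 m1] := dm.
  rewrite big_mkcond /= (bigD1 set0) //= eqxx big1 ?addr0; last first.
    by move=> W /negbTE ->; case: ifP.
  (* Zero rounds give the empty set. If it contains no support set, all of these have size at least
     1, so the expected size bounds the probability 1. *)
  case: ifP => [/forallP H|_]; last by apply: sumr_ge0 => A _; rewrite mulr_ge0.
  rewrite -[X in X <= _]m1; apply: ler_sum => A _; have [->|A0] := eqVneq (mu A) 0.
    by rewrite mul0r.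
  rewrite ler_peMr // ler1n card_gt0; have /implyP/(_ A0) := H A.
  by apply: contraNneq => ->; rewrite sub0set.
pose x e : R := 4 * w e; pose y e : R := 1 - (1 - 4 * w e) ^+ N.
have -> : (fun e => 1 - (1 - 4 * w e) ^+ N.+1) = fun e => x e + y e - x e * y e.
  by apply/funext => e; rewrite /x /y exprS; ring.
have y01 e : 0 <= y e <= 1.
  have /andP[? ?] := x01 e; rewrite subr_ge0 gerBl exprn_ile1 ?exprn_ge0 //; lra.
rewrite big_mkcond /=.
under eq_bigr => W _ do rewrite -mulrb -[(_ *+ _)]mulr_natr.
rewrite -(bern_conv x y (fun W => (misses mu W)%:R)).
apply: (@le_trans _ _ (\sum_W bern x W *
    (2^-1 ^+ N * \sum_T fragment_law mu W T * #|T|%:R))).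
  apply: ler_sum => W _; under eq_bigr => W2 _ do rewrite -mulrA.
  rewrite -mulr_sumr ler_wpM2l ?bern_ge0 //.
  apply: le_trans (IH _ (fragment_law_dist W dm) (fragment_law_spread W dm sp)).
  rewrite [X in _ <= X]big_mkcond /=; apply: ler_sum => W2 _.
  have y0 := bern_ge0 W2 y01.
  have [m|_] := boolP (misses mu _); last by rewrite mulr0; case: ifP.
  (* A fragment of [A] inside [W2] would put its refill inside [W :|: W2]; so if the union misses
     [mu], then [W2] misses the fragments. *)
  rewrite ifT ?mulr1 //; apply/forallP => T; apply/implyP => T0; apply/negP => TW2.
  have [A [A0 fA]] := fragment_law_supp T0; have [r0 rsub _ _] := refillP W A0.
  move/forallP/(_ (refill mu W A)): m; rewrite r0 /= => /negP; apply.
  apply/subsetP => e er; rewrite inE; have [//|eW] := boolP (e \in W).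
  by rewrite (subsetP TW2) // -fA inE eW er.
rewrite (eq_bigr (fun W => 2^-1 ^+ N * (bern x W * \sum_T fragment_law mu W T * #|T|%:R))) => [|W _]; last by rewrite mulrCA.
rewrite -mulr_sumr exprSr -mulrA ler_wpM2l ?exprn_ge0 ?invr_ge0 //.
exact: fragment_size.
Qed.

(** Coupling: [z] solves x + z - xz = y, so a random set of density y is one of density x united
    with an independent set. Solving requires x < 1. *)
Lemma bern_mono x y (P : pred {set U}) : (forall e, 0 <= x e < 1) ->
  (forall e, x e <= y e <= 1) -> (forall W Z : {set U}, W \subset Z -> P Z -> P W) ->
  \sum_(W | P W) bern y W <= \sum_(W | P W) bern x W.
Proof.
move=> x01 xy dP; pose z e := (y e - x e) / (1 - x e).
have D e : 0 < 1 - x e by rewrite subr_gt0; have /andP[] := x01 e.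
have -> : y = fun e => x e + z e - x e * z e.
  by apply/funext => e; rewrite /z; field; rewrite lt0r_neq0.
have z01 e : 0 <= z e <= 1.
  have /andP[? ?] := xy e.
  rewrite divr_ge0 ?subr_ge0 //=; last by apply: ltW; rewrite -subr_gt0.
  by rewrite ler_pdivrMr // mul1r lerD2r.
have x01' e : 0 <= x e <= 1 by have /andP[-> /ltW ->] := x01 e.
rewrite big_mkcond [X in _ <= X]big_mkcond /=.
under eq_bigr => W _ do rewrite -mulrb -[(_ *+ _)]mulr_natr.
under [X in _ <= X]eq_bigr => W _ do rewrite -mulrb -[(_ *+ _)]mulr_natr.
rewrite -bern_conv; apply: ler_sum => W _.
under eq_bigr => W2 _ do rewrite -mulrA.
rewrite -mulr_sumr ler_wpM2l ?bern_ge0 //.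
rewrite -[X in _ <= X]mul1r -[X in _ <= X * _](bern_sum1 z) mulr_suml.
apply: ler_sum => W2 _; rewrite ler_wpM2l ?bern_ge0 // ler_nat.
by have [p|//] := boolP (P (W :|: W2)); rewrite (dP _ _ _ p) ?subsetUl.
Qed.

(** The union of N rounds has density 1 - (1 - 4w)^N, at most 4Nw by Bernoulli's inequality. With N
    of order log n this is the source of the logarithm in the theorem. *)
Lemma spread_threshold (N : nat) w y mu (l : R) :
  (forall e, 0 <= w e) -> (forall e, 4 * w e < 1) ->
  (forall e, (4 * N)%:R * w e <= y e <= 1) ->
  is_dist mu -> spread w mu -> (forall A, mu A != 0 -> #|A|%:R <= l) ->
  \sum_(W | misses mu W) bern y W <= l / 2 ^+ N.
Proof.
move=> w0 w1 hy dm sp ml.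
have w01 e : 0 <= 4 * w e <= 1 by rewrite mulr_ge0 // ltW.
pose x e := 1 - (1 - 4 * w e) ^+ N.
have P0 e : 0 < (1 - 4 * w e) ^+ N by rewrite exprn_gt0 // subr_gt0.
apply: le_trans (bern_mono (x := x) _ _ _) _.
- move=> e; rewrite /x subr_ge0 gtrBl P0 andbT.
  by have /andP[? ?] := w01 e; rewrite exprn_ile1 ?subr_ge0 // gerBl.
- move=> e; have /andP[h1 ->] := hy e; rewrite andbT; apply: le_trans h1.
  rewrite /x lerBlDr -lerBlDl.
  have H : 1 - N%:R * (4 * w e) <= (1 - 4 * w e) ^+ N.
    elim: (N) => [|n IHn]; first by rewrite mul0r subr0 expr0.
    have /andP[a0 a1] := w01 e; rewrite exprS -natr1.
    apply: (@le_trans _ _ ((1 - 4 * w e) * (1 - n%:R * (4 * w e)))).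
      have : 0 <= n%:R * ((4 * w e) * (4 * w e)) by rewrite !mulr_ge0.
      lra.
    by rewrite ler_wpM2l ?subr_ge0.
  by apply: le_trans H; rewrite natrM; lra.
- move=> W Z WZ /forallP H; apply/forallP => A; apply/implyP => A0.
  by apply: contra (implyP (H A) A0) => AW; apply: subset_trans WZ.
apply: le_trans (misses_bound N w01 dm sp) _.
rewrite mulrC exprVn ler_pM2r ?invr_gt0 ?exprn_gt0 //.
have [m0 m1] := dm; rewrite -[l]mul1r -[X in _ <= X * _]m1 mulr_suml; apply: ler_sum => A _.
have [->|A0] := eqVneq (mu A) 0; first by rewrite !mul0r.
by rewrite ler_wpM2l ?ml.
Qed.

End SpreadTheorem.

(** * Calculus of spread laws: point masses, successive choices, averages *)

Section SpreadCombinators.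
Variables (R : realType) (U : finType).
Implicit Types (w : U -> R) (mu : {set U} -> R) (P : {set U} -> Prop) (M S : {set U}).

(** The law is hidden: later constructions compose randomised steps and track only the weights and
    the property [P] guaranteed for every outcome. *)
Definition has_spread w P :=
  exists mu, [/\ is_dist mu, spread w mu & forall M, mu M != 0 -> P M].

Lemma has_spread_weaken w w' P P' : (forall e, 0 <= w e <= w' e) ->
  (forall M, P M -> P' M) -> has_spread w P -> has_spread w' P'.
Proof.
move=> ww PP [mu [dm sp mP]]; exists mu; split=> // [S|M /mP/PP //].
by apply: le_trans (sp S) _; apply: ler_prod.
Qed.

(** A deterministic choice is affordable if the weights on [M] are at least 1: for the empty
    matching, on ground sets of bounded size, or as an ingredient of an average. *)
Lemma has_spread_point w P M : P M -> (forall e, 0 <= w e) ->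
  (forall e, e \in M -> 1 <= w e) -> has_spread w P.
Proof.
move=> PM w0 w1; exists (fun M' => (M' == M)%:R); split.
- split=> // ; rewrite (bigD1 M) //= eqxx big1 ?addr0 // => M' /negbTE ->.
  by [].
- move=> S; have [SM|SM] := boolP (S \subset M); last first.
    rewrite big1 ?prodr_ge0 // => M' SM'.
    by case: eqVneq => // eM; rewrite eM (negbTE SM) in SM'.
  rewrite (bigD1 M) //= eqxx big1 ?addr0; last by move=> M' /andP[_ /negbTE ->].
  apply: (big_ind (fun x => 1 <= x)) => // [x y x1 y1|e /(subsetP SM)/w1 //].
  by rewrite -[1]mulr1 ler_pM.
- by move=> M0; case: (eqVneq M0 M) => [->//|_]; rewrite eqxx.
Qed.

Lemma prod_addr_powerset (f g : U -> R) S :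
  \prod_(e in S) (f e + g e) =
    \sum_(J in powerset S) (\prod_(e in J) f e) * \prod_(e in S :\: J) g e.
Proof.
rewrite (big_mkcond (fun e => e \in S)) /=.
have -> : \prod_i (if i \in S then f i + g i else 1) =
   \prod_i ((if i \in S then f i else 0) + (if i \in S then g i else 1)).
  by apply: eq_bigr => e _; case: ifP => // _; rewrite add0r.
rewrite bigA_distr (bigID [in powerset S]) /= [X in _ + X]big1 ?addr0; last first.
  move=> J; rewrite powersetE => /subsetPn[e eJ eS].
  by rewrite (bigD1 e) //= eJ (negbTE eS) mul0r.
apply: eq_big => [//|J]; rewrite powersetE => JS.
rewrite (big_mkcond (fun e => e \in J)) (big_mkcond (fun e => e \in S :\: J)).
rewrite -big_split; apply: eq_bigr => e _ /=; rewrite inE.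
by have [/(subsetP JS) ->|_] := boolP (e \in J); rewrite /= ?mulr1 ?mul1r.
Qed.

(** If [S] lies in the union, it splits into J = S :&: M1 and a rest contained in [M2]. Summing over
    all J gives the expansion of the product of the sums w1 + w2. The second law may depend on
    [M1]. *)
Lemma has_spread_bind w1 w2 (P1 P : {set U} -> Prop) : (forall e, 0 <= w1 e) -> (forall e, 0 <= w2 e) ->
  has_spread w1 P1 ->
  (forall M1, P1 M1 -> has_spread w2 (fun M2 => P (M1 :|: M2))) ->
  has_spread (fun e => w1 e + w2 e) P.
Proof.
move=> w10 w20 [mu [[m0 m1] sp mP]] H.
have [kap kapP] : exists kap : {set U} -> {set U} -> R, forall M1, mu M1 != 0 ->
    [/\ is_dist (kap M1), spread w2 (kap M1) &
        forall M2, kap M1 M2 != 0 -> P (M1 :|: M2)].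
  have /choice[kap kapP] : forall M1, exists k : {set U} -> R, mu M1 != 0 ->
      [/\ is_dist k, spread w2 k & forall M2, k M2 != 0 -> P (M1 :|: M2)].
    move=> M1; have [_|M10] := eqVneq (mu M1) 0; first by exists (fun=> 0).
    by have [k Hk] := H _ (mP _ M10); exists k.
  by exists kap.
pose nu M := \sum_M1 \sum_(M2 | M1 :|: M2 == M) mu M1 * kap M1 M2.
have mk0 M1 M2 : 0 <= mu M1 * kap M1 M2.
  have [->|n0] := eqVneq (mu M1) 0; first by rewrite mul0r.
  by have [[k0 _] _ _] := kapP _ n0; rewrite mulr_ge0.
have nuE (f : {set U} -> R) :
    \sum_M nu M * f M = \sum_M1 \sum_M2 mu M1 * kap M1 M2 * f (M1 :|: M2).
  under eq_bigr => M _ do rewrite mulr_suml.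
  rewrite exchange_big /=; apply: eq_bigr => M1 _.
  rewrite [RHS](partition_big (fun M2 => M1 :|: M2) predT) //=.
  apply: eq_bigr => M _; rewrite mulr_suml.
  by apply: eq_bigr => M2 /eqP ->.
exists nu; split.
- split=> [M|]; first by do 2! apply: sumr_ge0 => ? _.
  under eq_bigr => M _ do rewrite -[nu M]mulr1.
  rewrite (nuE (fun=> 1)) -[RHS]m1; apply: eq_bigr => M1 _.
  under eq_bigr => M2 _ do rewrite mulr1.
  rewrite -mulr_sumr; have [->|n0] := eqVneq (mu M1) 0; first by rewrite mul0r.
  by have [[_ ->] _ _] := kapP _ n0; rewrite mulr1.
- move=> S; rewrite big_mkcond /=.
  under eq_bigr => M _ do rewrite -mulrb -[(_ *+ _)]mulr_natr.
  rewrite (nuE (fun M => (S \subset M)%:R)).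
  rewrite prod_addr_powerset.
  apply: (@le_trans _ _ (\sum_(J in powerset S) \sum_(M1 : {set U} | J \subset M1)
      \sum_(M2 : {set U} | S :\: J \subset M2) mu M1 * kap M1 M2)).
    apply: (@le_trans _ _ (\sum_(M1 : {set U}) \sum_(M2 : {set U}) \sum_(J in powerset S)
      (if (J \subset M1) && (S :\: J \subset M2) then mu M1 * kap M1 M2 else 0))).
      apply: ler_sum => M1 _; apply: ler_sum => M2 _.
      have [SM|_] := boolP (S \subset M1 :|: M2); last first.
        by rewrite mulr0; apply: sumr_ge0 => J _; case: ifP.
      rewrite mulr1 (bigD1 (S :&: M1)) ?powersetE ?subsetIl //= subsetIr /=.
      have -> : S :\: (S :&: M1) \subset M2.
        apply/subsetP => e; rewrite !inE => /andP[h eS]; rewrite eS /= in h.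
        by have := subsetP SM _ eS; rewrite inE (negbTE h).
      by rewrite lerDl sumr_ge0 // => J _; case: ifP.
    under eq_bigr => M1 _ do rewrite exchange_big /=.
    rewrite exchange_big /=; apply: ler_sum => J _.
    rewrite [X in _ <= X]big_mkcond /=; apply: ler_sum => M1 _.
    case: (J \subset M1) => /=; last by rewrite big1.
    by rewrite [X in _ <= X]big_mkcond.
  apply: ler_sum => J; rewrite powersetE => JS.
  apply: (@le_trans _ _ (\sum_(M1 : {set U} | J \subset M1) mu M1 * \prod_(e in S :\: J) w2 e)).
    apply: ler_sum => M1 _; rewrite -mulr_sumr.
    have [->|n0] := eqVneq (mu M1) 0; first by rewrite !mul0r.
    by have [_ spk _] := kapP _ n0; rewrite ler_wpM2l.
  by rewrite -mulr_suml ler_wpM2r ?prodr_ge0.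
- move=> M; have [[M1 M2] /= /andP[/eqP <- n0] _|H0] :=
    pickP (fun p => (p.1 :|: p.2 == M) && (mu p.1 * kap p.1 p.2 != 0)); last first.
    rewrite /nu big1 ?eqxx // => M1 _; apply: big1 => M2 eM.
    by have /negbT := H0 (M1, M2); rewrite /= eM negbK => /eqP.
  rewrite mulf_eq0 negb_or in n0; have /andP[a b] := n0.
  by have [_ _ H2] := kapP _ a; apply: H2.
Qed.

(** A uniform average over [G]. The inequality is demanded only for [S] inside an admissible
    outcome, since other sets have probability 0; in the applications [S] is thereby a matching,
    whose edges are disjoint. *)
Lemma has_spread_mix (T : finType) (G : {set T}) (w : U -> R) (wt : T -> U -> R) P :
  G != set0 -> (forall e, 0 <= w e) ->
  (forall t, t \in G -> has_spread (wt t) P) ->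
  (forall S M, P M -> S \subset M ->
     \sum_(t in G) \prod_(e in S) wt t e <= #|G|%:R * \prod_(e in S) w e) ->
  has_spread w P.
Proof.
move=> G0 w0 H Hw.
have [kap kapP] : exists kap : T -> {set U} -> R, forall t, t \in G ->
    [/\ is_dist (kap t), spread (wt t) (kap t) & forall M, kap t M != 0 -> P M].
  have /choice[kap kapP] : forall t, exists k : {set U} -> R, t \in G ->
      [/\ is_dist k, spread (wt t) k & forall M, k M != 0 -> P M].
    move=> t; have [tG|tG] := boolP (t \in G); last by exists (fun=> 0).
    by have [k Hk] := H _ tG; exists k.
  by exists kap.
have c0 : 0 < #|G|%:R :> R by rewrite ltr0n card_gt0.
pose nu M := #|G|%:R^-1 * \sum_(t in G) kap t M.
have nuP M : nu M != 0 -> P M.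
  have [/existsP[t /andP[tG n0]] _|H0] := boolP [exists t, (t \in G) && (kap t M != 0)].
    by have [_ _] := kapP _ tG; apply.
  rewrite /nu big1 ?mulr0 ?eqxx // => t tG.
  by move: H0; rewrite negb_exists => /forallP/(_ t); rewrite tG negbK => /eqP.
have nu0 M : 0 <= nu M.
  rewrite mulr_ge0 ?invr_ge0 // sumr_ge0 // => t tG.
  by have [[k0 _] _ _] := kapP _ tG.
exists nu; split=> //.
- split=> //; rewrite -mulr_sumr exchange_big /=.
  rewrite (eq_bigr (fun=> 1)) => [|t tG]; last by have [[]] := kapP _ tG.
  by rewrite sumr_const mulVf ?lt0r_neq0.
- move=> S; have [/existsP[M /andP[SM n0]]|H0] :=
      boolP [exists M : {set U}, (S \subset M) && (nu M != 0)]; last first.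
    rewrite big1 ?prodr_ge0 // => M SM.
    by move: H0; rewrite negb_exists => /forallP/(_ M); rewrite SM negbK => /eqP.
  rewrite -mulr_sumr exchange_big /= ler_pdivrMl //.
  apply: le_trans (Hw _ _ (nuP _ n0) SM); apply: ler_sum => t tG.
  by have [_ sp _] := kapP _ tG.
Qed.

End SpreadCombinators.

(** * Bounded differences inequality *)

Lemma sum_cst (R : realType) (X : finType) (c : R) : \sum_(x : X) c = c * #|X|%:R.
Proof. by rewrite sumr_const -[LHS]mulr_natr. Qed.

Section BoundedDifferences.
Variables (R : realType) (I T : finType).
Hypothesis T0 : (0 < #|T|)%N.
Implicit Types (f g : {ffun I -> T} -> R) (x y : {ffun I -> T}) (c : R).

Definition upd x i t : {ffun I -> T} := [ffun j => if j == i then t else x j].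

(** Conditional expectation given all coordinates except [i], kept as a function on the full
    product. *)
Definition coord_avg i f x : R := (\sum_t f (upd x i t)) / #|T|%:R.

(** One side suffices: undoing the update exchanges the two values. *)
Definition bounded_diff c f := forall x i t, f x - f (upd x i t) <= c.

Lemma upd_upd x i t t' : upd (upd x i t) i t' = upd x i t'.
Proof. by apply/ffunP => j; rewrite !ffunE; case: eqP. Qed.

Lemma upd_id x i : upd x i (x i) = x.
Proof. by apply/ffunP => j; rewrite !ffunE; case: eqP => [->|]. Qed.

Lemma updC x i j t t' : i != j -> upd (upd x i t) j t' = upd (upd x j t') i t.
Proof.
move=> ij; apply/ffunP => l; rewrite !ffunE.
by case: (eqVneq l j) => [->|//]; rewrite eq_sym (negbTE ij).
Qed.

Let T0R : 0 < #|T|%:R :> R. Proof. by rewrite ltr0n. Qed.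

Lemma sum_coord_avg i f : \sum_x coord_avg i f x = \sum_x f x.
Proof.
rewrite /coord_avg -mulr_suml.
have -> : \sum_x \sum_t f (upd x i t) = \sum_x \sum_(t : T) f x.
  rewrite !pair_bigA /=.
  rewrite [RHS](reindex_inj (h := fun p : {ffun I -> T} * T => (upd p.1 i p.2, p.1 i))) //.
  apply: (can_inj (g := fun p => (upd p.1 i p.2, p.1 i))) => -[x t] /=.
  by rewrite upd_upd upd_id ffunE eqxx.
under [X in X / _]eq_bigr => x _ do rewrite sumr_const -mulr_natr.
by rewrite -mulr_suml mulfK // lt0r_neq0.
Qed.

Lemma expR_quad (x : R) : x <= 2^-1 -> expR x <= 1 + x + 2 * x ^+ 2.
Proof.
move=> x2; have h := @expR_ge1Dx R (- x).
have x1 : 0 < 1 - x by lra.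
have -> : expR x = (expR (- x))^-1 by rewrite expRN invrK.
have le1 : (expR (- x))^-1 <= (1 - x)^-1 by rewrite lef_pV2 // posrE ?expR_gt0.
apply: le_trans le1 _; rewrite -[(1 - x)^-1]mul1r ler_pdivrMr //.
have -> : (1 + x + 2 * x ^+ 2) * (1 - x) = 1 + x ^+ 2 * (1 - 2 * x) by ring.
by rewrite lerDl mulr_ge0 ?sqr_ge0 //; lra.
Qed.

(** A weak form of Hoeffding's lemma: the deviations from the mean [m] are at most [c] and average
    to 0, so only the quadratic term of [expR_quad] remains. *)
Lemma avg_expR c (u : T -> R) : c <= 2^-1 -> (forall t t', u t - u t' <= c) ->
  (\sum_t expR (u t)) / #|T|%:R <= expR ((\sum_t u t) / #|T|%:R + 2 * c ^+ 2).
Proof.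
move=> c2 uc; set m := (\sum_t u t) / _.
have c0 : 0 <= c by move/card_gt0P: T0 => [t _]; have := uc t t; rewrite subrr.
have um t : `|u t - m| <= c.
  rewrite /m -[u t](mulfK (lt0r_neq0 T0R)) mulr_natr -sumr_const -mulrBl -sumrB.
  rewrite normrM [`|_^-1|]gtr0_norm ?invr_gt0 // ler_pdivrMr //.
  apply: le_trans (ler_norm_sum _ _ _) _.
  rewrite mulr_natr -sumr_const; apply: ler_sum => t' _.
  by rewrite ler_norml uc andbT lerNl opprB.
have -> : \sum_t expR (u t) = expR m * \sum_t expR (u t - m).
  by rewrite mulr_sumr; apply: eq_bigr => t _; rewrite -expRD addrC subrK.
rewrite expRD -mulrA ler_pM2l ?expR_gt0 //.
apply: le_trans (expR_ge1Dx _); rewrite ler_pdivrMr //.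
apply: (@le_trans _ _ (\sum_t (1 + (u t - m) + 2 * c ^+ 2))).
  apply: ler_sum => t _; have := um t; rewrite ler_norml => /andP[h1 h2].
  apply: le_trans (expR_quad _) _; first lra.
  rewrite lerD2l ler_pM2l // -[X in X <= _]real_normK ?num_real //.
  by rewrite lerXn2r ?nnegrE.
rewrite big_split big_split /= !sumr_const sumrB sumr_const.
have -> : \sum_t u t = m * #|T|%:R by rewrite mulfVK // lt0r_neq0.
rewrite (_ : #|xpredT| = #|T|) // -[m *+ _]mulr_natr -[(_ * _) *+ _]mulr_natr subrr addr0.
by rewrite [X in _ <= X]mulrDl mul1r.
Qed.

Lemma bounded_diff_coord_avg c i f : 0 <= c -> bounded_diff c f ->
  bounded_diff c (coord_avg i f).
Proof.
move=> c0 bf x j t; rewrite /coord_avg -mulrBl -sumrB ler_pdivrMr //.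
rewrite mulr_natr -sumr_const; apply: ler_sum => t' _.
have [->|ij] := eqVneq j i; first by rewrite upd_upd subrr.
by rewrite updC // bf.
Qed.

Lemma expR_coord_avg c i f : c <= 2^-1 -> bounded_diff c f ->
  \sum_x expR (f x) <= expR (2 * c ^+ 2) * \sum_x expR (coord_avg i f x).
Proof.
move=> c2 bf; rewrite -(sum_coord_avg i) mulr_sumr; apply: ler_sum => x _.
rewrite mulrC -expRD; apply: avg_expR => // t t'.
by rewrite -(upd_upd x i t t') bf.
Qed.

(** Replaces the martingale: coordinates are averaged out one by one, each costing a factor exp(2
    c^2), and the differences stay bounded. Once all are gone the function is constant, equal to its
    mean. *)
Lemma coord_avg_seq c f (s : seq I) : 0 <= c <= 2^-1 -> bounded_diff c f ->
  let g := foldr coord_avg f s in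
  [/\ bounded_diff c g, \sum_x g x = \sum_x f x,
      \sum_x expR (f x) <= expR (2 * c ^+ 2) ^+ size s * \sum_x expR (g x) &
      forall x i t, i \in s -> g (upd x i t) = g x].
Proof.
move=> /andP[c0 c2] bf; elim: s => [|j s [IH1 IH2 IH3 IH4]] /=.
  by split=> //; rewrite expr0 mul1r.
split; first exact: bounded_diff_coord_avg.
- by rewrite sum_coord_avg.
- apply: le_trans IH3 _; rewrite [_ ^+ (size s).+1]exprSr -mulrA ler_pM2l ?exprn_gt0 ?expR_gt0 //.
  exact: expR_coord_avg.
- move=> x i t; rewrite inE /coord_avg => His; congr (_ / _).
  apply: eq_bigr => t' _; have [->|ij] := eqVneq i j; first by rewrite upd_upd.
  by rewrite updC // IH4 //; move: His; rewrite (negbTE ij).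
Qed.

Lemma coord_avg_enum f x y : (forall x i t, f (upd x i t) = f x) -> f x = f y.
Proof.
move=> H.
suff : forall s : seq I, exists2 z, f z = f x & forall i, i \in s -> z i = y i.
  move=> /(_ (enum I))[z <- zy]; congr f; apply/ffunP => i.
  by rewrite zy ?mem_enum.
elim=> [|i s [z zx zy]]; first by exists x.
exists (upd z i (y i)); first by rewrite H.
by move=> j; rewrite ffunE inE; case: eqP => [->//|_] /=; apply: zy.
Qed.

Lemma mcdiarmid_exp c f : 0 <= c <= 2^-1 -> bounded_diff c f ->
  \sum_x expR (f x) <=
    #|{: {ffun I -> T}}|%:R *
    expR ((\sum_x f x) / #|{: {ffun I -> T}}|%:R + 2 * #|I|%:R * c ^+ 2).
Proof.
move=> hc bf; have [_ Es Ee Hi] := coord_avg_seq (enum I) hc bf.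
set g := foldr _ _ _ in Es Ee Hi.
have N0 : 0 < #|{: {ffun I -> T}}|%:R :> R by rewrite ltr0n card_ffun expn_gt0 T0.
have gE x : g x = (\sum_x f x) / #|{: {ffun I -> T}}|%:R.
  have E y : g y = g x by apply: coord_avg_enum => z i t; rewrite Hi // mem_enum.
  rewrite -Es (eq_bigr (fun=> g x)) => [|y _]; last exact: E.
  by rewrite sum_cst mulfK ?lt0r_neq0.
apply: le_trans Ee _; rewrite (eq_bigr (fun=> expR ((\sum_x f x) / #|{: {ffun I -> T}}|%:R))); last first.
  by move=> x _; rewrite gE.
set m := _ / _; set N := #|_|%:R in N0 *; rewrite sum_cst -cardE -/N [expR m * N]mulrC mulrCA ler_pM2l //.
rewrite mulrC -expRM_natl -expRD.
by rewrite mulrCA mulrA.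
Qed.

Lemma mcdiarmid_lower_tail c tau f : 0 < c -> 0 <= tau <= 2 * #|I|%:R * c ->
  (0 < #|I|)%N -> bounded_diff c f ->
  #|[set x | f x <= (\sum_x f x) / #|{: {ffun I -> T}}|%:R - tau]|%:R <=
  #|{: {ffun I -> T}}|%:R * expR (- (tau ^+ 2 / (8 * #|I|%:R * c ^+ 2))).
Proof.
move=> c0 /andP[t0 tc] I0; set m := _ / _; set N := #|{: _}|%:R => bf.
have I0R : 0 < #|I|%:R :> R by rewrite ltr0n.
have N0 : 0 < N by rewrite ltr0n card_ffun expn_gt0 T0.
(* The minimiser of 2 |I| c^2 lam^2 - lam tau; the upper bound on [tau] ensures lam c <= 1/2. *)
pose lam := tau / (4 * #|I|%:R * c ^+ 2).
have l0 : 0 <= lam by rewrite divr_ge0 // mulr_ge0 ?sqr_ge0 // mulr_ge0.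
pose g x := - (lam * f x).
have bg : bounded_diff (lam * c) g.
  move=> x i t; rewrite /g opprK addrC -mulrBr ler_wpM2l //.
  by rewrite -[X in f _ - f X](upd_id x i) -(upd_upd x i t (x i)) bf.
have lc : 0 <= lam * c <= 2^-1.
  rewrite mulr_ge0 ?(ltW c0) //= /lam mulrAC ler_pdivrMr; last first.
    by rewrite mulr_gt0 ?exprn_gt0 // mulr_gt0.
  have -> : 2^-1 * (4 * #|I|%:R * c ^+ 2) = (2 * #|I|%:R * c) * c by field.
  by rewrite ler_wpM2r // ltW.
have := mcdiarmid_exp lc bg; rewrite -/N.
have -> : \sum_x g x = - (lam * \sum_x f x) by rewrite /g sumrN mulr_sumr.
rewrite mulNr -[lam * _ / N]mulrA -/m => H.
set B := [set x | _].
have Hlow : #|B|%:R * expR (- (lam * (m - tau))) <= \sum_x expR (g x).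
  rewrite mulr_natl -sumr_const big_mkcond /=; apply: ler_sum => x _.
  case: ifP => [|_]; last exact: expR_ge0.
  by rewrite inE => fx; rewrite ler_expR /g lerN2 ler_wpM2l.
have := le_trans Hlow H; rewrite -ler_pdivlMr ?expR_gt0 // => H2.
apply: le_trans H2 _; rewrite -[X in X <= _]mulrA ler_pM2l //.
rewrite -expRN opprK -expRD ler_expR le_eqVlt; apply/orP; left; apply/eqP.
by rewrite /lam; field; rewrite !lt0r_neq0.
Qed.

End BoundedDifferences.

(** * Degrees into random transversals *)

Lemma ffact_le_pow n r : (n ^_ r <= n ^ r)%N.
Proof.
elim: r => [|r IH]; first by rewrite ffactn0.
by rewrite ffactnSr expnSr leq_mul // leq_subr.
Qed.

Lemma bin_le_exp n q : ('C(n, q) <= n ^ q)%N.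
Proof.
by apply: leq_trans (ffact_le_pow n q); rewrite -bin_ffact leq_pmulr // fact_gt0.
Qed.

Lemma card_imset2_le (A B C : finType) (f : A -> B -> C) (X : {set A}) (Y : {set B}) :
  (#|[set f x y | x in X, y in Y]| <= #|X| * #|Y|)%N.
Proof. by rewrite -cardsX curry_imset2X; apply: leq_imset_card. Qed.

Lemma card_bigcup_le (I T : finType) (F : I -> {set T}) :
  (#|\bigcup_i F i| <= \sum_i #|F i|)%N.
Proof.
elim/big_rec2: _ => [|i n A _ IH]; first by rewrite cards0.
by apply: leq_trans (leq_card_setU _ _) _; rewrite leq_add2l.
Qed.

Section Degrees.
Variable V : finType.
Implicit Types (S T W X Y e : {set V}) (E : {set {set V}}).

(** [S] need not lie in [X]. This lets vertices outside a core be matched into it, and lets degrees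
    of one [S] into different sets be compared. *)
Definition sdeg E S X := #|[set e in E | (S \subset e) && (e :\: S \subset X)]|.

Lemma card_draws_hit X W q :
  (#|[set T : {set V} | [&& T \subset X, #|T| == q & T :&: W != set0]]| * #|X|
     <= #|W| * #|X| ^ q)%N.
Proof.
case: q => [|q].
  rewrite (_ : [set _ | _] = set0) ?cards0 //; apply/setP => T; rewrite !inE cards_eq0.
  by case: eqP => [->|_]; rewrite ?set0I ?eqxx ?andbF.
rewrite expnSr mulnA leq_mul2r; apply/orP; right.
pose D := [set T : {set V} | T \subset X & #|T| == q].
apply: (@leq_trans #|[set w |: T | w in W, T in D]|).
  apply: subset_leq_card; apply/subsetP => T; rewrite inE => /and3P[TX /eqP cT].
  case/set0Pn => w; rewrite inE => /andP[wT wW].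
  apply/imset2P; exists w (T :\ w) => //; last by rewrite setD1K.
  rewrite inE (subset_trans (subsetDl _ _) TX) /=.
  by move: cT; rewrite (cardsD1 w) wT add1n => -[/eqP].
apply: leq_trans (card_imset2_le _ _ _) _.
by rewrite leq_mul // cards_draws bin_le_exp.
Qed.

Lemma sdeg_mono E S X Y : X \subset Y -> (sdeg E S X <= sdeg E S Y)%N.
Proof.
move=> XY; apply: subset_leq_card; apply/subsetP => e; rewrite !inE.
by case/and3P => -> -> h; rewrite (subset_trans h XY).
Qed.

Lemma card_link k e S : #|e| = k -> S \subset e -> #|e :\: S| = (k - #|S|)%N.
Proof. by move=> <- Se; rewrite cardsD (setIidPr Se). Qed.

Lemma setDl_inj S e e' : S \subset e -> S \subset e' -> e :\: S = e' :\: S -> e = e'.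
Proof.
by move=> /setIidPr h1 /setIidPr h2 h; rewrite -(setID e S) -(setID e' S) h h1 h2.
Qed.

(** The basic robustness estimate: the part of a lost edge outside [S] meets [W], and at most |W|
    |X|^(k - |S| - 1) sets do. Multiplying by |X| avoids division. *)
Lemma sdeg_setD k E S X W : uniform k E ->
  (sdeg E S X * #|X| <= sdeg E S (X :\: W) * #|X| + #|W| * #|X| ^ (k - #|S|))%N.
Proof.
move=> /forall_inP uE; pose H := [set T : {set V} | [&& T \subset X, #|T| == (k - #|S|)%N & T :&: W != set0]].
apply: (@leq_trans ((sdeg E S (X :\: W) + #|H|) * #|X|)).
  rewrite leq_mul2r; apply/orP; right.
  rewrite /sdeg -(cardsID [set e : {set V} | (e :\: S) :&: W == set0] [set e in E | (S \subset e) && (e :\: S \subset X)]).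
  apply: leq_add.
    apply: subset_leq_card; apply/subsetP => e; rewrite !inE.
    case/andP => /and3P[-> -> h1] h2 /=; rewrite subsetD h1 /=.
    by rewrite -setI_eq0.
  rewrite -(card_in_imset (f := fun e => e :\: S)); last first.
    move=> e e'; rewrite !inE => /andP[_ /and3P[_ h _]] /andP[_ /and3P[_ h' _]].
    exact: setDl_inj.
  apply: subset_leq_card; apply/subsetP => T /imsetP[e]; rewrite !inE.
  case/andP => h /and3P[eE Se eX] ->; rewrite eX h andbT /=.
  by rewrite (card_link (k := k)) //; apply/eqP/uE.
by rewrite mulnDl leq_add2l card_draws_hit.
Qed.

End Degrees.

(* [iota] arranges (most of) a vertex set into [M] groups of [b] vertices.  A
   random subset is modelled by choosing one vertex in each group: it has exactly
   [M] elements, its coordinates are independent, and all but a fraction [1 / M]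
   of the edges meet every group at most once. *)
Section Transversals.
Variables (V : finType) (M b : nat) (iota : 'I_M * 'I_b -> V).
Hypothesis iota_inj : injective iota.
Implicit Types (x : {ffun 'I_M -> 'I_b}) (S T Z : {set V}) (E : {set {set V}}).

Definition transv x : {set V} := [set iota (g, x g) | g : 'I_M].

Lemma mem_transv x g i : (iota (g, i) \in transv x) = (x g == i).
Proof.
apply/imsetP/eqP => [[g' _ /iota_inj[-> ->]] //|<-]; by exists g.
Qed.

Lemma card_transv x : #|transv x| = M.
Proof. by rewrite card_imset ?card_ord // => g g' /iota_inj[]. Qed.

Lemma transv_sub x : transv x \subset codom iota.
Proof. by apply/subsetP => v /imsetP[g _ ->]; apply: codom_f. Qed.

Lemma card_agree (I T : finType) (D : {set I}) (x0 : {ffun I -> T}) :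
  #|[set x : {ffun I -> T} | [forall g in D, x g == x0 g]]| = (#|T| ^ (#|I| - #|D|))%N.
Proof.
pose F g := [pred i : T | (g \in D) ==> (i == x0 g)].
transitivity #|family F|.
  apply: eq_card => x; rewrite inE; apply/forall_inP/familyP => H g.
    by rewrite inE; apply/implyP/H.
  by move=> gD; have := H g; rewrite inE gD.
rewrite card_family foldrE big_map big_enum /=.
rewrite (bigID [in D]) /= big1 ?mul1n => [|g gD]; last first.
  by rewrite -(card1 (x0 g)); apply: eq_card => i; rewrite !inE gD.
rewrite (eq_bigr (fun=> #|T|)) => [|g gD]; last first.
  by apply: eq_card => i; rewrite !inE (negbTE gD).
rewrite prod_nat_const -(cardC [in D]) addKn; congr (_ ^ _)%N.
Qed.

Lemma card_transv_containing Z x0 : Z \subset transv x0 ->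
  #|[set x | Z \subset transv x]| = (b ^ (M - #|Z|))%N.
Proof.
move=> Zx0; pose D := [set g | iota (g, x0 g) \in Z].
have -> : #|Z| = #|D|.
  rewrite -(card_imset (f := fun g => iota (g, x0 g)) D); last by move=> g g' /iota_inj[].
  congr #|pred_of_set _|; apply/setP => v; apply/idP/imsetP => [vZ|[g]]; last first.
    by rewrite inE => ? ->.
  by have /imsetP[g _ e] := subsetP Zx0 _ vZ; exists g; rewrite ?inE -?e.
transitivity (#|'I_b| ^ (#|'I_M| - #|D|))%N; last by rewrite !card_ord.
rewrite -(card_agree D x0); congr #|pred_of_set _|; apply/setP => x; rewrite !inE; apply/subsetP/forall_inP => H.
  by move=> g; rewrite inE => /H; rewrite mem_transv.
move=> v vZ; have /imsetP[g _ e] := subsetP Zx0 _ vZ; rewrite e mem_transv.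
by apply: H; rewrite inE -e.
Qed.

Lemma transv_containing_le Z :
  (#|[set x | Z \subset transv x]| * b ^ #|Z| <= b ^ M)%N.
Proof.
have [x0 Zx0|H] := pickP (fun x => Z \subset transv x).
  rewrite (card_transv_containing Zx0) -expnD subnK //.
  by rewrite -(card_transv x0) subset_leq_card.
rewrite (_ : [set x | _] = set0) ?cards0 //.
by apply/setP => x; rewrite !inE H.
Qed.

(** Such a set contains two vertices of one group. Removing one of them, for which there are M b
    possibilities, leaves a set that hits the rest of its group; this costs a fraction 1/M. *)
Lemma nontransversal_card r : (0 < b)%N -> (0 < M)%N ->
  (#|[set T : {set V} | [&& T \subset codom iota, #|T| == r &
       [forall x, ~~ (T \subset transv x)]]]| * M <= (M * b) ^ r)%N.
Proof.
move=> b0 M0; set N := [set T | _].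
have cY : #|[set v in codom iota]| = (M * b)%N.
  by rewrite cardsE card_codom // card_prod !card_ord.
case: r @N => [|r] N.
  rewrite (_ : N = set0) ?cards0 //; apply/setP => T; rewrite !inE cards_eq0.
  case: eqP => [->|_]; rewrite ?andbF //=; apply/negbTE; rewrite negb_and.
  apply/orP; right; rewrite negb_forall; apply/existsP.
  by exists [ffun=> Ordinal b0]; rewrite negbK sub0set.
pose W (p : 'I_M * 'I_b) := [set iota (p.1, i) | i in [set~ p.2]].
pose H p := [set T : {set V} | [&& T \subset [set v in codom iota], #|T| == r & T :&: W p != set0]].
have H1 : N \subset \bigcup_p [set iota p |: T | T in H p].
  apply/subsetP => T; rewrite inE => /and3P[TY cT /forallP nT].
  suff [g [i [i' [ii' h1 h2]]]] : exists g i i', [/\ i != i', iota (g, i) \in T & iota (g, i') \in T].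
    apply/bigcupP; exists (g, i) => //; apply/imsetP; exists (T :\ iota (g, i)); last by rewrite setD1K.
    rewrite inE; apply/and3P; split.
    - by apply/subsetP => v; rewrite !inE => /andP[_ /(subsetP TY)].
    - by move: cT; rewrite (cardsD1 (iota (g, i))) h1 add1n eqSS.
    - apply/set0Pn; exists (iota (g, i')); rewrite !inE h2 andbT.
      rewrite (inj_eq iota_inj) xpair_eqE eqxx eq_sym ii' /=.
      by apply/imsetP; exists i' => //; rewrite !inE eq_sym.
  apply: contrapT => nex.
  pose x : {ffun 'I_M -> 'I_b} := [ffun g => odflt (Ordinal b0) [pick i | iota (g, i) \in T]].
  move/negP: (nT x); apply; apply/subsetP => v vT.
  have /codomP[[g i] e] := subsetP TY _ vT; rewrite e mem_transv ffunE.
  case: pickP => [i' h|/(_ i)]; last by rewrite -e vT.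
  apply/eqP => /=; apply: contrapT => ne; apply: nex; exists g, i', i.
  by rewrite -e; split=> //; apply/eqP.
have cH p : (#|H p| * (M * b) <= b * (M * b) ^ r)%N.
  rewrite -cY; apply: leq_trans (card_draws_hit _ _ _) _; rewrite leq_mul2r.
  apply/orP; right; apply: leq_trans (leq_imset_card _ _) _.
  by rewrite -[b in (_ <= b)%N]card_ord max_card.
have cN : (#|N| <= b * (M * b) ^ r)%N.
  apply: leq_trans (subset_leq_card H1) _.
  apply: leq_trans (card_bigcup_le _) _.
  rewrite -(leq_pmul2l (m := M * b)) ?muln_gt0 ?M0 // mulnC big_distrl /=.
  apply: (@leq_trans (\sum_(p : 'I_M * 'I_b) (b * (M * b) ^ r))).
    apply: leq_sum => p _; apply: leq_trans (cH p); rewrite leq_mul2r leq_imset_card.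
    by rewrite orbT.
  by rewrite sum_nat_const card_prod !card_ord.
apply: (@leq_trans (b * (M * b) ^ r * M)); first by rewrite leq_mul2r cN orbT.
by rewrite expnS [(b * _ * M)%N]mulnC mulnA.
Qed.
End Transversals.

Section TransversalDegrees.
Variables (R : realType) (V : finType) (M b : nat) (iota : 'I_M * 'I_b -> V).
Hypothesis iota_inj : injective iota.
Hypotheses (M0 : (0 < M)%N) (b0 : (0 < b)%N).
Variables (E : {set {set V}}) (k : nat) (S : {set V}).
Hypothesis uE : uniform k E.
Let r := (k - #|S|)%N.
Implicit Types x : {ffun 'I_M -> 'I_b}.

Let iotaY := [set v in codom iota].

(** Double counting: a link set contained in some transversal lies in exactly b^(M - r) of them, and
    the other link sets are few by [nontransversal_card]. Truncated subtraction covers the case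
    where these dominate. *)
Lemma sum_sdeg_transv :
  ((sdeg E S iotaY * M - (M * b) ^ r) * b ^ M <=
    (\sum_x sdeg E S (transv iota x)) * (b ^ r * M))%N.
Proof.
set A := [set e in E | (S \subset e) && (e :\: S \subset iotaY)].
pose N := [set T : {set V} | [&& T \subset codom iota, #|T| == r &
       [forall x, ~~ (T \subset transv iota x)]]].
have [rM|rM] := leqP r M; last first.
  suff -> : (sdeg E S iotaY * M - (M * b) ^ r = 0)%N by rewrite mul0n.
  apply/eqP; rewrite subn_eq0; have := nontransversal_card iota_inj r b0 M0.
  apply: leq_trans; rewrite leq_mul2r; apply/orP; right.
  rewrite /sdeg -/A -[X in (X <= _)%N](card_in_imset (f := fun e => e :\: S)); last first.
    by move=> e e'; rewrite !inE => /and3P[_ h _] /and3P[_ h' _]; apply: setDl_inj.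
  apply: subset_leq_card; apply/subsetP => T /imsetP[e]; rewrite !inE.
  case/and3P => eE Se eY ->.
  have ce : #|e :\: S| = r by rewrite (card_link (k := k)) //; apply/eqP; move/forall_inP: uE; apply.
  apply/and3P; split; last 1 first.
  - apply/forallP => x; apply/negP => /subset_leq_card.
    by rewrite ce card_transv // leqNgt rM.
  - by apply/subsetP => v /(subsetP eY); rewrite inE.
  - by rewrite ce.
have H1 : (\sum_x sdeg E S (transv iota x) =
    \sum_(e in E | S \subset e) #|[set x | e :\: S \subset transv iota x]|)%N.
  rewrite /sdeg.
  under eq_bigr => x _ do rewrite -sum1_card.
  under [RHS]eq_bigr => e _ do rewrite -sum1_card.
  rewrite (exchange_big_dep (fun e => (e \in E) && (S \subset e))) /=; last first.
    by move=> x e _; rewrite inE => /and3P[-> ->].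
  apply: eq_bigr => e /andP[eE Se]; apply: eq_bigl => x.
  by rewrite !inE eE Se.
pose A1 := [set e in A | e :\: S \notin N].
have H2 : (#|A1| * b ^ (M - r) <= \sum_x sdeg E S (transv iota x))%N.
  rewrite H1 -sum_nat_const [X in (_ <= X)%N](bigID [in A1]) /=.
  apply: leq_trans (leq_addr _ _).
  rewrite [X in (_ <= X)%N](eq_bigl [in A1]) => [|e]; last first.
    case: (boolP (e \in A1)); rewrite ?andbF // andbT.
    by rewrite !inE => /andP[/and3P[-> ->]].
  apply: leq_sum => e; rewrite !inE => /andP[/and3P[eE Se eY]].
  have ce : #|e :\: S| = r by rewrite (card_link (k := k)) //; apply/eqP; move/forall_inP: uE; apply.
  have eY' : e :\: S \subset codom iota by apply/subsetP => v /(subsetP eY); rewrite inE.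
  rewrite ce eqxx eY' /= negb_forall => /existsP[x0]; rewrite negbK => sub.
  by rewrite (card_transv_containing iota_inj sub) ce.
have H3 : (sdeg E S iotaY * M - (M * b) ^ r <= #|A1| * M)%N.
  rewrite leq_subLR.
  have : (sdeg E S iotaY <= #|N| + #|A1|)%N.
    rewrite /sdeg -/A -(cardsID [set e | e :\: S \in N] A) leq_add //; last first.
      by apply: subset_leq_card; apply/subsetP => e; rewrite !inE andbC.
    rewrite -[X in (X <= _)%N](card_in_imset (f := fun e => e :\: S)); last first.
      move=> e e'; rewrite !inE => /andP[/and3P[_ h _] _] /andP[/and3P[_ h' _] _].
      exact: setDl_inj.
    by apply: subset_leq_card; apply/subsetP => T /imsetP[e]; rewrite inE => /andP[_]; rewrite inE => ? ->.
  move=> h; apply: leq_trans (_ : _ <= (#|N| + #|A1|) * M)%N _.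
    by rewrite leq_mul2r h orbT.
  rewrite mulnDl leq_add2r; exact: nontransversal_card.
apply: (@leq_trans (#|A1| * M * b ^ M)); first by rewrite leq_mul2r H3 orbT.
rewrite -[X in (_ * b ^ X)%N](subnK rM) expnD.
rewrite mulnACA [(M * _)%N]mulnC.
by rewrite leq_mul2r H2 orbT.
Qed.

(** Half of [delta] pays for the drop of the mean, caused by at most [wn] ungrouped vertices and by
    link sets inside no transversal; the other half is the deviation in the bounded differences
    inequality. *)
Lemma transv_sdeg_tail (Y : {set V}) (wn : nat) (rho delta : R) :
  (#|S| < k)%N ->
  codom iota \subset Y -> (#|Y| <= M * b + wn)%N ->
  rho * #|Y|%:R ^+ r <= r`!%:R * (sdeg E S Y)%:R ->
  0 <= delta <= 1 ->
  r`!%:R * (wn%:R / (M * b)%:R + M%:R^-1) <= delta / 2 ->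
  #|[set x | r`!%:R * (sdeg E S (transv iota x))%:R < (rho - delta) * M%:R ^+ r]|%:R <=
  (b ^ M)%:R * expR (- (delta ^+ 2 * M%:R / (32 * r`!%:R ^+ 2))).
Proof.
move=> dk iY cY hrho /andP[d0 d1] hsmall.
have r0 : (0 < r)%N by rewrite subn_gt0.
have F0 : 0 < r`!%:R :> R by rewrite ltr0n fact_gt0.
have M0R : 0 < M%:R :> R by rewrite ltr0n.
have b0R : 0 < b%:R :> R by rewrite ltr0n.
set rf := r`!%:R in hrho hsmall F0 *.
have cI : #|iotaY| = (M * b)%N by rewrite cardsE card_codom // card_prod !card_ord.
have iY' : iotaY \subset Y by apply/subsetP => v; rewrite inE => /(subsetP iY).
have YN : (M * b <= #|Y|)%N by rewrite -cI subset_leq_card.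
have N0 : 0 < (M * b)%:R :> R by rewrite ltr0n muln_gt0 M0.
have Y0 : 0 < #|Y|%:R :> R by apply: lt_le_trans N0 _; rewrite ler_nat.
have T0 : (0 < #|'I_b|)%N by rewrite card_ord.
(* For rho <= delta the event is empty; otherwise the density stays positive, which allows |Y| to be
   replaced by the smaller M b. *)
have [rd|rd] := leP (rho - delta) 0.
  rewrite (_ : [set x | _] = set0) ?cards0 ?mulr_ge0 ?expR_ge0 //.
  apply/setP => x; rewrite !inE; apply/negbTE; rewrite -leNgt.
  apply: (@le_trans _ _ 0); first by rewrite mulr_le0_ge0 ?exprn_ge0.
  by rewrite mulr_ge0 // ltW.
pose f x : R := rf * (sdeg E S (transv iota x))%:R.
pose c : R := rf * M%:R ^+ r.-1.
have c0 : 0 < c by rewrite mulr_gt0 ?exprn_gt0.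
have Mr : M%:R ^+ r = M%:R * M%:R ^+ r.-1 :> R by rewrite -exprS prednK.
have bf : bounded_diff c f.
  move=> x i t; rewrite /f -mulrBr ler_pM2l // lerBlDr -natrX -natrD ler_nat.
  rewrite -(leq_pmul2r M0); have := sdeg_setD S (transv iota x) [set iota (i, x i)] uE.
  rewrite card_transv // cards1 mul1n => /leq_trans; apply.
  rewrite mulnDl -expnSr prednK // addnC leq_add2l leq_mul2r; apply/orP; right.
  apply: sdeg_mono; apply/subsetP => v; rewrite !inE => /andP[vi /imsetP[g _ e]].
  rewrite e mem_transv // ffunE; case: (eqVneq g i) => [gi|_]; rewrite ?eqxx //.
  by rewrite e gi eqxx in vi.
pose tau : R := delta / 2 * M%:R ^+ r.
have htau : 0 <= tau <= 2 * #|'I_M|%:R * c.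
  rewrite card_ord /tau mulr_ge0 ?exprn_ge0 ?divr_ge0 //=.
  rewrite Mr /c mulrA [2 * _ * _]mulrA; apply: ler_wpM2r; first exact: exprn_ge0.
  have : 1 <= rf by rewrite ler1n fact_gt0.
  have h : delta / 2 <= 1 by lra.
  move=> h2; apply: (@le_trans _ _ (1 * M%:R)); first by rewrite ler_wpM2r.
  rewrite mulrAC; apply: ler_wpM2r => //; lra.
have := mcdiarmid_lower_tail T0 c0 htau _ bf.
rewrite !card_ord card_ffun !card_ord => /(_ M0).
have -> : tau ^+ 2 / (8 * M%:R * c ^+ 2) = delta ^+ 2 * M%:R / (32 * rf ^+ 2).
  rewrite /tau /c Mr; field.
  by rewrite !lt0r_neq0 ?exprn_gt0.
apply: le_trans; rewrite ler_nat subset_leq_card //; apply/subsetP => x.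
rewrite !inE => /ltW hx; apply: le_trans hx _; rewrite lerBrDr.
have H1 : rf * (sdeg E S Y)%:R <= rf * (sdeg E S iotaY)%:R + rf * wn%:R * #|Y|%:R ^+ r / #|Y|%:R.
  rewrite -!mulrA -mulrDr ler_pM2l //.
  rewrite -(ler_pM2r Y0) mulrDl !mulrA mulfVK ?lt0r_neq0 //.
  rewrite -!natrX -!natrM -natrD ler_nat.
  apply: leq_trans (sdeg_setD S Y (Y :\: iotaY) uE) _.
  rewrite setDDr setDv set0U (setIidPr iY') leq_add2l leq_mul2r; apply/orP; right.
  by rewrite cardsD (setIidPr iY') cI leq_subLR.
have H2 : (rho - rf * wn%:R / (M * b)%:R) * (M * b)%:R ^+ r <= rf * (sdeg E S iotaY)%:R.
  have P0 : 0 <= rho - rf * wn%:R / (M * b)%:R.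
    have : 0 <= rf * M%:R^-1 by rewrite divr_ge0 // ltW.
    move: hsmall; rewrite mulrDr mulrA; lra.
  apply: (@le_trans _ _ ((rho - rf * wn%:R / (M * b)%:R) * #|Y|%:R ^+ r)).
    by rewrite ler_wpM2l // lerXn2r ?nnegrE ?ler_nat.
  apply: (@le_trans _ _ ((rho - rf * wn%:R / #|Y|%:R) * #|Y|%:R ^+ r)).
    rewrite ler_wpM2r ?exprn_ge0 // lerD2l lerN2 ler_wpM2l ?mulr_ge0 ?(ltW F0) //.
    by rewrite lef_pV2 ?posrE // ler_nat.
  move: H1 hrho; rewrite mulrBl mulrAC; lra.
have H3 : (rf * (sdeg E S iotaY)%:R * M%:R - rf * (M * b)%:R ^+ r) * b%:R ^+ M <=
   (\sum_x f x) * (b%:R ^+ r * M%:R).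
  rewrite -mulr_sumr -!mulrA -mulrBr -!mulrA ler_pM2l //.
  have := sum_sdeg_transv; rewrite -(ler_nat R) !natrM !natrX natr_sum.
  apply: le_trans; rewrite ler_wpM2r ?exprn_ge0 //.
  have [le|lt] := leqP ((M * b) ^ r) (sdeg E S iotaY * M).
    by rewrite natrB // ?natrX ?natrM.
  have -> : (sdeg E S iotaY * M - (M * b) ^ r = 0)%N.
    by apply/eqP; rewrite subn_eq0 ltnW.
  by rewrite subr_le0 -!natrM -natrX ler_nat ltnW.
have bM0 : 0 < b%:R ^+ M :> R by rewrite exprn_gt0.
rewrite natrX ler_pdivlMr //.
have P0 : 0 < b%:R ^+ r * M%:R :> R by rewrite mulr_gt0 ?exprn_gt0.
rewrite -(ler_pM2r P0); apply: le_trans H3.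
rewrite [X in X <= _]mulrAC ler_pM2r //.
apply: (@le_trans _ _ ((rho - rf * wn%:R / (M * b)%:R) * (M * b)%:R ^+ r * M%:R - rf * (M * b)%:R ^+ r)); last first.
  by rewrite lerD2r ler_pM2r.
have -> : ((rho - delta) * M%:R ^+ r + tau) * (b%:R ^+ r * M%:R) =
    (rho - delta / 2) * M%:R * (M * b)%:R ^+ r.
  by rewrite /tau natrM exprMn; field.
have -> : (rho - rf * wn%:R / (M * b)%:R) * (M * b)%:R ^+ r * M%:R - rf * (M * b)%:R ^+ r
   = ((rho - rf * wn%:R / (M * b)%:R) - rf / M%:R) * M%:R * (M * b)%:R ^+ r.
  by field; rewrite !lt0r_neq0.
rewrite ler_pM2r ?exprn_gt0 // ler_pM2r //.
move: hsmall; rewrite mulrDr mulrA; lra.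
Qed.

End TransversalDegrees.

(** * Near-perfect matchings from random clusters *)

Definition matchable_above (R : realType) (k d s : nat) (beta : R) (y0 : nat) :=
  forall (V : finType) (E : {set {set V}}) (Y : {set V}), uniform k E ->
    (y0 <= #|Y|)%N -> (#|Y| = s %[mod k])%N ->
    (forall S : {set V}, S \subset Y -> #|S| = d ->
       beta * #|Y|%:R ^+ (k - d) <= (k - d)`!%:R * (sdeg E S Y)%:R) ->
    exists M, [/\ is_matching E M, cover M \subset Y & #|M| = (#|Y| %/ k)%N].

(** A permutation of b points takes prescribed values on a of them with probability at most (e/b)^a.
    The induction rests on (1 + 1/b)^a <= e for a <= b. *)
Lemma fact_ratio_le (R : realType) (a b : nat) : (a <= b)%N ->
  b%:R ^+ a * (b - a)`!%:R <= expR 1 ^+ a * b`!%:R :> R.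
Proof.
elim: a b => [b _|a IH [|b] //]; first by rewrite !expr0 subn0.
rewrite ltnS => ab; rewrite subSS factS natrM !exprS.
have -> : expR 1 * expR 1 ^+ a * (b.+1%:R * b`!%:R) =
  b.+1%:R * (expR 1 * (expR 1 ^+ a * b`!%:R)) :> R by ring.
rewrite -!mulrA ler_pM2l ?ltr0n //.
apply: le_trans (ler_wpM2l (expR_ge0 _) (IH _ ab)).
rewrite mulrA ler_wpM2r //.
case: b ab {IH} => [|b] ab; first by move: ab; rewrite leqn0 => /eqP ->; rewrite !expr0 mulr1 ltW // expR_gt1.
have b0 : 0 < b.+1%:R :> R by rewrite ltr0n.
have -> : b.+2%:R = b.+1%:R * (1 + b.+1%:R^-1) :> R.
  by rewrite mulrDr mulr1 mulfV ?lt0r_neq0 // natr1.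
rewrite exprMn mulrC ler_pM2r ?exprn_gt0 //.
apply: (@le_trans _ _ (expR b.+1%:R^-1 ^+ a)).
  by rewrite lerXn2r ?nnegrE ?expR_ge0 ?addr_ge0 ?invr_ge0 // expR_ge1Dx.
rewrite -expRM_natl ler_expR ler_pdivrMr // mul1r ler_nat.
by [].
Qed.

Lemma card_perm_agree (b : nat) (Q : {set 'I_b}) (p0 : 'S_b) :
  #|[set p : 'S_b | [forall i in Q, p i == p0 i]]| = (b - #|Q|)`!.
Proof.
have -> : (b - #|Q| = #|~: Q|)%N by have := cardsC Q; rewrite card_ord; lia.
rewrite -card_perm -[RHS](card_imset _ (mulIg p0)) /=.
apply: eq_card => p; rewrite inE; apply/forall_inP/imsetP => [H|[q]].
  exists (p * p0^-1)%g; last by rewrite mulgKV.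
  apply/subsetP => i; rewrite !inE permM.
  by apply: contra => /H/eqP ->; rewrite permK.
move=> /subsetP H -> i iQ; rewrite permM.
have [->|/H] := eqVneq (q i) i; first by rewrite eqxx.
by rewrite inE iQ.
Qed.

Lemma inj_into_set (X V : finType) (A : {set V}) : (#|X| <= #|A|)%N ->
  exists2 f : X -> V, injective f & codom f \subset A.
Proof.
move=> XA; exists (fun x => enum_val (widen_ord XA (enum_rank x))).
  by move=> x y /enum_val_inj/(congr1 val)/= /ord_inj/enum_rank_inj.
by apply/subsetP => v /codomP[x ->]; apply: enum_valP.
Qed.

Section Clusters.
Variables (R : realType) (V : finType) (m b : nat) (iota : 'I_m * 'I_b -> V).
Hypothesis iota_inj : injective iota.
Hypotheses (m0 : (0 < m)%N) (b0 : (0 < b)%N).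
Variables (E : {set {set V}}) (k d s : nat).
Hypothesis uE : uniform k E.
Hypothesis dk : (d < k)%N.
Variables (A : {set V}) (beta delta : R).
Hypothesis iA : codom iota \subset A.
Hypothesis cA : (#|A| <= m * b + m)%N.
Hypothesis delta01 : 0 <= delta <= 1.
Let r := (k - d)%N.
Implicit Types (x : {ffun 'I_m -> 'I_b}) (pi : {ffun 'I_m -> 'S_b}) (S T Z : {set V}).

Definition sparse (Y : {set V}) S :=
  (r`!%:R * (sdeg E S Y)%:R < beta * m%:R ^+ r :> R).

Definition bad (Y : {set V}) := [exists S : {set V}, [&& S \subset Y, #|S| == d & sparse Y S]].

Hypothesis degA : forall S, S \subset A -> #|S| = d ->
  (beta + delta) * #|A|%:R ^+ r <= r`!%:R * (sdeg E S A)%:R.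
Hypothesis m_large1 : r`!%:R * d%:R / m%:R <= delta / 2.
Hypothesis m_large2 : r`!%:R * (m%:R / (m * b)%:R + m%:R^-1) <= delta / 4.

Let tail : R := expR (- ((delta / 2) ^+ 2 * m%:R / (32 * r`!%:R ^+ 2))).

(** A plain union bound over all [S] would cost (m b)^d with b unbounded. The factor b^d saved here
    stems from near independence: whether [S] lies in the transversal depends on d coordinates, and
    resampling these lets the degree of [S] grow by at most d m^(r - 1). *)
Lemma sparse_transv S : #|S| = d ->
  #|[set x | (S \subset transv iota x) && sparse (transv iota x) S]|%:R * b%:R ^+ d
    <= (b ^ m)%:R * tail.
Proof.
move=> cS; have r0 : (0 < r)%N by rewrite subn_gt0.
set B := [set x | _].
have [x0 Sx0|H] := pickP (fun x => S \subset transv iota x); last first.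
  rewrite (_ : B = set0) ?cards0 ?mul0r ?mulr_ge0 ?expR_ge0 //.
  by apply/setP => x; rewrite !inE H.
have SA : S \subset A.
  apply: subset_trans Sx0 _; apply: subset_trans iA; exact: transv_sub.
pose D := [set g | iota (g, x0 g) \in S].
have cD : #|D| = d.
  rewrite -cS -(card_imset (f := fun g => iota (g, x0 g)) D); last by move=> g g' /iota_inj[].
  apply: eq_card => v; apply/imsetP/idP => [[g]|vS]; first by rewrite inE => ? ->.
  by have /imsetP[g _ e] := subsetP Sx0 _ vS; exists g; rewrite ?inE -?e.
pose fix_ x : {ffun 'I_m -> 'I_b} := [ffun g => if g \in D then x0 g else x g].
have onD x : x \in B -> forall g, g \in D -> x g = x0 g.
  rewrite inE => /andP[Sx _] g; rewrite inE => /(subsetP Sx).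
  by rewrite mem_transv // => /eqP.
pose B' := [set x | r`!%:R * (sdeg E S (transv iota x))%:R < (beta + delta - delta / 2) * m%:R ^+ r].
have BB' x : fix_ x \in B -> x \in B'.
  rewrite !inE => /andP[_ sp].
  pose W := [set iota (g, x g) | g in D].
  have cW : (#|W| <= d)%N by rewrite -cD leq_imset_card.
  have h1 : (sdeg E S (transv iota x) * m <= sdeg E S (transv iota (fix_ x)) * m + d * m ^ r)%N.
    have := sdeg_setD S (transv iota x) W uE; rewrite card_transv // cS -/r.
    move=> /leq_trans; apply; apply: leq_add; rewrite leq_mul2r; last by rewrite cW orbT.
    apply/orP; right; apply: sdeg_mono; apply/subsetP => v; rewrite !inE => /andP[vW /imsetP[g _ e]].
    rewrite e mem_transv // ffunE; case: ifP => // gD.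
    by case/negP: vW; rewrite e; apply/imsetP; exists g.
  have m0R : 0 < m%:R :> R by rewrite ltr0n.
  have F0 : 0 < r`!%:R :> R by rewrite ltr0n fact_gt0.
  have h2 : r`!%:R * (sdeg E S (transv iota x))%:R <=
    r`!%:R * (sdeg E S (transv iota (fix_ x)))%:R + (r`!%:R * d%:R / m%:R) * m%:R ^+ r :> R.
    rewrite -!mulrA -mulrDr ler_pM2l // -(ler_pM2r m0R) mulrDl.
    rewrite [X in _ <= _ + X](_ : _ = d%:R * m%:R ^+ r).
      by rewrite -natrX -!natrM -natrD ler_nat.
    by field; rewrite lt0r_neq0.
  have h3 : (r`!%:R * d%:R / m%:R) * m%:R ^+ r <= delta / 2 * m%:R ^+ r :> R.
    by rewrite ler_wpM2r ?exprn_ge0.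
  move: sp; rewrite /sparse => sp.
  apply: le_lt_trans h2 _; rewrite -addrA mulrDl.
  have -> : (delta - delta / 2) = delta / 2 by field.
  exact: ltr_leD.
(* Each [x] in [B] has b^d preimages under [fix_], obtained by freeing the coordinates in [D], and
   all of them lie in [B']. *)
have count : (#|B| * b ^ d <= #|B'|)%N.
  have -> : (#|B| * b ^ d = \sum_(x in B) #|[set y | fix_ y == x]|)%N.
    rewrite -sum_nat_const; apply: eq_bigr => x xB.
    transitivity (#|'I_b| ^ (#|'I_m| - #|~: D|))%N.
      by rewrite -(cardsC D) addnK cD card_ord.
    rewrite -(card_agree (~: D) x); apply: eq_card => y; rewrite !inE.
    apply/forall_inP/eqP => [H|<- g].
      apply/ffunP => g; rewrite ffunE; case: ifP => gD; first by rewrite (onD x).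
      by apply/eqP; apply: H; rewrite inE gD.
    by rewrite inE ffunE => /negbTE ->.
  rewrite -[#|B'|]sum1_card [X in (_ <= X)%N](partition_big fix_ predT) //=.
  rewrite [X in (_ <= X)%N](bigID [in B]) /=; apply: leq_trans (leq_addr _ _).
  apply: leq_sum => x xB; rewrite -sum1_card.
  rewrite [X in (X <= _)%N](eq_bigl (fun y => (y \in B') && (fix_ y == x))) // => y.
  by rewrite inE; case: eqP => [e|]; rewrite ?andbF // andbT BB' ?e.
apply: (@le_trans _ _ #|B'|%:R).
  by rewrite -natrX -natrM ler_nat.
have cS' : (k - #|S|)%N = r by rewrite cS.
have := @transv_sdeg_tail R V m b iota iota_inj m0 b0 E k S uE A m (beta + delta) (delta / 2).
rewrite cS -/r -/tail; apply => //.
- exact: degA.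
- by move/andP: delta01 => [? ?]; apply/andP; split; lra.
- by apply: le_trans m_large2 _; lra.
Qed.

Lemma bad_transv : #|[set x | bad (transv iota x)]|%:R <= (b ^ m)%:R * (m%:R ^+ d * tail).
Proof.
have b0R : 0 < b%:R :> R by rewrite ltr0n.
pose D := [set S : {set V} | S \subset [set v in codom iota] & #|S| == d].
have cD : (#|D| <= (m * b) ^ d)%N.
  apply: leq_trans (bin_le_exp _ _); rewrite /D cards_draws.
  by rewrite cardsE card_codom // card_prod !card_ord.
pose B S := [set x | (S \subset transv iota x) && sparse (transv iota x) S].
have H : (#|[set x | bad (transv iota x)]| <= \sum_(S in D) #|B S|)%N.
  apply: (@leq_trans #|\bigcup_(S in D) B S|).
    apply: subset_leq_card; apply/subsetP => x; rewrite inE => /existsP[S /and3P[Sx cS sp]].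
    apply/bigcupP; exists S; rewrite inE; last by rewrite Sx sp.
    rewrite cS andbT; apply/subsetP => v /(subsetP Sx) /(subsetP (transv_sub iota x)).
    by rewrite inE.
  elim/big_rec2: _ => [|S n C _ IH]; first by rewrite cards0.
  by apply: leq_trans (leq_card_setU _ _) _; rewrite leq_add2l.
apply: (@le_trans _ _ (\sum_(S in D) #|B S|%:R)); first by rewrite -natr_sum ler_nat.
apply: (@le_trans _ _ (\sum_(S in D) ((b ^ m)%:R * tail / b%:R ^+ d))).
  apply: ler_sum => S; rewrite inE => /andP[_ /eqP cS].
  by rewrite ler_pdivlMr ?exprn_gt0 //; apply: sparse_transv.
rewrite sumr_const -[X in X <= _]mulr_natl.
apply: (@le_trans _ _ ((m * b)%:R ^+ d * ((b ^ m)%:R * tail / b%:R ^+ d))).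
  rewrite ler_wpM2r ?divr_ge0 ?mulr_ge0 ?expR_ge0 ?exprn_ge0 //.
  by rewrite -natrX ler_nat.
rewrite natrM exprMn le_eqVlt; apply/orP; left; apply/eqP.
by field; rewrite lt0r_neq0 ?exprn_gt0.
Qed.

(* With an independent uniform permutation of the labels in each group, the
   clusters partition the groups while each of them is a uniform transversal. *)
Definition cluster pi (j : 'I_b) : {set V} := transv iota [ffun g => (pi g)^-1%g j].

Lemma mem_cluster pi j g i : (iota (g, i) \in cluster pi j) = (pi g i == j).
Proof.
rewrite mem_transv // ffunE; apply/eqP/eqP => [<-|<-]; first by rewrite permKV.
by rewrite permK.
Qed.

Lemma card_cluster pi j : #|cluster pi j| = m.
Proof. exact: card_transv. Qed.

Lemma cluster_disjoint pi j j' v : v \in cluster pi j -> v \in cluster pi j' -> j = j'.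
Proof.
move=> vj; have /imsetP[g _ e] := vj; move: vj; rewrite e !mem_cluster.
by move=> /eqP h /eqP h'; apply: etrans (esym h) h'.
Qed.

Lemma card_pi : #|{: {ffun 'I_m -> 'S_b}}| = (b`! ^ m)%N.
Proof. by rewrite card_ffun card_Sn !card_ord. Qed.

Lemma card_family_eq (I T : finType) (F : I -> {set T}) :
  #|[set f : {ffun I -> T} | [forall i, f i \in F i]]| = (\prod_i #|F i|)%N.
Proof.
transitivity #|family F|; last by rewrite card_family foldrE big_map big_enum.
by apply: eq_card => f; rewrite inE; apply/forallP/familyP.
Qed.

Lemma bad_cluster_count j :
  #|[set pi | bad (cluster pi j)]|%:R <= (b`! ^ m)%:R * (m%:R ^+ d * tail).
Proof.
have -> : #|[set pi | bad (cluster pi j)]| =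
    (#|[set x | bad (transv iota x)]| * (b.-1)`! ^ m)%N.
  rewrite -sum_nat_const -sum1_card.
  rewrite (partition_big (fun pi => [ffun g => (pi g)^-1%g j]) [in [set x | bad (transv iota x)]]) /=; last first.
    by move=> pi; rewrite !inE.
  apply: eq_bigr => x; rewrite inE => bx; rewrite sum1_card.
  transitivity (\prod_(g < m) #|[set p : 'S_b | p (x g) == j]|)%N.
    rewrite -card_family_eq; apply: eq_card => pi; rewrite !inE.
    apply/andP/forallP => [[_ /eqP e] g|H].
      by rewrite inE -e ffunE permKV.
    suff e : [ffun g => (pi g)^-1%g j] = x by rewrite inE /cluster e eqxx; split.
    apply/ffunP => g; rewrite ffunE; have := H g; rewrite inE => /eqP <-.
    by rewrite permK.
  rewrite (eq_bigr (fun=> (b.-1)`!)) ?prod_nat_const ?card_ord // => g _.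
  rewrite -subn1 -(cards1 (x g)) -(card_perm_agree [set x g] (tperm (x g) j)).
  apply: eq_card => p; rewrite !inE; apply/eqP/forall_inP => [e i|H].
    by rewrite inE => /eqP ->; rewrite e tpermL.
  by apply/eqP; rewrite (eqP (H (x g) _)) ?inE // tpermL.
have bS : (b`! = b * b.-1`!)%N by rewrite -[in LHS](prednK b0) factS prednK.
rewrite bS expnMn !natrM; apply: (@le_trans _ _ ((b ^ m)%:R * (m%:R ^+ d * tail) * (b.-1`! ^ m)%:R)).
  by rewrite ler_wpM2r // bad_transv.
by rewrite mulrAC.
Qed.

Definition few_bad pi := (#|[set j | bad (cluster pi j)]|%:R <= 2 * (m%:R ^+ d * tail) * b%:R :> R).

(** Markov's inequality. Distinct clusters are dependent, but the expected number of bad ones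
    involves only the law of each. *)
Lemma few_bad_half : (b`! ^ m)%:R <= 2 * #|[set pi | few_bad pi]|%:R :> R.
Proof.
set G := [set pi | _]; set eps : R := m%:R ^+ d * tail.
have b0R : 0 < b%:R :> R by rewrite ltr0n.
have e0 : 0 < eps by rewrite mulr_gt0 ?expR_gt0 ?exprn_gt0 ?ltr0n.
have eP : (#|G| + #|~: G|)%:R = (b`! ^ m)%:R :> R by rewrite cardsC card_pi.
have H : \sum_pi #|[set j | bad (cluster pi j)]|%:R <= b%:R * ((b`! ^ m)%:R * eps) :> R.
  have -> : \sum_pi #|[set j | bad (cluster pi j)]|%:R =
     \sum_(j < b) #|[set pi | bad (cluster pi j)]|%:R :> R.
    rewrite -!natr_sum; congr _%:R.
    under eq_bigr => pi _ do rewrite -sum1_card.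
    under [RHS]eq_bigr => j _ do rewrite -sum1_card.
    rewrite (exchange_big_dep predT) //=; apply: eq_bigr => j _.
    by apply: eq_bigl => pi; rewrite !inE.
  apply: (@le_trans _ _ (\sum_(j < b) ((b`! ^ m)%:R * eps))).
    by apply: ler_sum => j _; apply: bad_cluster_count.
  by rewrite sumr_const card_ord -[X in X <= _]mulr_natl.
have H2 : #|~: G|%:R * (2 * eps * b%:R) <= \sum_pi #|[set j | bad (cluster pi j)]|%:R :> R.
  rewrite mulr_natl -sumr_const big_mkcond /=; apply: ler_sum => pi _.
  case: ifP => // ; rewrite !inE -ltNge; exact: ltW.
have H3 := le_trans H2 H.
have : #|~: G|%:R * 2 <= (b`! ^ m)%:R :> R.
  rewrite -(ler_pM2r (mulr_gt0 e0 b0R)); move: H3; lra.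
move: eP; rewrite natrD; lra.
Qed.


(** With a cluster prescribed for every edge, the permutation of each group is determined on the
    labels covered by [S]. These are k |S| positions in total as the edges are disjoint, each
    costing a factor e/b. *)
Lemma labelled_cluster_count (S : {set {set V}}) (f : {set V} -> 'I_b) :
  S \subset E -> trivIset S -> cover S \subset codom iota ->
  #|[set pi | [forall e in S, e \subset cluster pi (f e)]]|%:R
    <= (b`! ^ m)%:R * (expR 1 / b%:R) ^+ (k * #|S|) :> R.
Proof.
move=> SE tS cS; have b0R : 0 < b%:R :> R by rewrite ltr0n.
pose F g := [set p : 'S_b | [forall e in S, forall i, (iota (g, i) \in e) ==> (p i == f e)]].
pose Q g := [set i | iota (g, i) \in cover S].
have H1 : (#|[set pi | [forall e in S, e \subset cluster pi (f e)]]| <= \prod_(g < m) #|F g|)%N.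
  rewrite -card_family_eq; apply: subset_leq_card; apply/subsetP => pi; rewrite !inE.
  move=> /forall_inP H; apply/forallP => g; rewrite inE; apply/forall_inP => e eS.
  apply/forallP => i; apply/implyP => ie; have := subsetP (H e eS) _ ie.
  by rewrite mem_cluster.
have H2 g : #|F g|%:R <= b`!%:R * (expR 1 / b%:R) ^+ #|Q g| :> R.
  have [p0 p0F|F0] := pickP [in F g]; last first.
    by rewrite (eq_card0 F0) mulr_ge0 // exprn_ge0 // divr_ge0 // expR_ge0.
  apply: (@le_trans _ _ (b - #|Q g|)`!%:R).
    rewrite ler_nat -(card_perm_agree (Q g) p0); apply: subset_leq_card; apply/subsetP => p.
    rewrite !inE => /forall_inP Hp; apply/forall_inP => i; rewrite inE => /bigcupP[e eS ie].
    have /forallP/(_ i)/implyP/(_ ie)/eqP -> := Hp e eS.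
    move: p0F; rewrite inE => /forall_inP/(_ e eS)/forallP/(_ i)/implyP/(_ ie)/eqP ->.
    by [].
  rewrite expr_div_n mulrA ler_pdivlMr ?exprn_gt0 // mulrC [b`!%:R * _]mulrC.
  by apply: fact_ratio_le; rewrite -[X in (_ <= X)%N]card_ord max_card.
have H3 : (\sum_(g < m) #|Q g| = k * #|S|)%N.
  transitivity #|cover S|; last first.
    rewrite -(eqP tS) (eq_bigr (fun=> k)) ?sum_nat_const 1?mulnC // => e eS.
    by apply/eqP; move/forall_inP: uE; apply; apply: (subsetP SE).
  transitivity #|[set p | iota p \in cover S]|.
    under eq_bigr => g _ do rewrite -sum1_card.
    rewrite pair_big_dep /= -sum1_card; apply: eq_bigl => -[g i].
    by rewrite !inE.
  rewrite -(card_imset _ iota_inj); apply: eq_card => v.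
  apply/imsetP/idP => [[p]|vS]; first by rewrite inE => ? ->.
  by have /codomP[p e] := subsetP cS _ vS; exists p; rewrite ?inE -?e.
apply: (@le_trans _ _ (\prod_(g < m) #|F g|%:R)).
  by rewrite -natr_prod ler_nat.
apply: (@le_trans _ _ (\prod_(g < m) (b`!%:R * (expR 1 / b%:R) ^+ #|Q g|))).
  by apply: ler_prod => g _; rewrite ler0n H2.
by rewrite big_split /= prodr_const card_ord -expr_sum H3 natrX.
Qed.

(** Union over the b^|S| assignments of edges to clusters. The resulting weight b (e/b)^k per edge
    is of order b^(1-k), the right one since [m] is constant. *)
Lemma cluster_spread_count (S : {set {set V}}) :
  S \subset E -> trivIset S ->
  #|[set pi | [forall e in S, [exists j, e \subset cluster pi j]]]|%:R
    <= (b`! ^ m)%:R * (b%:R * (expR 1 / b%:R) ^+ k) ^+ #|S| :> R.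
Proof.
move=> SE tS; have b0R : 0 < b%:R :> R by rewrite ltr0n.
have q0 : 0 <= expR 1 / b%:R :> R by rewrite divr_ge0 // expR_ge0.
have [cS|cS] := boolP (cover S \subset codom iota); last first.
  rewrite (_ : [set pi | _] = set0) ?cards0; last first.
    apply/setP => pi; rewrite !inE; apply/negbTE; apply: contra cS => /forall_inP H.
    apply/subsetP => v /bigcupP[e eS ve]; have /existsP[j ej] := H e eS.
    by apply: (subsetP (transv_sub iota _)); apply: (subsetP ej).
  by rewrite mulr_ge0 // exprn_ge0 // mulr_ge0 // exprn_ge0.
pose j0 := Ordinal b0.
pose D := [set f : {ffun {set V} -> 'I_b} | f \in pffun_on j0 [in S] predT].
pose B (f : {ffun {set V} -> 'I_b}) := [set pi | [forall e in S, e \subset cluster pi (f e)]].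
have H : (#|[set pi | [forall e in S, [exists j, e \subset cluster pi j]]]| <= \sum_(f in D) #|B f|)%N.
  apply: (@leq_trans #|\bigcup_(f in D) B f|).
    apply: subset_leq_card; apply/subsetP => pi; rewrite inE => /forall_inP Hpi.
    pose f : {ffun {set V} -> 'I_b} :=
      [ffun e => if e \in S then odflt j0 [pick j | e \subset cluster pi j] else j0].
    apply/bigcupP; exists f; rewrite inE.
      apply/pffun_onP; split => // ; apply/subsetP => e; rewrite !inE ffunE.
      by case: ifP => //; rewrite eqxx.
    apply/forall_inP => e eS; rewrite ffunE eS; case: pickP => [//|H0].
    by have /existsP[j] := Hpi e eS; rewrite H0.
  elim/big_rec2: _ => [|S' n C _ IH]; first by rewrite cards0.
  by apply: leq_trans (leq_card_setU _ _) _; rewrite leq_add2l.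
apply: (@le_trans _ _ (\sum_(f in D) #|B f|%:R)); first by rewrite -natr_sum ler_nat.
apply: (@le_trans _ _ (\sum_(f in D) ((b`! ^ m)%:R * (expR 1 / b%:R) ^+ (k * #|S|)))).
  by apply: ler_sum => f _; apply: labelled_cluster_count.
rewrite sumr_const cardsE card_pffun_on -[X in X <= _]mulr_natr.
have -> : (#|(predT : pred 'I_b)| = b)%N by rewrite -[RHS]card_ord; apply: eq_card.
rewrite (_ : #|in_mem^~ (mem S)| = #|S|); last by apply: eq_card.
by rewrite [(b ^ _)%:R]natrX [(b%:R * _) ^+ _]exprMn -exprM -mulrA [X in _ * X <= _]mulrC.
Qed.

Variables (y0 : nat).
Hypothesis hmatch : matchable_above k d s beta y0.
Hypotheses (my0 : (y0 <= m)%N) (ms : (m = s %[mod k])%N).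

(** Given the permutations, every good cluster receives one fixed optimal matching; all randomness
    lies in [pi], restricted to choices with few bad clusters. *)
Lemma cluster_matching :
  has_spread (R := R) (fun e : {set V} => if e \subset A then 2 * (b%:R * (expR 1 / b%:R) ^+ k) else 0)
    (fun M => [/\ is_matching E M, cover M \subset A &
       #|A :\: cover M|%:R <= m%:R + s%:R * b%:R + 2 * (m%:R ^+ d * tail) * b%:R * m%:R]).
Proof.
have b0R : 0 < b%:R :> R by rewrite ltr0n.
have k0 : (0 < k)%N by apply: leq_ltn_trans dk.
pose good (Y : {set V}) (M : {set {set V}}) := [/\ is_matching E M, cover M \subset Y & #|M| = (m %/ k)%N].
have [Mt MtP] : exists Mt : {set V} -> {set {set V}}, forall Y : {set V}, #|Y| = m -> ~~ bad Y -> good Y (Mt Y).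
  have /choice[Mt MtP] : forall Y : {set V}, exists M, #|Y| = m -> ~~ bad Y -> good Y M.
    move=> Y; have [cY|cY] := eqVneq #|Y| m; last by exists set0 => h; rewrite h eqxx in cY.
    have [bY|bY] := boolP (bad Y); first by exists set0.
    have [|||S SY cS|M [h1 h2 h3]] := hmatch (V := V) (E := E) (Y := Y); rewrite ?cY //.
      rewrite leNgt; apply: contra bY => sp; apply/existsP; exists S.
      by rewrite SY cS eqxx.
    by exists M => _ _; split; rewrite // h3 cY.
  by exists Mt.
pose Mp pi := \bigcup_(j | ~~ bad (cluster pi j)) Mt (cluster pi j).
have MpP pi e : reflect (exists2 j, ~~ bad (cluster pi j) & e \in Mt (cluster pi j)) (e \in Mp pi).
  by apply: (iffP bigcupP) => -[j ? ?]; exists j.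
have Msub pi j e : ~~ bad (cluster pi j) -> e \in Mt (cluster pi j) -> e \subset cluster pi j.
  move=> bj eM; have [_ cM _] := MtP _ (card_cluster pi j) bj.
  by apply: subset_trans cM; apply: bigcup_sup.
have clA pi j : cluster pi j \subset A.
  by apply: subset_trans iA; apply: transv_sub.
have Mmatch pi : is_matching E (Mp pi).
  apply/andP; split.
    apply/subsetP => e /MpP[j bj eM]; have [/andP[sE _] _ _] := MtP _ (card_cluster pi j) bj.
    exact: (subsetP sE).
  apply/trivIsetP => e e' /MpP[j bj eM] /MpP[j' bj' eM'] ee'.
  have [jj|jj] := eqVneq j j'.
    subst j'; have [/andP[_ /trivIsetP tM] _ _] := MtP _ (card_cluster pi j) bj.
    exact: tM.
  rewrite disjoints_subset; apply/subsetP => v ve; rewrite inE; apply/negP => ve'.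
  case/eqP: jj; apply: (@cluster_disjoint pi j j' v).
    by apply: (subsetP (Msub _ _ _ bj eM)).
  by apply: (subsetP (Msub _ _ _ bj' eM')).
have Mcov pi : cover (Mp pi) \subset A.
  apply/subsetP => v /bigcupP[e /MpP[j bj eM] ve]; apply: (subsetP (clA pi j)).
  exact: (subsetP (Msub _ _ _ bj eM)).
(* Three sources of uncovered vertices: at most [m] ungrouped ones, at most [s] in each matched
   cluster, all [m] in each bad one. *)
have Mleft pi : (#|A :\: cover (Mp pi)| <= m + s * b + #|[set j | bad (cluster pi j)]| * m)%N.
  pose L j := if bad (cluster pi j) then cluster pi j else cluster pi j :\: cover (Mt (cluster pi j)).
  have sub : A :\: cover (Mp pi) \subset (A :\: [set v in codom iota]) :|: \bigcup_j L j.
    apply/subsetP => v; rewrite inE => /andP[vM vA].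
    rewrite inE; case: (boolP (v \in [set v in codom iota])) => [|nv]; last by rewrite inE nv vA.
    rewrite inE => /codomP[[g i] e]; apply/orP; right; apply/bigcupP.
    have vj : v \in cluster pi (pi g i) by rewrite e mem_cluster.
    exists (pi g i) => //; rewrite /L; case: ifP => bj //.
    rewrite inE vj andbT; apply: contra vM => /bigcupP[e' e'M ve'].
    by apply/bigcupP; exists e' => //; apply/MpP; exists (pi g i); rewrite ?bj.
  apply: leq_trans (subset_leq_card sub) _; apply: leq_trans (leq_card_setU _ _) _.
  rewrite -addnA leq_add //.
    rewrite cardsD (setIidPr _); last by apply/subsetP => v; rewrite inE => /(subsetP iA).
    by rewrite cardsE card_codom // card_prod !card_ord leq_subLR.
  apply: leq_trans (card_bigcup_le _) _.
  apply: (@leq_trans (\sum_(j < b) (s + (if bad (cluster pi j) then m else 0)))).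
    apply: leq_sum => j _; rewrite /L; case: ifP => bj.
      by rewrite card_cluster leq_addl.
    have [/andP[sE tM] cM nM] := MtP _ (card_cluster pi j) (negbT bj).
    rewrite cardsD (setIidPr cM) card_cluster addn0.
    rewrite -(eqP tM) (eq_bigr (fun=> k)) ?sum_nat_const ?nM; last first.
      by move=> e eM; apply/eqP; move/forall_inP: uE; apply; apply: (subsetP sE).
    by rewrite [X in (X - _)%N](divn_eq m k) addKn ms leq_mod.
  rewrite big_split /= sum_nat_const card_ord mulnC leq_add2l.
  by rewrite -big_mkcond /= sum_nat_const cardsE.
have half := few_bad_half.
pose G := [set pi | few_bad pi].
have G0 : 0 < #|G|%:R :> R.
  have : 0 < (b`! ^ m)%:R :> R by rewrite ltr0n expn_gt0 fact_gt0.
  move: half; rewrite -/G; lra.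
have q0 : 0 <= b%:R * (expR 1 / b%:R) ^+ k :> R.
  by rewrite mulr_ge0 // exprn_ge0 // divr_ge0 // expR_ge0.
apply: (@has_spread_mix _ _ _ G _ (fun pi e => (e \in Mp pi)%:R)).
- by rewrite -card_gt0 -(ltr0n R).
- by move=> e; case: ifP => // _; rewrite mulr_ge0.
- move=> pi; rewrite inE => fb; apply: (@has_spread_point _ _ _ _ (Mp pi)) => //; last first.
    by move=> e ->.
  split=> //; apply: (@le_trans _ _ (m + s * b + #|[set j | bad (cluster pi j)]| * m)%:R).
    by rewrite ler_nat.
  rewrite !natrD !natrM lerD2l; apply: ler_wpM2r => //; exact: fb.
- move=> S M [mM cM _] SM.
  have SA e : e \in S -> e \subset A.
    by move=> eS; apply: subset_trans cM; apply: bigcup_sup; apply: (subsetP SM).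
  have [ME tM] := andP mM; have tS := trivIsetS SM tM.
  have SE := subset_trans SM ME.
  rewrite (eq_bigr (fun=> 2 * (b%:R * (expR 1 / b%:R) ^+ k))) => [|e eS]; last by rewrite SA.
  rewrite prodr_const.
  have [S0|S0] := posnP #|S|.
    rewrite S0 expr0 mulr1 -sum1_card natr_sum; apply: ler_sum => pi _.
    by rewrite big_pred0 // => e; have /cards0_eq -> := S0; rewrite inE.
  have H1 : \sum_(pi in G) \prod_(e in S) (e \in Mp pi)%:R
     <= #|[set pi | [forall e in S, [exists j, e \subset cluster pi j]]]|%:R :> R.
    rewrite -sum1_card natr_sum big_mkcond [X in _ <= X]big_mkcond /=.
    apply: ler_sum => pi _; rewrite inE; case: ifP => [_|_]; last by case: ifP.
    case: ifP => [_|/negP H].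
      apply: prodr_ile1 => e _; by case: (e \in Mp pi); rewrite ?lexx ?ler01.
    have [e /andP[eS eM]] : exists e, (e \in S) && (e \notin Mp pi).
      apply/existsP; apply: contrapT => /negP; rewrite negb_exists => /forallP nex.
      apply: H; rewrite inE; apply/forall_inP => e eS; have := nex e; rewrite eS negbK => /MpP[j bj eMj].
      by apply/existsP; exists j; apply: Msub.
    by rewrite (bigD1 e) //= (negbTE eM) mul0r.
  apply: le_trans H1 _; apply: le_trans (cluster_spread_count SE tS) _.
  (* Restricting to [G] loses a factor 2, absorbed by 2^|S| because [S] is nonempty. *)
  rewrite [X in _ <= _ * X]exprMn mulrA; apply: ler_wpM2r; first exact: exprn_ge0.
  apply: le_trans half _; rewrite -/G mulrC; apply: ler_wpM2l => //.
  by rewrite -(prednK S0) exprS ler_peMr ?exprn_ege1 ?ler1n.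
Qed.

End Clusters.

Lemma nat_above (R : realType) (x : R) : exists n : nat, x <= n%:R.
Proof.
exists (Num.bound `|x|); apply: le_trans (ler_norm x) _.
by apply/ltW/archi_boundP.
Qed.

Lemma expR_beats_pow (R : realType) (d : nat) (a x : R) : 0 < a -> 0 < x ->
  x ^+ d * expR (- (a * x)) <= d.+1`!%:R / a ^+ d.+1 / x.
Proof.
move=> a0 x0; rewrite expRN ler_pdivrMr ?expR_gt0 //.
have F0 : 0 < d.+1`!%:R :> R by rewrite ltr0n fact_gt0.
have ax : 0 <= a * x by rewrite mulr_ge0 ?ltW.
have h : (a * x) ^+ d.+1 / d.+1`!%:R <= expR (a * x).
  by apply: le_trans (expR_ge1Dxn d ax); rewrite lerDr.
have -> : x ^+ d = d.+1`!%:R / a ^+ d.+1 / x * ((a * x) ^+ d.+1 / d.+1`!%:R).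
  rewrite exprMn [x ^+ d.+1]exprS; field.
  by rewrite !lt0r_neq0 ?exprn_gt0.
by rewrite ler_wpM2l // !divr_ge0 ?exprn_ge0 // ltW.
Qed.

Lemma ler_div_of_nat (R : realType) (x eta : R) (n m : nat) : 0 < eta -> (0 < m)%N ->
  x / eta <= n%:R -> (n <= m)%N -> x / m%:R <= eta.
Proof.
move=> e0 m0 xn nm; rewrite ler_pdivrMr ?ltr0n // -ler_pdivrMl //.
by rewrite mulrC (le_trans xn) // ler_nat.
Qed.

Lemma near_perfect_matching (R : realType) (k d s : nat) (beta delta eps : R) (y0 : nat) :
  (d < k)%N -> 0 < delta <= 1 -> 0 < eps -> matchable_above k d s beta y0 ->
  exists K : R, exists N1 : nat, 0 <= K /\
    forall (V : finType) (E : {set {set V}}) (A : {set V}), uniform k E -> (N1 <= #|A|)%N ->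
    (forall S : {set V}, S \subset A -> #|S| = d ->
      (beta + delta) * #|A|%:R ^+ (k - d) <= (k - d)`!%:R * (sdeg E S A)%:R) ->
    has_spread (fun e : {set V} => if e \subset A then K / #|A|%:R ^+ (k - 1) else 0 : R)
      (fun M => [/\ is_matching E M, cover M \subset A & #|A :\: cover M|%:R <= eps * #|A|%:R]).
Proof.
move=> dk /andP[d0 d1] e0 hm; set r := (k - d)%N.
have k0 : (0 < k)%N by apply: leq_ltn_trans dk.
have F0 : 0 < r`!%:R :> R by rewrite ltr0n fact_gt0.
pose a : R := (delta / 2) ^+ 2 / (32 * r`!%:R ^+ 2).
have a0 : 0 < a.
  by rewrite divr_gt0 //; [rewrite exprn_gt0 // divr_gt0|rewrite mulr_gt0 // exprn_gt0].
(* Lower bounds for [m]: [n1] for the d resampled coordinates, [n2] for the drop of the mean (it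
   bounds [b] as well), [n3] for the [s] vertices left in a cluster, [n4] for bad clusters. *)
have [n1 hn1] := nat_above (r`!%:R * d%:R / (delta / 2)).
have [n2 hn2] := nat_above (r`!%:R / (delta / 8)).
have [n3 hn3] := nat_above (s%:R / (eps / 4)).
have [n4 hn4] := nat_above (d.+1`!%:R / a ^+ d.+1 / (eps / 8)).
have [m mbig ms] : exists2 m, (n1 + n2 + n3 + n4 + y0 + 1 <= m)%N & (m = s %[mod k])%N.
  exists (k * (n1 + n2 + n3 + n4 + y0 + 1) + s)%N; last by rewrite mulnC modnMDl.
  by apply: leq_trans (leq_addr _ _); rewrite leq_pmull.
have [m0 n1m n2m n3m n4m] : [/\ (0 < m)%N, (n1 <= m)%N, (n2 <= m)%N, (n3 <= m)%N & (n4 <= m)%N].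
  by clear -mbig; split; lia.
have my0 : (y0 <= m)%N by clear -mbig; lia.
have m0R : 0 < m%:R :> R by rewrite ltr0n.
have [n5 hn5] := nat_above (2 * m%:R / eps).
pose N1 := (m * (n2 + 1) + n5)%N.
(* From |A| <= m b + m <= 2 m b one gets b^(1-k) <= (2m / |A|)^(k-1). *)
pose K : R := 2 * expR 1 ^+ k * (2 * m%:R) ^+ (k - 1).
have K0 : 0 <= K by rewrite !mulr_ge0 ?exprn_ge0 ?mulr_ge0 ?expR_ge0.
exists K, N1; split=> // V E A uE AN degA.
have [b bE] : exists b, b = (#|A| %/ m)%N by exists (#|A| %/ m)%N.
have bn : (n2 + 1 <= b)%N.
  by rewrite bE leq_divRL // mulnC; apply: leq_trans AN; rewrite /N1 leq_addr.
have b0 : (0 < b)%N by apply: leq_trans bn; rewrite addn1.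
have b0R : 0 < b%:R :> R by rewrite ltr0n.
have bA : (m * b <= #|A|)%N by rewrite bE mulnC leq_divM.
have Ab : (#|A| <= m * b + m)%N.
  by rewrite bE mulnC -mulSnr ltnW // ltn_ceil.
have A0R : 0 < #|A|%:R :> R.
  by rewrite ltr0n; apply: leq_trans bA; rewrite muln_gt0 m0.
have [iota iinj iA] : exists2 f : 'I_m * 'I_b -> V, injective f & codom f \subset A.
  by apply: inj_into_set; rewrite card_prod !card_ord.
have := @cluster_matching R V m b iota iinj m0 b0 E k d s uE dk A beta delta iA Ab.
move=> /(_ _ degA _ _ y0 hm _ ms) H.
apply: has_spread_weaken (H _ _ _ _) => {H}.
- move=> e; case: ifP => _; last by rewrite lexx.
  rewrite !mulr_ge0 ?exprn_ge0 ?divr_ge0 ?expR_ge0 //=.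
  have -> : 2 * (b%:R * (expR 1 / b%:R) ^+ k) = 2 * expR 1 ^+ k / b%:R ^+ (k - 1) :> R.
    rewrite expr_div_n -{2}(subnK k0) addn1 exprS.
    by field; rewrite !lt0r_neq0 ?exprn_gt0.
  rewrite /K -!mulrA -expr_div_n !ler_pM2l ?exprn_gt0 ?expR_gt0 //.
  rewrite -exprVn lerXn2r ?nnegrE ?invr_ge0 ?divr_ge0 ?mulr_ge0 //.
  rewrite ler_pdivlMr // mulrC ler_pdivrMr //.
  rewrite -!natrM ler_nat; apply: leq_trans Ab _.
  by clear -b0; nia.
- move=> M [h1 h2 h3]; split=> //; apply: le_trans h3 _.
  set tl := expR _.
  have t1 : m%:R ^+ d * tl <= eps / 8.
    rewrite /tl (_ : (delta / 2) ^+ 2 * m%:R / (32 * r`!%:R ^+ 2) = a * m%:R); last first.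
      by rewrite /a; field; rewrite lt0r_neq0.
    apply: le_trans (expR_beats_pow d a0 m0R) _.
    by apply: (ler_div_of_nat _ m0 hn4 n4m); rewrite divr_gt0.
  have t2 : s%:R / m%:R <= eps / 4.
    by apply: (ler_div_of_nat _ m0 hn3 n3m); rewrite divr_gt0.
  have t3 : m%:R <= eps / 2 * #|A|%:R.
    have : 2 * m%:R / eps <= #|A|%:R.
      by apply: le_trans hn5 _; rewrite ler_nat; apply: leq_trans AN; rewrite /N1 leq_addl.
    rewrite ler_pdivrMr //; lra.
  have t4 : m%:R * b%:R <= #|A|%:R :> R by rewrite -natrM ler_nat.
  have t5 : s%:R * b%:R <= eps / 4 * #|A|%:R.
    have -> : s%:R * b%:R = (s%:R / m%:R) * (m%:R * b%:R) :> R.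
      by field; rewrite lt0r_neq0.
    by rewrite ler_pM ?divr_ge0 ?mulr_ge0.
  have t6 : 2 * (m%:R ^+ d * tl) * b%:R * m%:R <= eps / 4 * #|A|%:R.
    rewrite -[_ * b%:R * m%:R]mulrA [b%:R * _]mulrC; apply: ler_pM => //.
    + by rewrite mulr_ge0 // mulr_ge0 ?expR_ge0 ?exprn_ge0.
    + by rewrite mulr_ge0.
    + by move: t1; set u := _ * tl; clear; lra.
  move: t3 t5 t6; set u := _ * m%:R; set v := _ * b%:R; clear; lra.
- by rewrite ltW.
- by apply: (ler_div_of_nat _ m0 hn1 n1m); rewrite divr_gt0.
- have h1 : r`!%:R / m%:R <= delta / 8.
    by apply: (ler_div_of_nat _ m0 hn2 n2m); rewrite divr_gt0.
  have h2 : r`!%:R / b%:R <= delta / 8.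
    by apply: (ler_div_of_nat _ b0 hn2); [rewrite divr_gt0|apply: leq_trans bn; rewrite leq_addr].
  rewrite mulrDr (_ : m%:R / (m * b)%:R = b%:R^-1); last first.
    by rewrite natrM; field; rewrite !lt0r_neq0.
  lra.
- exact: my0.
Qed.

(** * Greedy covers *)

Section GreedyCover.
Variables (R : realType) (V : finType) (E : {set {set V}}) (k : nat).
Hypothesis uE : uniform k E.
Implicit Types (e L B : {set V}) (M : {set {set V}}).

Definition star v B := [set e in E | (v \in e) && (e :\ v \subset B)].

Lemma coverU M M' : cover (M :|: M') = cover M :|: cover M'.
Proof. by rewrite /cover bigcup_setU. Qed.

Lemma cover1 e : cover [set e] = e.
Proof. by rewrite /cover big_set1. Qed.

Lemma is_matchingU M M' : is_matching E M -> is_matching E M' ->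
  [disjoint cover M & cover M'] -> is_matching E (M :|: M').
Proof.
move=> /andP[ME tM] /andP[ME' tM'] dis; apply/andP; split; first by rewrite subUset ME.
apply/trivIsetP => e e'; rewrite !inE.
have sub (N : {set {set V}}) (x : {set V}) : x \in N -> x \subset cover N by move=> xN; apply: bigcup_sup.
case/orP => eM /orP[] eM' ne.
- exact: (trivIsetP tM).
- apply: disjointWl (sub _ _ eM) _; apply: disjointWr (sub _ _ eM') _; exact: dis.
- rewrite disjoint_sym; apply: disjointWl (sub _ _ eM') _.
  by apply: disjointWr (sub _ _ eM) _.
- exact: (trivIsetP tM').
Qed.

(** Vertices of [L] are served one after another by a uniformly random edge of the current star.
    Each edge uses at most k vertices of [B], so the bound [D] is demanded for all [B'] missing at
    most k |L| of them. *)
Lemma greedy_cover (D : R) L B : 0 < D -> [disjoint L & B] ->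
  (forall v B', v \in L -> B' \subset B -> (#|B :\: B'| <= k * #|L|)%N ->
     D <= #|star v B'|%:R) ->
  has_spread (fun e => if (#|e :&: L| == 1)%N && (e :\: L \subset B) then D^-1 else 0 : R)
    (fun M => [/\ is_matching E M, cover M \subset L :|: B, L \subset cover M &
       (#|cover M :&: B| <= k * #|L|)%N]).
Proof.
move=> D0; elim: {L}_.+1 {-2}L (ltnSn #|L|) B => // n IH L Ln B LB hstar.
have Di0 : 0 <= D^-1 by rewrite invr_ge0 ltW.
have [L0|/set0Pn[v vL]] := eqVneq L set0.
  apply: (@has_spread_point _ _ _ _ set0).
  - have c0 : cover (set0 : {set {set V}}) = set0 by rewrite /cover big_set0.
    rewrite c0 set0I cards0 sub0set L0 sub0set; split=> //.
    apply/andP; split; first exact: sub0set.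
    by apply/trivIsetP => e e'; rewrite inE.
  - by move=> e; case: ifP.
  - by move=> e; rewrite inE.
have cL : #|L| = #|L :\ v|.+1 by rewrite (cardsD1 v) vL.
have vB : v \notin B by rewrite (disjointFr LB vL).
pose w1 e : R := if e \in star v B then D^-1 else 0.
pose w2 e : R := if (#|e :&: (L :\ v)| == 1)%N && (e :\: (L :\ v) \subset B) then D^-1 else 0.
pose w e : R := if (#|e :&: L| == 1)%N && (e :\: L \subset B) then D^-1 else 0.
pose P M := [/\ is_matching E M, cover M \subset L :|: B, L \subset cover M &
       (#|cover M :&: B| <= k * #|L|)%N].
have starL e : e \in star v B -> e \subset v |: B.
  rewrite inE => /and3P[_ ve eB]; rewrite -(setD1K ve); exact: setUS.
(* The two weights have disjoint supports: an edge of the star meets [L] only in [v], a later edge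
   avoids [v]. So their sum stays below D^-1 instead of growing with |L|. *)
apply: (@has_spread_weaken _ _ (fun e => w1 e + w2 e) _ P) => [e|//|].
  rewrite addr_ge0 /=; try by rewrite /w1 /w2; case: ifP.
  rewrite /w1 /w2; case: ifP => [es|_]; last first.
    rewrite add0r; case: ifP => [/andP[/eqP c1 sB]|_]; last by case: ifP.
    have ve : v \notin e.
      apply: contra vB => ve; apply: (subsetP sB); by rewrite !inE eqxx ve.
    have -> : e :&: L = e :&: (L :\ v).
      apply/setP => u; rewrite !inE; have [ue|//] := boolP (u \in e).
      by have [uv|//] := eqVneq u v; rewrite uv (negbTE ve) in ue.
    rewrite c1 eqxx /= ifT //; apply/subsetP => u uL; apply: (subsetP sB).
    by move: uL; rewrite !inE => /andP[/negbTE -> ->]; rewrite andbF.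
  have ve : v \in e by move: es; rewrite inE => /and3P[].
  have eL : e :&: L = [set v].
    apply/setP => u; rewrite !inE; apply/andP/eqP => [[ue uL]|->]; last by rewrite ve.
    have := subsetP (starL _ es) _ ue; rewrite !inE => /orP[/eqP //|uB].
    by rewrite (disjointFr LB uL) in uB.
  have sB : e :\: L \subset B.
    apply/subsetP => u; rewrite inE => /andP[uL ue].
    have := subsetP (starL _ es) _ ue; rewrite !inE => /orP[/eqP uv|//].
    by rewrite uv vL in uL.
  rewrite eL cards1 eqxx sB /= ifF ?addr0 //; apply/negbTE; rewrite negb_and; apply/orP; left.
  suff -> : e :&: (L :\ v) = set0 by rewrite cards0.
  apply/setP => u; rewrite !inE; apply/negbTE; apply/negP => /and3P[ue uv uL].
  by have : u \in e :&: L by [rewrite inE ue]; rewrite eL inE (negbTE uv).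
apply: (@has_spread_bind _ _ w1 w2 (fun M1 => exists2 e, e \in star v B & M1 = [set e])).
- by move=> e; rewrite /w1; case: ifP.
- by move=> e; rewrite /w2; case: ifP.
- have cS : D <= #|star v B|%:R by apply: hstar; rewrite ?subxx // setDv cards0.
  have S0 : 0 < #|star v B|%:R :> R by apply: lt_le_trans cS.
  apply: (@has_spread_mix _ _ _ (star v B) _ (fun e0 e => (e == e0)%:R)).
  + by rewrite -card_gt0 -(ltr0n R).
  + by move=> e; rewrite /w1; case: ifP.
  + move=> e0 es; apply: (@has_spread_point _ _ _ _ [set e0]) => //; first by exists e0.
    by move=> e; rewrite inE => ->.
  + move=> S _ [e es ->]; rewrite subset1 => /orP[] /eqP ->.
      rewrite big_set1 /w1 es (eq_bigr (fun e0 => (e == e0)%:R)); last by move=> *; rewrite big_set1.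
      rewrite (bigD1 e) //= eqxx big1 ?addr0; last by move=> e0 /andP[_ /negbTE]; rewrite eq_sym => ->.
      by rewrite ler_pdivlMr // mul1r.
    rewrite big_set0 mulr1 (eq_bigr (fun=> 1)); last by move=> *; rewrite big_set0.
    by rewrite sumr_const.
move=> _ [e es ->].
have ce : #|e| = k.
  by apply/eqP; move/forall_inP: uE; apply; move: es; rewrite inE => /and3P[].
have ve : v \in e by move: es; rewrite inE => /and3P[].
have eE : e \in E by move: es; rewrite inE => /and3P[].
have disj : [disjoint L :\ v & B :\: e].
  apply/pred0P => u /=; rewrite !inE; apply/negbTE/negP => /andP[/andP[_ uL] /andP[_ uB]].
  by rewrite (disjointFr LB uL) in uB.
apply: has_spread_weaken (IH (L :\ v) _ (B :\: e) disj _).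
- move=> e'; rewrite /w2; case: ifP => [/andP[-> sB]|_]; last by rewrite lexx /=; case: ifP.
  by rewrite (subset_trans sB (subsetDl _ _)) /= Di0 lexx.
- move=> M [mM cM LM cMB].
  have eB : e \subset v |: B by apply: starL.
  have em : is_matching E [set e].
    apply/andP; split; first by rewrite sub1set.
    by apply/trivIsetP => a a'; rewrite !inE => /eqP -> /eqP ->; rewrite eqxx.
  have dis : [disjoint e & cover M].
    rewrite disjoint_sym disjoints_subset; apply: subset_trans cM _.
    apply/subsetP => u; rewrite !inE => /orP[/andP[uv uL]|/andP[] //].
    apply/negP => ue; have := subsetP eB _ ue; rewrite !inE (negbTE uv) /= => uB.
    by rewrite (disjointFr LB uL) in uB.
  rewrite /P coverU cover1; split.
  + by apply: is_matchingU => //; rewrite cover1.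
  + rewrite subUset; apply/andP; split.
      by apply: subset_trans eB _; rewrite setSU // sub1set.
    by apply: subset_trans cM _; apply: setUSS; [apply: subD1set|apply: subsetDl].
  + apply/subsetP => u uL; rewrite inE; have [->|uv] := eqVneq u v; first by rewrite ve.
    by rewrite (subsetP LM) ?orbT // !inE uv.
  + rewrite setIUl; apply: leq_trans (leq_card_setU _ _) _; rewrite cL mulnS leq_add //.
      by rewrite -ce subset_leq_card // subsetIl.
    apply: leq_trans cMB; apply: subset_leq_card; apply/subsetP => u.
    by rewrite !inE => /andP[uM ->]; rewrite uM (disjointFl dis uM).
- by rewrite -ltnS -cL.
- move=> u B' uL B'B cB; apply: hstar.
  + by move: uL; rewrite inE => /andP[].
  + by apply: subset_trans B'B (subsetDl _ _).
  + rewrite cL mulnS; apply: (@leq_trans (#|e| + #|(B :\: e) :\: B'|)); last by rewrite ce leq_add2l.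
    apply: leq_trans (leq_card_setU _ _); apply: subset_leq_card; apply/subsetP => x.
    by rewrite !inE => /andP[-> ->]; case: (x \in e).
Qed.

(** Averaging over (d-1)-sets [T] in [B] turns a bound on d-degrees into one for the single vertex
    [v]; an edge is counted at most 2^k times. The number [n] is the size of a reference set of
    which [B] has at least half. *)
Lemma star_card (d : nat) (theta n : R) v B : (0 < d < k)%N -> v \notin B -> 0 <= theta -> 0 <= n ->
  n <= 2 * #|B|%:R -> (2 * d <= #|B|)%N ->
  (forall S : {set V}, S \subset v |: B -> #|S| = d ->
     theta * n ^+ (k - d) <= (k - d)`!%:R * (sdeg E S B)%:R) ->
  theta / (2 ^+ k * (k - d)`!%:R * 4 ^+ d.-1 * (d.-1)`!%:R) * n ^+ (k - 1) <= #|star v B|%:R.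
Proof.
move=> /andP[d0 dk] vB t0 n0 nB dB hdeg.
pose U := [set T : {set V} | T \subset B & #|T| == d.-1].
have cU : (#|U| = 'C(#|B|, d.-1))%N by rewrite cards_draws.
have H1 : (\sum_(T in U) sdeg E (v |: T) B <= #|star v B| * 2 ^ k)%N.
  rewrite /sdeg; under eq_bigr => T _ do rewrite -sum1_card.
  rewrite (exchange_big_dep [in star v B]) /=; last first.
    move=> T e TU; rewrite !inE => /and3P[-> sub eB]; rewrite (subsetP sub) ?setU11 //=.
    move: TU; rewrite inE => /andP[TB _].
    apply/subsetP => u; rewrite inE => /andP[uv ue]; have [uT|uT] := boolP (u \in T).
      by apply: (subsetP TB).
    by apply: (subsetP eB); move: uv; rewrite !inE (negbTE uT) orbF ue => ->.
  rewrite -sum_nat_const; apply: leq_sum => e es; rewrite sum1_card.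
  have ce : #|e| = k.
    by apply/eqP; move/forall_inP: uE; apply; move: es; rewrite inE => /and3P[].
  rewrite -ce -card_powerset; apply: subset_leq_card; apply/subsetP => T.
  rewrite powersetE unfold_in /= => /andP[_]; rewrite inE => /and3P[_ + _].
  by apply: subset_trans; apply: subsetUr.
have F1 : 0 < (k - d)`!%:R :> R by rewrite ltr0n fact_gt0.
have F2 : 0 < (d.-1)`!%:R :> R by rewrite ltr0n fact_gt0.
have H2 : #|U|%:R * (theta * n ^+ (k - d) / (k - d)`!%:R) <= #|star v B|%:R * 2 ^+ k.
  rewrite -natrX -natrM; apply: (@le_trans _ _ (\sum_(T in U) sdeg E (v |: T) B)%:R); last by rewrite ler_nat.
  rewrite natr_sum mulr_natl -sumr_const; apply: ler_sum => T; rewrite inE => /andP[TB /eqP cT].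
  rewrite ler_pdivrMr // [X in _ <= X]mulrC; apply: hdeg; first exact: setUS.
  rewrite cardsU1 cT (_ : v \notin T) ?add1n ?prednK //.
  by apply: contra vB => /(subsetP TB).
(* Each factor of the falling factorial is at least |B| - d, hence at least |B|/2 and n/4. *)
have H3 : (n / 4) ^+ d.-1 <= (d.-1)`!%:R * #|U|%:R.
  rewrite cU -natrM mulnC bin_ffact.
  have h : forall q, (q <= d)%N -> (n / 4) ^+ q <= (#|B| ^_ q)%:R.
    elim=> [|q IHq] qd; first by rewrite expr0 ffactn0.
    rewrite exprSr ffactnSr natrM; apply: ler_pM => //.
    - by rewrite exprn_ge0 // divr_ge0.
    - by rewrite divr_ge0.
    - by apply: IHq; apply: ltnW.
    - rewrite natrB; last by lia.
      have : (q%:R : R) <= d%:R by rewrite ler_nat ltnW.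
      have : (2 * d)%:R <= #|B|%:R :> R by rewrite ler_nat.
      rewrite natrM; lra.
  by apply: h; rewrite leq_pred.
have P0 : 0 < 2 ^+ k * (k - d)`!%:R * 4 ^+ d.-1 * (d.-1)`!%:R :> R.
  by rewrite !mulr_gt0 ?exprn_gt0.
rewrite mulrAC ler_pdivrMr //.
have -> : (k - 1 = (k - d) + d.-1)%N by clear -d0 dk; lia.
rewrite exprD.
apply: (@le_trans _ _ ((theta * n ^+ (k - d)) * ((d.-1)`!%:R * #|U|%:R * 4 ^+ d.-1))).
  rewrite [X in X <= _]mulrA ler_wpM2l ?mulr_ge0 ?exprn_ge0 //.
  by rewrite -ler_pdivrMr ?exprn_gt0 // -expr_div_n.
have := ler_wpM2r (mulr_ge0 (mulr_ge0 (ltW F1) (exprn_ge0 d.-1 (ler0n R 4))) (ltW F2)) H2.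
congr (_ <= _); last by ring.
by field; rewrite lt0r_neq0.
Qed.

End GreedyCover.

(** * Descending the vortex *)

(** Disjoint edges have disjoint vertex sets, so J of them lie in a random transversal with
    probability at most b^(-k|J|), as if independently. Expanding both products over J gives the
    bound. *)
Lemma transv_product (R : realType) (V : finType) (M b k : nat) (iota : 'I_M * 'I_b -> V)
    (a c : R) (S : {set {set V}}) :
  injective iota -> (0 < b)%N -> trivIset S -> (forall e, e \in S -> #|e| = k) -> 0 <= a -> 0 <= c ->
  \sum_(x : {ffun 'I_M -> 'I_b}) \prod_(e in S) (c * (e \subset transv iota x)%:R + a)
    <= (b ^ M)%:R * (c / b%:R ^+ k + a) ^+ #|S|.
Proof.
move=> iinj b0 tS cS a0 c0; have b0R : 0 < b%:R :> R by rewrite ltr0n.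
rewrite -prodr_const prod_addr_powerset mulr_sumr.
under eq_bigr => x _ do rewrite prod_addr_powerset.
rewrite exchange_big /=; apply: ler_sum => J; rewrite powersetE => JS.
rewrite -mulr_suml mulrA; apply: ler_wpM2r; first by rewrite prodr_ge0.
have tJ := trivIsetS JS tS.
have cJ : #|cover J| = (k * #|J|)%N.
  by rewrite -(eqP tJ) (eq_bigr (fun=> k)) ?sum_nat_const 1?mulnC // => e /(subsetP JS)/cS.
rewrite (eq_bigr (fun x => c ^+ #|J| * \prod_(e in J) (e \subset transv iota x)%:R)) => [|x _]; last first.
  by rewrite big_split /= prodr_const.
rewrite -mulr_sumr prodr_const exprMn mulrCA; apply: ler_wpM2l; first exact: exprn_ge0.
rewrite exprVn -exprM ler_pdivlMr ?exprn_gt0 // -cJ.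
apply: (@le_trans _ _ (#|[set x | cover J \subset transv iota x]|%:R * b%:R ^+ #|cover J|)); last first.
  by rewrite -natrX -natrM ler_nat transv_containing_le.
apply: ler_wpM2r; first exact: exprn_ge0.
rewrite -sum1_card natr_sum [X in _ <= X]big_mkcond /=; apply: ler_sum => x _.
rewrite inE; case: ifP => [_|/negbT nsub].
  by apply: prodr_ile1 => e _; case: (e \subset _); rewrite ?lexx ?ler01.
have [e /andP[eJ esub]] : exists e, (e \in J) && ~~ (e \subset transv iota x).
  apply/existsP; apply: contraNT nsub; rewrite negb_exists => /forallP H.
  apply/subsetP => v /bigcupP[e eJ ve]; have := H e; rewrite eJ negbK => /subsetP; exact.
by rewrite (bigD1 e) //= (negbTE esub) mul0r.
Qed.

Lemma leq_expn_base a b j : (a <= b)%N -> (a ^ j <= b ^ j)%N.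
Proof. by move=> ab; case: j => // j; rewrite leq_exp2r. Qed.

Section Vortex.
Variables (R : realType) (V : finType) (E : {set {set V}}) (k d s : nat).
Variables (beta delta eps Kc K1 K : R) (h N0 N1 y0 : nat).
Hypotheses (uE : uniform k E) (d0 : (0 < d)%N) (dk : (d < k)%N).
Hypotheses (beta0 : 0 <= beta) (delta0 : 0 < delta) (delta1 : delta <= 1).
Hypotheses (h16 : (16 <= h)%N) (h2k : (2 ^ k.+1 <= h)%N).
Let r := (k - d)%N.
Hypothesis hh : r`!%:R / h%:R <= delta / 4.
Hypotheses (eps0 : 0 < eps) (heps : r`!%:R * (k%:R * (2 * h%:R * eps)) <= delta / 4).
Hypothesis near_perfect : forall A : {set V}, (N1 <= #|A|)%N ->
    (forall S : {set V}, S \subset A -> #|S| = d ->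
      (beta + delta) * #|A|%:R ^+ r <= r`!%:R * (sdeg E S A)%:R) ->
    has_spread (fun e : {set V} => if e \subset A then Kc / #|A|%:R ^+ (k - 1) else 0 : R)
      (fun M => [/\ is_matching E M, cover M \subset A & #|A :\: cover M|%:R <= eps * #|A|%:R]).
Hypothesis hmatch : matchable_above k d s beta y0.
Hypotheses (N0y0 : (y0 <= N0)%N) (N0d : (4 * d <= N0)%N) (N0pos : (0 < N0)%N).
Hypothesis N0delta : 8 * r`!%:R / delta <= N0%:R.
Hypothesis N0N1 : N1%:R <= 2 * h%:R * eps * N0%:R.
(* [256 * 64 = 128 ^ 2]: the tail exponent at level [j] is
   [delta ^ 2 * M / (128 * r`! ^ 2 * 4 ^ j)]. *)
Hypothesis N0tail : 2 * ((2 * h%:R) ^+ d * (2 * d.+1)`!%:R *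
  (256 * r`!%:R ^+ 4 * 64 / delta ^+ 4) ^+ d.+1) <= N0%:R.
Let c0 : R := delta / (2 ^+ k * r`!%:R * 4 ^+ d.-1 * (d.-1)`!%:R).
Hypotheses (Kc0 : 0 <= Kc) (K1c : Kc / (2 * h%:R * eps) ^+ (k - 1) <= K1) (K1g : c0^-1 <= K1).
Hypothesis K1base : (h * N0)%:R ^+ (k - 1) <= K1.
Hypothesis KE : K = 4 * (2 * h%:R) ^+ (k - 1) * K1.
Implicit Types (S A B L X Y W e : {set V}) (M : {set {set V}}).

Let k0 : (0 < k)%N. Proof. exact: leq_ltn_trans dk. Qed.
Let h0 : (0 < h)%N. Proof. exact: leq_trans h16. Qed.
Let F0 : 0 < r`!%:R :> R. Proof. by rewrite ltr0n fact_gt0. Qed.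
Let h0R : 0 < h%:R :> R. Proof. by rewrite ltr0n. Qed.
Let c00 : 0 < c0.
Proof. by rewrite divr_gt0 // !mulr_gt0 ?exprn_gt0 // ltr0n fact_gt0. Qed.
Let K10 : 0 < K1. Proof. by apply: lt_le_trans K1g; rewrite invr_gt0. Qed.

Lemma sdeg_loss (theta : R) X Y S : #|S| = d -> X \subset Y -> (0 < #|Y|)%N ->
  beta + 2 * delta <= theta ->
  r`!%:R * #|Y :\: X|%:R <= delta * #|Y|%:R ->
  theta * #|Y|%:R ^+ r <= r`!%:R * (sdeg E S Y)%:R ->
  (beta + delta) * #|Y|%:R ^+ r <= r`!%:R * (sdeg E S X)%:R.
Proof.
move=> cS XY Y0 ht hW hY; have Y0R : 0 < #|Y|%:R :> R by rewrite ltr0n.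
have := sdeg_setD S Y (Y :\: X) uE; rewrite cS -/r setDDr setDv set0U (setIidPr XY).
rewrite -(ler_nat R) natrD !natrM natrX => H.
rewrite -(ler_pM2r Y0R).
have h1 : r`!%:R * ((sdeg E S Y)%:R * #|Y|%:R) <=
  r`!%:R * ((sdeg E S X)%:R * #|Y|%:R) + delta * #|Y|%:R * #|Y|%:R ^+ r.
  apply: le_trans (ler_wpM2l (ltW F0) H) _; rewrite mulrDr lerD2l mulrA.
  by apply: ler_wpM2r => //; apply: exprn_ge0.
have h2 : (beta + 2 * delta) * #|Y|%:R ^+ r * #|Y|%:R <= r`!%:R * ((sdeg E S Y)%:R * #|Y|%:R).
  rewrite [X in _ <= X]mulrA; apply: ler_wpM2r => //; apply: le_trans hY.
  by apply: ler_wpM2r => //; apply: exprn_ge0.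
move: (le_trans h2 h1); rewrite mulrA; set y := _ ^+ r; lra.
Qed.

(** [A] may be too small for [near_perfect]. Then it is left uncovered by the empty matching, which
    the leftover bound, measured against [n], permits. *)
Lemma cover_A A (n : nat) : (N0 <= n)%N -> (#|A| <= 2 * h * n)%N ->
  (forall S, S \subset A -> #|S| = d ->
      (beta + delta) * #|A|%:R ^+ r <= r`!%:R * (sdeg E S A)%:R) ->
  has_spread (fun e => if e \subset A then K1 / n%:R ^+ (k - 1) else 0 : R)
    (fun M => [/\ is_matching E M, cover M \subset A &
        #|A :\: cover M|%:R <= 2 * h%:R * eps * n%:R]).
Proof.
move=> Nn An degA.
have n0 : 0 < n%:R :> R by rewrite ltr0n (leq_trans N0pos).
have he0 : 0 < 2 * h%:R * eps by rewrite !mulr_gt0.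
have [small|large] := leP #|A|%:R (2 * h%:R * eps * n%:R).
  apply: (@has_spread_point _ _ _ _ set0).
  - have c0' : cover (set0 : {set {set V}}) = set0 by rewrite /cover big_set0.
    rewrite c0' sub0set setD0; split=> //; apply/andP; split; first exact: sub0set.
    by apply/trivIsetP => e e'; rewrite inE.
  - by move=> e; case: ifP => // _; rewrite divr_ge0 ?exprn_ge0 // ltW.
  - by move=> e; rewrite inE.
have AN : (N1 <= #|A|)%N.
  rewrite -(ler_nat R); apply: le_trans (ltW large); apply: le_trans N0N1 _.
  by rewrite ler_pM2l // ler_nat.
apply: has_spread_weaken (near_perfect AN degA).
- move=> e; case: ifP => _; last by rewrite lexx.
  rewrite divr_ge0 ?exprn_ge0 //=.
  rewrite ler_pdivrMr ?exprn_gt0 //; last by rewrite (lt_trans _ large) // mulr_gt0.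
  rewrite mulrAC ler_pdivlMr ?exprn_gt0 //.
  move: K1c; rewrite ler_pdivrMr ?exprn_gt0 // => h1.
  apply: le_trans (ler_wpM2r _ h1) _; first exact: exprn_ge0.
  rewrite -[X in X <= _]mulrA -exprMn ler_pM2l // lerXn2r ?nnegrE ?ltW //.
    by rewrite mulr_gt0.
  by apply: lt_trans large; rewrite mulr_gt0.
- move=> M [h1 h2 h3]; split=> //; apply: le_trans h3 _.
  have hA : #|A|%:R <= 2 * h%:R * n%:R :> R by rewrite -!natrM ler_nat.
  apply: le_trans (ler_wpM2l (ltW eps0) hA) _.
  by rewrite le_eqVlt; apply/orP; left; apply/eqP; ring.
Qed.

(** Degrees into [B] survive k |L| deletions: [Y] has lost a fraction 1/h to the next core and
    little to earlier edges, each worth at most delta / 4. Density [delta] is left for the star of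
    every vertex of [L]. *)
Lemma cover_leftover A B Y L (theta : R) : [disjoint A & Y] -> B \subset Y ->
  L \subset A -> (N0 <= #|Y|)%N -> beta + 2 * delta <= theta ->
  (forall S, S \subset A :|: Y -> #|S| = d -> theta * #|Y|%:R ^+ r <= r`!%:R * (sdeg E S Y)%:R) ->
  #|L|%:R <= 2 * h%:R * eps * #|Y|%:R :> R -> h%:R * #|Y :\: B|%:R <= #|Y|%:R :> R ->
  has_spread (fun e => if (#|e :&: L| == 1)%N && (e :\: L \subset B)
                       then K1 / #|Y|%:R ^+ (k - 1) else 0 : R)
    (fun M => [/\ is_matching E M, cover M \subset L :|: B, L \subset cover M &
       (#|cover M :&: B| <= k * #|L|)%N]).
Proof.
move=> AY BY LA NY ht degY cL cB.
have Y0 : (0 < #|Y|)%N by apply: leq_trans NY.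
have Y0R : 0 < #|Y|%:R :> R by rewrite ltr0n.
have dk' : (0 < d < k)%N by rewrite d0.
have D0 : 0 < c0 * #|Y|%:R ^+ (k - 1) by rewrite mulr_gt0 ?exprn_gt0.
have LB : [disjoint L & B].
  by apply: disjointWl LA _; apply: disjointWr BY _.
have gc := greedy_cover uE D0 LB; apply: (has_spread_weaken _ _ (gc _)) => //.
  move=> e; case: ifP => _; last by rewrite lexx.
  rewrite invr_ge0 ltW //= invfM ler_pM2r // invr_gt0 exprn_gt0 //.
move=> v B' vL B'B cB'.
have loss : r`!%:R * #|Y :\: B'|%:R <= delta / 2 * #|Y|%:R.
  have : (#|Y :\: B'| <= #|Y :\: B| + k * #|L|)%N.
    apply: leq_trans (leq_add (leqnn _) cB'); apply: leq_trans (leq_card_setU _ _).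
    apply: subset_leq_card; apply/subsetP => u; rewrite !inE => /andP[-> ->].
    by case: (u \in B).
  rewrite -(ler_nat R) natrD natrM => h1.
  apply: le_trans (ler_wpM2l (ltW F0) h1) _; rewrite mulrDr.
  have h2 : r`!%:R * #|Y :\: B|%:R <= delta / 4 * #|Y|%:R.
    have -> : r`!%:R * #|Y :\: B|%:R = r`!%:R / h%:R * (h%:R * #|Y :\: B|%:R) :> R.
      by field; rewrite lt0r_neq0.
    apply: ler_pM => //; last by rewrite mulr_ge0.
    by rewrite divr_ge0 // ltW.
  have h3 : r`!%:R * (k%:R * #|L|%:R) <= delta / 4 * #|Y|%:R.
    apply: (@le_trans _ _ (r`!%:R * (k%:R * (2 * h%:R * eps * #|Y|%:R)))).
      by rewrite ler_pM2l // ler_wpM2l.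
    by rewrite mulrA [X in X <= _](_ : _ = r`!%:R * (k%:R * (2 * h%:R * eps)) * #|Y|%:R) ?ler_pM2r //; ring.
  lra.
have YB' : (2 * #|Y :\: B'| <= #|Y|)%N.
  rewrite -(ler_nat R) natrM.
  have f1 : 1 <= r`!%:R :> R by rewrite ler1n fact_gt0.
  have : 1 * #|Y :\: B'|%:R <= r`!%:R * #|Y :\: B'|%:R :> R by rewrite ler_wpM2r.
  have : delta / 2 * #|Y|%:R <= 1 / 2 * #|Y|%:R :> R.
    by apply: ler_wpM2r => //; move: delta1; lra.
  move: loss; lra.
have B'Y : B' \subset Y by apply: subset_trans BY.
have cYB' : (#|Y :\: B'| + #|B'| = #|Y|)%N.
  by rewrite cardsD (setIidPr B'Y) subnK // subset_leq_card.
have vB' : v \notin B'.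
  by apply/negP => /(subsetP B'B) vB; rewrite (disjointFr LB vL) in vB.
apply: (@star_card R V E k uE d delta #|Y|%:R v B') => //.
- exact: ltW.
- by rewrite -natrM ler_nat -cYB'; clear -YB' cYB'; lia.
- by clear -YB' cYB' NY N0d; lia.
- move=> S Sv cS.
  apply: (@le_trans _ _ ((beta + delta) * #|Y|%:R ^+ r)).
    by apply: ler_wpM2r; [apply: exprn_ge0|rewrite lerDr].
  apply: (@sdeg_loss theta _ _ _ cS B'Y Y0 ht).
    by apply: le_trans loss _; apply: ler_wpM2r => //; move: (ltW delta0); lra.
  apply: degY => //; apply: subset_trans Sv _; rewrite subUset sub1set inE (subsetP LA) //=.
  by apply: subset_trans B'Y (subsetUr _ _).
Qed.


(* Passing from level [j.+1] to level [j] costs [delta / 2 ^+ j.+1], which is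
   summable, so the density never drops below [beta + 2 * delta]. *)
Definition level_density j : R := beta + 3 * delta - delta / 2 ^+ j.

Lemma level_density_ge j : beta + 2 * delta <= level_density j.
Proof.
have h1 : delta / 2 ^+ j <= delta by rewrite ler_pdivrMr ?exprn_gt0 // ler_peMr ?exprn_ege1 ?ler1n // ltW.
rewrite /level_density; lra.
Qed.

Lemma level_densityS j : level_density j.+1 - delta / 2 ^+ j.+1 = level_density j.
Proof. by rewrite /level_density exprS; field; rewrite expf_neq0 // pnatr_eq0. Qed.

(** [S] ranges over subsets of [Y], not only of [X]: leftovers of [Y] must later be matched into
    [X]. *)
Definition good_core j Y X := [forall S : {set V}, (S \subset Y) && (#|S| == d) ==>
   (level_density j * #|X|%:R ^+ r <= r`!%:R * (sdeg E S X)%:R)].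

(** Union bound against tail. Though the admissible loss shrinks like 2^(-j), the exponent is of
    order M / 4^j, and M >= N0 h^j with h >= 16 makes its square at least of order N0 M. *)
Lemma level_tail j (M n : nat) : (n <= 2 * h * M)%N -> (N0 * h ^ j <= M)%N ->
  n%:R ^+ d * expR (- ((delta / 2 ^+ j.+1) ^+ 2 * M%:R / (32 * r`!%:R ^+ 2))) <= 2^-1.
Proof.
move=> nM NM; set y := _ / (32 * _).
have N0R : 0 < N0%:R :> R by rewrite ltr0n.
have N01 : 1 <= N0%:R :> R by rewrite ler1n.
have M0 : (0 < M)%N by apply: leq_trans NM; rewrite muln_gt0 N0pos expn_gt0 h0.
have M0R : 0 < M%:R :> R by rewrite ltr0n.
have M1 : 1 <= M%:R :> R by rewrite ler1n.
pose C : R := 256 * r`!%:R ^+ 4 * 64 / delta ^+ 4.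
have C0 : 0 < C by rewrite divr_gt0 ?mulr_gt0 ?exprn_gt0.
have y0' : 0 <= y by rewrite divr_ge0 // mulr_ge0 ?sqr_ge0.
have y2 : N0%:R * M%:R / C <= y ^+ 2.
  have -> : y ^+ 2 = (M%:R / 16 ^+ j) * M%:R / C.
    rewrite /y /C [2 ^+ j.+1]exprS (_ : 16 ^+ j = (2 ^+ j) ^+ 4 :> R); last first.
      by rewrite -exprM mulnC exprM; congr (_ ^+ _); ring.
    by field; rewrite !lt0r_neq0 ?exprn_gt0.
  rewrite ler_pM2r ?invr_gt0 // ler_pM2r // ler_pdivlMr ?exprn_gt0 //.
  rewrite -natrX -natrM ler_nat; apply: leq_trans NM.
  by rewrite leq_mul2l leq_expn_base ?orbT.
rewrite expRN ler_pdivrMr ?expR_gt0 // -ler_pdivrMl ?invr_gt0 // invrK.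
(* The Taylor term of degree 2(d + 1) is a power of y^2 and yields (N0 M)^(d+1), more than the M^d
   to be beaten. *)
have e1 : y ^+ (2 * d.+1) / (2 * d.+1)`!%:R <= expR y.
  have -> : (2 * d.+1 = (2 * d).+1.+1)%N by rewrite mulnS.
  by apply: le_trans (expR_ge1Dxn (2 * d).+1 y0'); rewrite lerDr.
apply: le_trans e1; rewrite ler_pdivlMr ?ltr0n ?fact_gt0 // exprM.
apply: (@le_trans _ _ ((N0%:R * M%:R / C) ^+ d.+1)); last first.
  rewrite lerXn2r ?nnegrE ?sqr_ge0 //; apply: divr_ge0; [exact: mulr_ge0|exact: ltW].
rewrite expr_div_n ler_pdivlMr ?exprn_gt0 //.
apply: (@le_trans _ _ (2 * (2 * h%:R * M%:R) ^+ d * (2 * d.+1)`!%:R * C ^+ d.+1)).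
  rewrite ler_pM2r ?exprn_gt0 // ler_pM2r ?ltr0n ?fact_gt0 // ler_pM2l //.
  rewrite lerXn2r ?nnegrE ?mulr_ge0 //.
  by rewrite -!natrM ler_nat.
apply: (@le_trans _ _ (N0%:R * M%:R ^+ d)).
  have := N0tail; rewrite -/C => t; apply: le_trans (ler_wpM2r _ t); last by rewrite exprn_ge0.
  by rewrite exprMn le_eqVlt; apply/orP; left; apply/eqP; ring.
rewrite exprMn ler_pM //; first by rewrite exprn_ge0.
  by rewrite exprS ler_peMr // exprn_ege1.
by rewrite exprS ler_peMl ?exprn_ge0.
Qed.

Lemma good_core_half j Y (M : nat) (iota : 'I_M * 'I_h -> V) : injective iota -> codom iota \subset Y ->
  (#|Y| <= M * h + h)%N -> (N0 * h ^ j <= M)%N ->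
  (forall S, S \subset Y -> #|S| = d ->
     level_density j.+1 * #|Y|%:R ^+ r <= r`!%:R * (sdeg E S Y)%:R) ->
  (h ^ M)%:R <= 2 * #|[set x : {ffun 'I_M -> 'I_h} | good_core j Y (transv iota x)]|%:R :> R.
Proof.
move=> iinj iY cY NM degY.
have M0 : (0 < M)%N by apply: leq_trans NM; rewrite muln_gt0 N0pos expn_gt0 h0.
have M0R : 0 < M%:R :> R by rewrite ltr0n.
set G := [set x | _]; set T := expR (- ((delta / 2 ^+ j.+1) ^+ 2 * M%:R / (32 * r`!%:R ^+ 2))).
pose D := [set S : {set V} | (S \subset Y) && (#|S| == d)].
pose B S := [set x : {ffun 'I_M -> 'I_h} |
   r`!%:R * (sdeg E S (transv iota x))%:R < (level_density j.+1 - delta / 2 ^+ j.+1) * M%:R ^+ r].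
have cG : (#|~: G| <= \sum_(S in D) #|B S|)%N.
  apply: (@leq_trans #|\bigcup_(S in D) B S|).
    apply: subset_leq_card; apply/subsetP => x; rewrite !inE negb_forall => /existsP[S].
    rewrite negb_imply -ltNge card_transv // -level_densityS => /andP[SD sp].
    by apply/bigcupP; exists S; rewrite inE.
  elim/big_rec2: _ => [|S n C _ IH]; first by rewrite cards0.
  by apply: leq_trans (leq_card_setU _ _) _; rewrite leq_add2l.
have p2 : 0 < 2 ^+ j.+1 :> R by rewrite exprn_gt0.
have small : r`!%:R * (h%:R / (M * h)%:R + M%:R^-1) <= delta / 2 ^+ j.+1 / 2.
  have -> : h%:R / (M * h)%:R + M%:R^-1 = 2 / M%:R :> R.
    by rewrite natrM; field; rewrite !lt0r_neq0.
  rewrite mulrA ler_pdivrMr // -[delta / _ / 2]mulrA -mulrA -ler_pdivrMl //.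
  apply: (@le_trans _ _ (N0%:R * 2 ^+ j / 4)).
    have := N0delta; rewrite ler_pdivrMr // => h1.
    have j1 : 1 <= 2 ^+ j :> R by rewrite exprn_ege1 // ler1n.
    rewrite mulrC ler_pdivrMr // ; apply: (@le_trans _ _ (N0%:R * delta / 4)).
      lra.
    rewrite [X in _ <= X](_ : _ = (N0%:R * delta / 4) * 2 ^+ j); last by ring.
    by rewrite ler_peMr // divr_ge0 // mulr_ge0 // ltW.
  have -> : (2 ^+ j.+1)^-1 / 2 * M%:R = M%:R / 2 ^+ j / 4 :> R.
    by rewrite exprS; field; rewrite lt0r_neq0 // exprn_gt0.
  rewrite ler_pM2r ?invr_gt0 // ler_pdivlMr ?exprn_gt0 // -mulrA -exprMn.
  rewrite -natrM -natrX -natrM ler_nat; apply: leq_trans NM.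
  by rewrite leq_mul2l leq_expn_base ?orbT // (leq_trans _ h16).
have cB S : S \in D -> #|B S|%:R <= (h ^ M)%:R * T.
  rewrite inE => /andP[SY /eqP cS].
  have := @transv_sdeg_tail R V M h iota iinj M0 h0 E k S uE Y h (level_density j.+1) (delta / 2 ^+ j.+1).
  rewrite cS -/r; apply => //; first exact: degY.
  apply/andP; split; first by rewrite divr_ge0 ?exprn_ge0 // ltW.
  rewrite ler_pdivrMr // mul1r.
  by apply: le_trans delta1 _; rewrite exprn_ege1 // ler1n.
have cD : (#|D| <= #|Y| ^ d)%N.
  by rewrite /D cards_draws bin_le_exp.
have Yn : (#|Y| <= 2 * h * M)%N by apply: leq_trans cY _; clear -M0; nia.
have bound : #|~: G|%:R <= (h ^ M)%:R / 2 :> R.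
  apply: (@le_trans _ _ (\sum_(S in D) #|B S|%:R)); first by rewrite -natr_sum ler_nat.
  apply: (@le_trans _ _ (\sum_(S in D) ((h ^ M)%:R * T))); first by apply: ler_sum.
  rewrite sumr_const -[X in X <= _]mulr_natl mulrCA; apply: ler_wpM2l => //.
  apply: le_trans (level_tail Yn NM); apply: ler_wpM2r; first exact: expR_ge0.
  by rewrite -natrX ler_nat.
have : (#|G| + #|~: G|)%:R = (h ^ M)%:R :> R by rewrite cardsC card_ffun !card_ord.
rewrite natrD; lra.
Qed.


(** [Y] is the current set of the vortex and [A] what remains of its predecessor; [j] counts the
    levels below. The three degree conditions serve, in order, the clusters in [A], the greedy step
    with the next core, and the bottom level. The size bounds make |Y| the common scale of all
    weights. *)
Definition vstate j A Y :=
  [/\ [disjoint A & Y], (N0 * h ^ j <= #|Y| < N0 * h ^ j.+1)%N, (#|A| <= 2 * h * #|Y|)%N,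
      (#|A :|: Y| = s %[mod k])%N &
   [/\ forall S, S \subset A -> #|S| = d ->
         (beta + delta) * #|A|%:R ^+ r <= r`!%:R * (sdeg E S A)%:R,
       forall S, S \subset A :|: Y -> #|S| = d ->
         level_density j * #|Y|%:R ^+ r <= r`!%:R * (sdeg E S Y)%:R &
       forall S, S \subset A :|: Y -> #|S| = d ->
         (beta + delta) * #|A :|: Y|%:R ^+ r <= r`!%:R * (sdeg E S (A :|: Y))%:R]].

(* Edges meeting [A] are chosen at the current level, at cost [K1]; for an edge
   inside [Y] the levels below contribute a geometric series, absorbed by [K]. *)
Definition vweight A Y e : R :=
  if e \subset Y then K / #|Y|%:R ^+ (k - 1)
  else if e \subset A :|: Y then K1 / #|Y|%:R ^+ (k - 1) else 0.

Definition voutcome A Y M :=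
  [/\ is_matching E M, cover M \subset A :|: Y & #|M| = (#|A :|: Y| %/ k)%N].

Lemma K1_le_K : K1 <= K.
Proof.
rewrite KE ler_peMl ?(ltW K10) //.
have : 1 <= (2 * h%:R) ^+ (k - 1) :> R.
  by rewrite exprn_ege1 // -natrM ler1n muln_gt0.
lra.
Qed.

Let K0 : 0 < K. Proof. exact: lt_le_trans K1_le_K. Qed.

Lemma vweight_ge0 A Y e : 0 <= vweight A Y e.
Proof.
rewrite /vweight; case: ifP => _; first by rewrite divr_ge0 ?exprn_ge0 // ltW.
by case: ifP => // _; rewrite divr_ge0 ?exprn_ge0 // ltW.
Qed.

(** At the bottom |Y| < h N0, so [K1] is at least |Y|^(k-1), all relevant weights are at least 1 and
    a single matching will do. *)
Lemma vortex_base A Y : vstate 0 A Y -> has_spread (vweight A Y) (voutcome A Y).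
Proof.
move=> [AY /andP[NY YN] cA res [_ _ deg]].
rewrite expn0 muln1 in NY; rewrite expn1 in YN.
have Y0 : 0 < #|Y|%:R :> R by rewrite ltr0n (leq_trans N0pos).
have cY : (y0 <= #|A :|: Y|)%N.
  by apply: leq_trans (leq_trans N0y0 NY) _; rewrite subset_leq_card // subsetUr.
have [S SU cS|M [h1 h2 h3]] := hmatch uE cY res.
  apply: le_trans (deg S SU cS); apply: ler_wpM2r; first exact: exprn_ge0.
  by rewrite lerDl ltW.
have big (c : R) : K1 <= c -> 1 <= c / #|Y|%:R ^+ (k - 1).
  move=> Kc'; rewrite ler_pdivlMr ?exprn_gt0 // mul1r; apply: le_trans Kc'.
  apply: le_trans K1base; rewrite lerXn2r ?nnegrE // ler_nat mulnC; exact: ltnW.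
apply: (@has_spread_point _ _ _ _ M) => //; first exact: vweight_ge0.
move=> e eM; rewrite /vweight; case: ifP => _; first by apply: big; apply: K1_le_K.
rewrite ifT; first exact: big.
by apply: subset_trans h2; apply: bigcup_sup.
Qed.

(** An edge in [Y] falls into the core with probability h^(-k), while passing from |Y| to the core
    size raises weights by a factor of order h^(k-1). The net factor of order 1/h lets the recursion
    for [K] close. *)
Lemma vortex_mix A Y (M : nat) (iota : 'I_M * 'I_h -> V) (G : {set {ffun 'I_M -> 'I_h}}) :
  [disjoint A & Y] -> injective iota -> (0 < #|Y|)%N -> (#|Y| <= 2 * h * M)%N ->
  (h ^ M)%:R <= 2 * #|G|%:R :> R ->
  (forall x, x \in G -> has_spread (fun e =>
      (if e \subset A then K1 / #|Y|%:R ^+ (k - 1) else 0) +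
      ((if (#|e :&: A| == 1)%N && (e :\: A \subset Y) then K1 / #|Y|%:R ^+ (k - 1) else 0) +
       (if e \subset Y then
          if e \subset transv iota x then K / M%:R ^+ (k - 1) else K1 / M%:R ^+ (k - 1)
        else 0 : R))) (voutcome A Y)) ->
  has_spread (vweight A Y) (voutcome A Y).
Proof.
move=> AY iinj Y0 YM half H.
have Y0R : 0 < #|Y|%:R :> R by rewrite ltr0n.
have M0 : (0 < M)%N by have := leq_trans Y0 YM; rewrite muln_gt0 => /andP[].
have M0R : 0 < M%:R :> R by rewrite ltr0n.
have hM : 0 < (h ^ M)%:R :> R by rewrite ltr0n expn_gt0 h0.
have G0 : 0 < #|G|%:R :> R by move: half; lra.
set nu := K1 / #|Y|%:R ^+ (k - 1) in H.
have nu0 : 0 <= nu by rewrite divr_ge0 ?exprn_ge0 // ltW.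
set c : R := K / M%:R ^+ (k - 1) in H; set a : R := K1 / M%:R ^+ (k - 1) in H.
have c0' : 0 <= c by rewrite divr_ge0 ?exprn_ge0 // ltW.
have a0 : 0 <= a by rewrite divr_ge0 ?exprn_ge0 // ltW.
set q : R := K / #|Y|%:R ^+ (k - 1).
have q0 : 0 <= q by rewrite divr_ge0 ?exprn_ge0 // ltW.
have ac : 2 * (c / h%:R ^+ k + a) <= q.
  have YMR : #|Y|%:R <= 2 * h%:R * M%:R :> R by rewrite -!natrM ler_nat.
  have pw : #|Y|%:R ^+ (k - 1) <= (2 * h%:R) ^+ (k - 1) * M%:R ^+ (k - 1) :> R.
    by rewrite -exprMn lerXn2r ?nnegrE // !mulr_ge0.
  rewrite ler_pdivlMr ?exprn_gt0 //.
  have s0 : 0 <= 2 * (c / h%:R ^+ k + a) by rewrite mulr_ge0 // addr_ge0 // divr_ge0 ?exprn_ge0.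
  apply: le_trans (ler_wpM2l s0 pw) _.
  have -> : 2 * (c / h%:R ^+ k + a) * ((2 * h%:R) ^+ (k - 1) * M%:R ^+ (k - 1)) =
     2 * (2 * h%:R) ^+ (k - 1) * (K / h%:R ^+ k + K1).
    by rewrite /c /a; field; rewrite !lt0r_neq0 ?exprn_gt0.
  have -> : 2 * (2 * h%:R) ^+ (k - 1) * (K / h%:R ^+ k + K1) =
     2 ^+ k / h%:R * K + 2 * (2 * h%:R) ^+ (k - 1) * K1.
    rewrite -{2 3}(subnK k0) addn1 !exprS exprMn.
    by field; rewrite !lt0r_neq0 ?exprn_gt0.
  (* Half of [K] pays for an edge inside the core, the other half, by the choice of [K], for the
     term [K1]. This is the purpose of h >= 2^(k+1). *)
  have half1 : 2 ^+ k / h%:R <= 2^-1 :> R.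
    rewrite ler_pdivrMr // -ler_pdivrMl ?invr_gt0 // invrK -exprS -natrX ler_nat; exact: h2k.
  have h1 : 2 ^+ k / h%:R * K <= 2^-1 * K by rewrite ler_wpM2r // ltW.
  have h2 : 2 * (2 * h%:R) ^+ (k - 1) * K1 = 2^-1 * K by rewrite KE; field.
  rewrite h2; apply: le_trans (lerD h1 (lexx _)) _.
  by rewrite -mulrDl (_ : 2^-1 + 2^-1 = 1) ?mul1r //; field.
apply: (has_spread_mix _ (vweight_ge0 A Y) H).
  by rewrite -card_gt0 -(ltr0n R).
move=> S N [/andP[NE tN] cN _] SN.
have SE := subset_trans SN NE; have tS := trivIsetS SN tN.
have cS e : e \in S -> #|e| = k.
  by move=> eS; apply/eqP; move/forall_inP: uE; apply; apply: (subsetP SE).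
have eAY e : e \in S -> e \subset A :|: Y.
  by move=> eS; apply: subset_trans cN; apply: bigcup_sup; apply: (subsetP SN).
pose SY := [set e in S | e \subset Y].
have SYS : SY \subset S by apply/subsetP => e; rewrite inE => /andP[].
have -> : \prod_(e in S) vweight A Y e = nu ^+ #|S :\: SY| * q ^+ #|SY|.
  rewrite (bigID [in SY]) /= mulrC -!prodr_const; congr (_ * _).
    apply: eq_big => e; first by rewrite [RHS]inE andbC.
    move=> /andP[eS]; rewrite inE eS /= => /negbTE eY.
    by rewrite /vweight eY eAY.
  apply: eq_big => e; first by rewrite inE andbA andbb.
  by move=> /andP[eS]; rewrite inE eS /= => eY; rewrite /vweight eY.
apply: (@le_trans _ _ (nu ^+ #|S :\: SY| * \sum_(x in G) \prod_(e in SY) (c * (e \subset transv iota x)%:R + a))).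
  rewrite mulr_sumr; apply: ler_sum => x xG.
  (* The three weights never add up: an edge in [Y] avoids [A], and an edge inside [A] has k > 1
     vertices there. *)
  rewrite (bigID [in SY]) /= mulrC -prodr_const; apply: ler_pM.
  - apply: prodr_ge0 => e _; rewrite !addr_ge0 //; try by case: ifP.
    by case: ifP => // _; case: ifP.
  - apply: prodr_ge0 => e _; rewrite !addr_ge0 //; try by case: ifP.
    by case: ifP => // _; case: ifP.
  - rewrite [X in _ <= X](eq_bigl (fun e => (e \in S) && (e \notin SY))); last first.
      by move=> e; rewrite [LHS]inE andbC.
    apply: ler_prod => e /andP[eS]; rewrite inE eS /= => /negbTE ->.
    rewrite addr0 !addr_ge0 /=; try by case: ifP.
    case: ifP => [eA|_]; last by rewrite add0r; case: ifP.
    by rewrite (setIidPl eA) cS // (gtn_eqF (leq_ltn_trans d0 dk)) /= addr0.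
  - rewrite [X in X <= _](eq_bigl [in SY]); last first.
      by move=> e; rewrite inE andbA andbb.
    apply: ler_prod => e; rewrite inE => /andP[eS eY]; rewrite eY.
    have eA0 : e :&: A = set0.
      apply/setP => u; rewrite !inE; apply/negbTE/negP => /andP[ue uA].
      by have := subsetP eY _ ue; rewrite (disjointFr AY uA).
    have enA : (e \subset A) = false.
      apply/negbTE/negP => /setIidPl; rewrite eA0 => e0.
      by have := cS e eS; rewrite -e0 cards0 => k0'; move: k0; rewrite -k0'.
    rewrite enA eA0 cards0 /= !add0r.
    case: ifP => _ /=; first by rewrite c0' mulr1 lerDl.
    by rewrite a0 mulr0 add0r lexx.
rewrite [X in _ <= X]mulrCA; apply: ler_wpM2l; first exact: exprn_ge0.
(* The factor 2 from restricting to [G] can be absorbed only if some edge lies in [Y]; otherwise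
   there is nothing to lose. *)
have [S0|S0] := posnP #|SY|.
  rewrite S0 expr0 mulr1 -sum1_card natr_sum; apply: ler_sum => x _.
  by rewrite big_pred0 // => e; have /cards0_eq -> := S0; rewrite inE.
apply: (@le_trans _ _ (\sum_x \prod_(e in SY) (c * (e \subset transv iota x)%:R + a))).
  rewrite [X in _ <= X](bigID [in G]) /= lerDl sumr_ge0 // => x _.
  by apply: prodr_ge0 => e _; rewrite addr_ge0 // mulr_ge0.
have cSY e : e \in SY -> #|e| = k by move=> /(subsetP SYS); apply: cS.
apply: le_trans (transv_product iinj h0 (trivIsetS SYS tS) cSY a0 c0') _.
have t0 : 0 <= c / h%:R ^+ k + a by rewrite addr_ge0 // divr_ge0 ?exprn_ge0.
move: (c / h%:R ^+ k + a) t0 ac => t t0 ac.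
apply: (@le_trans _ _ (2 * #|G|%:R * t ^+ #|SY|)).
  by apply: ler_wpM2r => //; apply: exprn_ge0.
rewrite [2 * _]mulrC -mulrA; apply: ler_wpM2l => //.
apply: (@le_trans _ _ ((2 * t) ^+ #|SY|)).
  rewrite exprMn; apply: ler_wpM2r; first exact: exprn_ge0.
  by rewrite -(prednK S0) exprS ler_peMr ?exprn_ege1 ?ler1n.
by rewrite lerXn2r ?nnegrE // mulr_ge0.
Qed.

Lemma card_cover_matching M : is_matching E M -> #|cover M| = (k * #|M|)%N.
Proof.
move=> /andP[ME /eqP <-]; rewrite (eq_bigr (fun=> k)) ?sum_nat_const 1?mulnC // => e eM.
by apply/eqP; move/forall_inP: uE; apply; apply: (subsetP ME).
Qed.

(* Two rounds of covering use up [A] and few vertices of [Y \ X]; what is left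
   of [Y \ X] plays the role of [A] one level down, next to the core [X]. *)
Lemma vstate_down j A X Y M1 M2 : vstate j.+1 A Y -> X \subset Y ->
  (N0 * h ^ j <= #|X| < N0 * h ^ j.+1)%N -> (#|Y| <= 2 * h * #|X|)%N -> (h * #|X| <= #|Y|)%N ->
  good_core j Y X ->
  is_matching E M1 -> cover M1 \subset A ->
  #|A :\: cover M1|%:R <= 2 * h%:R * eps * #|Y|%:R :> R ->
  is_matching E M2 -> cover M2 \subset (A :\: cover M1) :|: (Y :\: X) ->
  A :\: cover M1 \subset cover M2 ->
  (#|cover M2 :&: (Y :\: X)| <= k * #|A :\: cover M1|)%N ->
  vstate j ((Y :\: X) :\: cover M2) X /\
  forall M3, voutcome ((Y :\: X) :\: cover M2) X M3 -> voutcome A Y (M1 :|: (M2 :|: M3)).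
Proof.
move=> [AY /andP[NY YN] cA res [_ dY _]] XY NX YX XhY gX m1 c1 l1 m2 c2 L2 l2.
set L := A :\: cover M1 in l1 c2 L2 l2; set B := Y :\: X in c2 l2 *.
set A' := B :\: cover M2; pose U := (A' :|: X); pose C := cover M1 :|: cover M2.
have Y0 : (0 < #|Y|)%N by apply: leq_trans NY; rewrite muln_gt0 N0pos expn_gt0 h0.
have Y0R : 0 < #|Y|%:R :> R by rewrite ltr0n.
have nAY u : u \in A -> u \in Y -> False by move=> uA; rewrite (disjointFr AY uA).
have dis12 : [disjoint cover M1 & cover M2].
  apply/pred0P => u /=; apply/negbTE/negP => /andP[u1 /(subsetP c2)].
  rewrite !inE u1 /= => /andP[_ uY]; exact: nAY _ (subsetP c1 _ u1) uY.
have m12 := is_matchingU m1 m2 dis12.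
have cC : #|C| = (k * #|M1 :|: M2|)%N by rewrite -card_cover_matching // coverU.
(* The next ground set is precisely what is uncovered so far; hence its size keeps the residue
   modulo [k] and the sizes of the matchings add up. *)
have UE : U = (A :|: Y) :\: C.
  apply/setP => u; rewrite !inE negb_or.
  have [uX|uX] := boolP (u \in X).
    have uY := subsetP XY _ uX; rewrite orbT uY orbT andbT; apply: esym; apply/andP; split.
      apply/negP => /(subsetP c1) uA; exact: nAY _ uA uY.
    apply/negP => /(subsetP c2); rewrite !inE uX /= orbF => /andP[_ uA]; exact: nAY _ uA uY.
  rewrite orbF /=; have [u2|u2] := boolP (u \in cover M2); first by rewrite !andbF.
  rewrite andbT; have [uY|uY] := boolP (u \in Y).
    rewrite orbT !andbT /=; apply: esym; apply/negP => u1; exact: nAY _ (subsetP c1 _ u1) uY.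
  rewrite orbF andbF /=; apply: esym; apply/negbTE/negP => /andP[u1 uA].
  by case/negP: u2; apply: (subsetP L2); rewrite inE u1.
have CAY : C \subset A :|: Y.
  rewrite subUset (subset_trans c1 (subsetUl _ _)) /=; apply: subset_trans c2 _.
  by apply: setUSS; apply: subsetDl.
have cU : #|A :|: Y| = (#|M1 :|: M2| * k + #|U|)%N.
  by rewrite mulnC -cC UE cardsD (setIidPr CAY) subnKC // subset_leq_card.
have UY : U \subset Y.
  rewrite subUset XY andbT; apply: subset_trans (subsetDl _ _) (subsetDl _ _).
have A'Y : A' \subset Y := subset_trans (subsetUl _ _) UY.
have lossW : r`!%:R * #|cover M2 :&: B|%:R <= delta / 4 * #|Y|%:R.
  apply: (@le_trans _ _ (r`!%:R * (k%:R * (2 * h%:R * eps * #|Y|%:R)))).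
    rewrite ler_pM2l //; apply: (@le_trans _ _ (k%:R * #|L|%:R)).
      by rewrite -natrM ler_nat.
    by rewrite ler_wpM2l.
  by rewrite [X in X <= _](_ : _ = r`!%:R * (k%:R * (2 * h%:R * eps)) * #|Y|%:R) ?ler_pM2r //; ring.
have lossX : r`!%:R * #|X|%:R <= delta / 4 * #|Y|%:R.
  have -> : r`!%:R * #|X|%:R = r`!%:R / h%:R * (h%:R * #|X|%:R) :> R.
    by field; rewrite lt0r_neq0.
  apply: ler_pM => //; [by rewrite divr_ge0 // ltW|by rewrite mulr_ge0|].
  by rewrite -natrM ler_nat.
have D0 : 0 < delta * #|Y|%:R by rewrite mulr_gt0.
have loss (W : {set V}) : W \subset X :|: (cover M2 :&: B) -> r`!%:R * #|W|%:R <= delta * #|Y|%:R.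
  move=> WS; have : #|W|%:R <= #|X|%:R + #|cover M2 :&: B|%:R :> R.
    rewrite -natrD ler_nat; apply: leq_trans (subset_leq_card WS) _.
    exact: leq_card_setU.
  move=> /(ler_wpM2l (ltW F0)); rewrite mulrDr => h1; apply: le_trans h1 _.
  apply: le_trans (lerD lossX lossW) _.
  rewrite [X in X <= _](_ : _ = delta * #|Y|%:R / 2); last by field.
  by rewrite ler_pdivrMr // ler_peMr ?ler1n // ltW.
have lossA' : r`!%:R * #|Y :\: A'|%:R <= delta * #|Y|%:R.
  apply: loss; apply/subsetP => u; rewrite !inE negb_and negbK => /andP[h1 uY].
  by move: h1; rewrite uY andbT negbK; case: (u \in X); rewrite /= ?andbT ?orbF.
have lossU : r`!%:R * #|Y :\: U|%:R <= delta * #|Y|%:R.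
  apply: loss; apply/subsetP => u; rewrite !inE negb_or negb_and negbK => /andP[/andP[h1 h2] uY].
  by move: h1; rewrite uY (negbTE h2) /= orbF andbT.
have degsub (Z S : {set V}) : Z \subset Y -> r`!%:R * #|Y :\: Z|%:R <= delta * #|Y|%:R ->
    S \subset Y -> #|S| = d -> (beta + delta) * #|Z|%:R ^+ r <= r`!%:R * (sdeg E S Z)%:R.
  move=> ZY lZ SY cS.
  apply: le_trans (sdeg_loss cS ZY Y0 (level_density_ge j.+1) lZ (dY _ _ cS)).
    rewrite ler_wpM2l ?addr_ge0 //; first exact: ltW.
    by rewrite lerXn2r ?nnegrE // ler_nat subset_leq_card.
  exact: subset_trans SY (subsetUr _ _).
split.
- split=> //.
  + apply/pred0P => u /=; rewrite !inE; apply/negbTE/negP.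
    by case/andP => /andP[_ /andP[/negbTE ->]].
  + by apply: leq_trans (subset_leq_card A'Y) YX.
  + by rewrite -res cU modnMDl.
  + split=> [S SA'|S SU cS|S SU].
    * by apply: degsub => //; apply: subset_trans SA' A'Y.
    * move/forallP/(_ S)/implyP: gX; apply.
      by rewrite cS eqxx andbT; apply: subset_trans SU UY.
    * by apply: degsub => //; apply: subset_trans SU UY.
- move=> M3 [m3 c3 n3].
  have dis : [disjoint C & cover M3].
    apply/pred0P => u /=; apply/negbTE/negP => /andP[uC /(subsetP c3)].
    by rewrite -/U UE inE uC.
  have m : is_matching E (M1 :|: (M2 :|: M3)).
    by rewrite setUA; apply: is_matchingU => //; rewrite coverU.
  split=> //.
    rewrite setUA !coverU subUset CAY /=; apply: subset_trans c3 _.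
    by rewrite -/U UE subsetDl.
  apply/eqP; rewrite -(eqn_pmul2l k0) -card_cover_matching // setUA !coverU -/C.
  rewrite cardsU (_ : C :&: cover M3 = set0) ?cards0 ?subn0; last first.
    by apply/eqP; rewrite setI_eq0.
  by rewrite cC card_cover_matching // n3 -/U cU divnMDl // mulnDr eqxx.
Qed.

(** The core is drawn before [M1] and [M2], so its degree properties hold whatever these are, and
    the greedy step can avoid it. *)
Lemma vortex_step j : (forall A Y, vstate j A Y -> has_spread (vweight A Y) (voutcome A Y)) ->
  forall A Y, vstate j.+1 A Y -> has_spread (vweight A Y) (voutcome A Y).
Proof.
move=> IH A Y st; have [AY /andP[NY YN] cA res [dA dY _]] := st.
have [M ME] : exists M : nat, M = (#|Y| %/ h)%N by exists (#|Y| %/ h)%N.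
have Mh : (M * h <= #|Y|)%N by rewrite ME leq_divM.
have YMh : (#|Y| <= M * h + h)%N by rewrite -mulSnr ME ltnW // ltn_ceil.
have NM : (N0 * h ^ j <= M)%N by rewrite ME leq_divRL // -mulnA -expnSr.
have MN : (M < N0 * h ^ j.+1)%N by rewrite ME ltn_divLR // -mulnA -expnSr.
have M0 : (0 < M)%N by apply: leq_trans NM; rewrite muln_gt0 N0pos expn_gt0 h0.
have YM : (#|Y| <= 2 * h * M)%N by apply: leq_trans YMh _; clear -M0; nia.
have Y0 : (0 < #|Y|)%N by apply: leq_trans Mh; rewrite muln_gt0 M0.
have N0Y : (N0 <= #|Y|)%N.
  by apply: leq_trans NY; rewrite leq_pmulr // expn_gt0 h0.
have [iota iinj iY] : exists2 f : 'I_M * 'I_h -> V, injective f & codom f \subset Y.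
  by apply: inj_into_set; rewrite card_prod !card_ord.
have half := good_core_half iinj iY YMh NM (fun S SY => dY S (subset_trans SY (subsetUr _ _))).
apply: (vortex_mix AY iinj Y0 YM half) => x; rewrite inE => gx.
set X := transv iota x in gx *.
have cX : #|X| = M by apply: card_transv.
have XY : X \subset Y by apply: subset_trans iY; apply: transv_sub.
have nuY (Z : nat) (c : R) : 0 <= c -> 0 <= c / Z%:R ^+ (k - 1) :> R.
  by move=> c0'; rewrite divr_ge0 ?exprn_ge0.
have K0' := ltW K0; have K10' := ltW K10.
apply: (has_spread_bind _ _ (cover_A N0Y cA dA)).
- by move=> e; case: ifP => // _; apply: nuY.
- move=> e; apply: addr_ge0; first by case: ifP => // _; apply: nuY.
  by case: ifP => // _; case: ifP => _; apply: nuY.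
move=> M1 [m1 c1 l1].
have cB : h%:R * #|Y :\: (Y :\: X)|%:R <= #|Y|%:R :> R.
  by rewrite setDDr setDv set0U (setIidPr XY) cX -natrM ler_nat mulnC.
have := cover_leftover AY (subsetDl Y X) (subsetDl A (cover M1)) N0Y (level_density_ge j.+1) dY l1 cB.
set w2 := (X in has_spread X _) => gr.
(* The weight must not depend on [M1]. Greedy edges meet [A] in one leftover vertex only, so the
   condition can be restated with [A] and [Y]. *)
have gr' := has_spread_weaken (w' := fun e =>
   if (#|e :&: A| == 1)%N && (e :\: A \subset Y) then K1 / #|Y|%:R ^+ (k - 1) else 0) _ (fun M h => h) gr.
apply: (has_spread_bind _ _ (gr' _)).
- by move=> e; case: ifP => // _; apply: nuY.
- by move=> e; case: ifP => // _; case: ifP => _; apply: nuY.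
- move=> e; rewrite /w2; case: ifP => [/andP[c2 s2]|_]; last first.
    by rewrite lexx /=; case: ifP => // _; apply: nuY.
  have eA : e :&: A = e :&: (A :\: cover M1).
    apply/setP => u; rewrite !inE; have [ue|//] := boolP (u \in e).
    have [uA|] := boolP (u \in A); last by rewrite /= andbF.
    have [u1|//] := boolP (u \in cover M1).
    have : u \in Y :\: X by apply: (subsetP s2); rewrite !inE u1 ue.
    by rewrite inE (disjointFr AY uA) andbF.
  rewrite eA c2 /= (_ : e :\: A \subset Y) ?lexx ?andbT; first exact: nuY.
  apply: (@subset_trans _ _ (pred_of_set (Y :\: X))); last exact: subsetDl.
  apply: subset_trans s2; apply/subsetP => u; rewrite !inE => /andP[/negbTE -> ->].
  by rewrite andbF.
move=> M2 [m2 c2 L2 l2].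
have hX : (N0 * h ^ j <= #|X| < N0 * h ^ j.+1)%N by rewrite cX NM MN.
have YX : (#|Y| <= 2 * h * #|X|)%N by rewrite cX.
have XhY : (h * #|X| <= #|Y|)%N by rewrite cX mulnC.
have [st' out] := vstate_down st XY hX YX XhY gx m1 c1 l1 m2 c2 L2 l2.
apply: has_spread_weaken (IH _ _ st') => [e|M3]; last exact: out.
rewrite vweight_ge0 /vweight cX /=.
have XU : Y :\: X :\: cover M2 :|: X \subset Y.
  by rewrite subUset XY andbT; apply: subset_trans (subsetDl _ _) (subsetDl _ _).
case: ifP => [eX|_]; first by rewrite (subset_trans eX XY).
case: ifP => [eU|_]; first by rewrite (subset_trans eU XU).
by case: ifP => // _; apply: nuY.
Qed.

Lemma vortex j A Y : vstate j A Y -> has_spread (vweight A Y) (voutcome A Y).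
Proof.
elim: j A Y => [|j IH] A Y; first exact: vortex_base.
exact: vortex_step.
Qed.

End Vortex.

(** Sets not inside [E] have probability 0. Weight 0 off [E] matches a random subset that never
    selects a non-edge. *)
Lemma has_spread_support (R : realType) (U : finType) (w : U -> R) (P : {set U} -> Prop) (E : {set U}) :
  (forall e, 0 <= w e) -> (forall M, P M -> M \subset E) -> has_spread w P ->
  has_spread (fun e => if e \in E then w e else 0) P.
Proof.
move=> w0 PE [mu [dm sp mP]]; exists mu; split=> // S.
have [SE|/subsetPn[e eS eE]] := boolP (S \subset E).
  by apply: le_trans (sp S) _; apply: ler_prod => e eS; rewrite (subsetP SE) // w0 /=.
rewrite big1; last first.
  move=> M SM; apply/eqP/negPn/negP => /mP/PE ME.
  by case/negP: eE; apply: (subsetP ME); apply: (subsetP SM).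
by apply: prodr_ge0 => e' _; case: ifP.
Qed.

(** The vortex starts with [A] empty and [Y] the whole vertex set; the condition on d-sets in [A] is
    then void since d > 0. *)
Lemma spread_optimal_matching (R : realType) (k d s : nat) (beta delta : R) (y0 : nat) :
  (0 < d)%N -> (d < k)%N -> 0 <= beta -> 0 < delta -> delta <= 1 ->
  matchable_above k d s beta y0 ->
  exists K : R, exists n0 : nat, 0 <= K /\
    forall (V : finType) (E : {set {set V}}), uniform k E -> (n0 <= #|V|)%N ->
    (#|V| = s %[mod k])%N ->
    (forall S : {set V}, #|S| = d ->
       (beta + 3 * delta) * #|V|%:R ^+ (k - d) <= (k - d)`!%:R * (sdeg E S [set: V])%:R) ->
    has_spread (fun=> K / #|V|%:R ^+ (k - 1) : R)
      (fun M => is_matching E M /\ #|M| = (#|V| %/ k)%N).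
Proof.
move=> d0 dk beta0 delta0 delta1 hm; set r := (k - d)%N.
have k0 : (0 < k)%N by apply: leq_ltn_trans dk.
have k0R : 0 < k%:R :> R by rewrite ltr0n.
have F0 : 0 < r`!%:R :> R by rewrite ltr0n fact_gt0.
(* Constants in order of dependence: [h], then [eps], then [Kc] and [N1], then [N0], finally [K1]
   and [K]. *)
have [nh hnh] := nat_above (r`!%:R / (delta / 4)).
have [h [h16 h2k hnh']] : exists h, [/\ (16 <= h)%N, (2 ^ k.+1 <= h)%N & (nh <= h)%N].
  by exists (16 + 2 ^ k.+1 + nh)%N; split; [rewrite -addnA leq_addr|rewrite addnAC leq_addl|rewrite leq_addl].
have h0 : (0 < h)%N by apply: leq_trans h16.
have h0R : 0 < h%:R :> R by rewrite ltr0n.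
have hh : r`!%:R / h%:R <= delta / 4.
  by apply: (ler_div_of_nat _ h0 hnh hnh'); rewrite divr_gt0.
pose eps : R := delta / (8 * r`!%:R * k%:R * h%:R).
have eps0 : 0 < eps by rewrite divr_gt0 // !mulr_gt0.
have heps : r`!%:R * (k%:R * (2 * h%:R * eps)) <= delta / 4.
  by rewrite le_eqVlt; apply/orP; left; apply/eqP; rewrite /eps; field; rewrite !lt0r_neq0.
clearbody eps; have d01 : 0 < delta <= 1 by rewrite delta0.
have [Kc [N1 [Kc0 near]]] := near_perfect_matching dk d01 eps0 hm.
have [n1 hn1] := nat_above (8 * r`!%:R / delta).
have [n2 hn2] := nat_above (N1%:R / (2 * h%:R * eps)).
have [n3 hn3] := nat_above (2 * ((2 * h%:R) ^+ d * (2 * d.+1)`!%:R *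
  (256 * r`!%:R ^+ 4 * 64 / delta ^+ 4) ^+ d.+1)).
have [N0 [N0y0 N0d N0pos [N0n1 N0n2 N0n3]]] : exists N0, [/\ (y0 <= N0)%N, (4 * d <= N0)%N, (0 < N0)%N &
    [/\ (n1 <= N0)%N, (n2 <= N0)%N & (n3 <= N0)%N]].
  exists (y0 + 4 * d + n1 + n2 + n3 + 1)%N; clear; split; [lia|lia|lia|split; lia].
pose c0 : R := delta / (2 ^+ k * r`!%:R * 4 ^+ d.-1 * (d.-1)`!%:R).
have c00 : 0 < c0 by rewrite divr_gt0 // !mulr_gt0 ?exprn_gt0 // ltr0n fact_gt0.
have he0 : 0 < 2 * h%:R * eps by rewrite mulr_gt0 // mulr_gt0.
pose K1 : R := Kc / (2 * h%:R * eps) ^+ (k - 1) + c0^-1 + (h * N0)%:R ^+ (k - 1).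
have t1 : 0 <= Kc / (2 * h%:R * eps) ^+ (k - 1) by rewrite divr_ge0 ?exprn_ge0 // ltW.
have t2 : 0 <= c0^-1 by rewrite invr_ge0 ltW.
have t3 : 0 <= (h * N0)%:R ^+ (k - 1) :> R by rewrite exprn_ge0.
have K1c : Kc / (2 * h%:R * eps) ^+ (k - 1) <= K1 by rewrite /K1 -addrA lerDl addr_ge0.
have K1g : c0^-1 <= K1 by rewrite /K1 addrAC lerDr addr_ge0.
have K1b : (h * N0)%:R ^+ (k - 1) <= K1 by rewrite /K1 lerDr addr_ge0.
pose K : R := 4 * (2 * h%:R) ^+ (k - 1) * K1.
have K0 : 0 <= K.
  by apply: mulr_ge0; [rewrite mulr_ge0 // exprn_ge0 // mulr_ge0|rewrite !addr_ge0].
exists K, N0; split=> // V E uE NV res deg.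
have NV0 : (0 < #|V| %/ N0)%N by rewrite divn_gt0.
have /andP[j1 j2] := trunc_log_bounds (leq_trans (isT : (1 < 16)%N) h16) NV0.
set j := trunc_log _ _ in j1 j2.
rewrite leq_divRL // in j1; rewrite ltn_divLR // in j2.
have N0delta : 8 * r`!%:R / delta <= N0%:R by apply: le_trans hn1 _; rewrite ler_nat.
have N0N1 : N1%:R <= 2 * h%:R * eps * N0%:R.
  by rewrite mulrC -ler_pdivrMr //; apply: le_trans hn2 _; rewrite ler_nat.
have N0tail : 2 * ((2 * h%:R) ^+ d * (2 * d.+1)`!%:R *
  (256 * r`!%:R ^+ 4 * 64 / delta ^+ 4) ^+ d.+1) <= N0%:R :> R.
  by apply: le_trans hn3 _; rewrite ler_nat.
have KE : K = 4 * (2 * h%:R) ^+ (k - 1) * K1 by [].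
have V0 : (0 < #|V|)%N by apply: leq_trans NV.
have cT : #|set0 :|: [set: V]| = #|V| by rewrite set0U cardsT.
have st : vstate E k d s beta delta h N0 j set0 [set: V].
  split.
  - by rewrite disjoints_subset sub0set.
  - by rewrite cardsT [(N0 * _)%N]mulnC j1 [(N0 * _)%N]mulnC j2.
  - by rewrite cards0.
  - by rewrite cT.
  - split=> [S|S _ cS|S _ cS].
    + by rewrite subset0 => /eqP -> /esym; rewrite cards0 => d00; rewrite d00 in d0.
    + apply: le_trans (_ : _ <= (beta + 3 * delta) * #|[set: V]|%:R ^+ (k - d)) _.
        apply: ler_wpM2r; first exact: exprn_ge0.
        by rewrite /level_density gerBl divr_ge0 ?exprn_ge0 // ltW.
      by rewrite cardsT; apply: deg.
    + rewrite cT set0U; apply: le_trans (deg S cS); apply: ler_wpM2r; first exact: exprn_ge0.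
      lra.
have vx := vortex uE d0 dk beta0 delta0 delta1 h16 h2k hh eps0 heps (fun A NA dA => near V E A uE NA dA)
  hm N0y0 N0d N0pos N0delta N0N1 N0tail Kc0 K1c K1g K1b KE st.
apply: has_spread_weaken vx => [e|M [m _ c]]; last by rewrite -cT.
by rewrite /vweight subsetT cardsT lexx andbT divr_ge0 // exprn_ge0.
Qed.

(** * Thresholds and the random subhypergraph *)

Lemma min_degree_le_degree (V : finType) (d : nat) (E : {set {set V}}) (S : {set V}) :
  #|S| = d -> (min_degree d E <= degree E S)%N.
Proof.
move=> /eqP cS; rewrite /min_degree; have := mem_index_enum S.
elim: (index_enum _) => [//|T s IH]; rewrite inE big_cons.
by case/orP => [/eqP <-|/IH le]; [rewrite cS geq_minl|case: ifP => // _; rewrite geq_min le orbT].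
Qed.

Lemma leq_min_degree (V : finType) (d D : nat) (E : {set {set V}}) : (d <= #|V|)%N ->
  (forall S : {set V}, #|S| = d -> (D <= degree E S)%N) -> (D <= min_degree d E)%N.
Proof.
move=> dV H; apply: (big_ind (fun x => D <= x)%N) => [|x y hx hy|S /eqP cS]; last exact: H.
  (* The initial value of the minimum is harmless: some d-set exists, and its degree is at most
     |E|. *)
  have [S cS] : exists S : {set V}, #|S| == d.
    have : (0 < #|[set S : {set V} | S \subset [set: V] & #|S| == d]|)%N.
      by rewrite cards_draws bin_gt0 cardsT.
    by rewrite card_gt0 => /set0Pn[S]; rewrite inE => /andP[_ cS]; exists S.
  apply: leq_trans (H S (eqP cS)) _; apply: subset_leq_card.
  by apply/subsetP => e; rewrite inE => /andP[].
by rewrite leq_min hx.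
Qed.

Lemma sdeg_setT (V : finType) (E : {set {set V}}) (S : {set V}) :
  sdeg E S [set: V] = degree E S.
Proof. by apply: eq_card => e; rewrite !inE subsetT andbT. Qed.

Lemma degree_le_bin (V : finType) (k : nat) (E : {set {set V}}) (S : {set V}) :
  uniform k E -> (degree E S <= 'C(#|V| - #|S|, k - #|S|))%N.
Proof.
move=> /forall_inP uE; have -> : (#|V| - #|S| = #|~: S|)%N by rewrite -(cardsC S) addKn.
rewrite -cards_draws /degree -[X in (X <= _)%N](card_in_imset (f := fun e => e :\: S)); last first.
  by move=> e e'; rewrite !inE => /andP[_ h] /andP[_ h']; apply: setDl_inj.
apply: subset_leq_card; apply/subsetP => T /imsetP[e]; rewrite !inE => /andP[eE Se] ->.
apply/andP; split; first by rewrite setDE subsetIr.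
by rewrite (card_link (k := k)) //; apply/eqP/uE.
Qed.

(** Beyond the largest possible degree the condition is vacuous. This bounds the sequence whose
    limsup is taken. *)
Lemma m_threshold_le_bin (d k n : nat) : (d <= n)%N ->
  (m_threshold d k n <= 'C(n - d, k - d).+1)%N.
Proof.
move=> dn; rewrite /m_threshold; case: ex_minnP => m _; apply.
apply/forallP => E; apply/implyP => /andP[uE].
have [S] : exists S : {set 'I_n}, S \in [set S : {set 'I_n} | S \subset [set: 'I_n] & #|S| == d].
  by apply/set0Pn; rewrite -card_gt0 cards_draws bin_gt0 cardsT card_ord.
rewrite inE => /andP[_ /eqP cS].
move=> /leq_trans /(_ (min_degree_le_degree E cS)) /leq_trans /(_ (degree_le_bin S uE)).
by rewrite cS card_ord ltnn.
Qed.

(** A bijection from an ordinal onto [Y] pulls back the edges inside [Y]; for [S] in [Y], the edges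
    counted by [sdeg] are among these. *)
Lemma optimal_matching_above_threshold (V : finType) (d k : nat) (E : {set {set V}}) (Y : {set V}) :
  uniform k E -> (d <= #|Y|)%N ->
  (forall S : {set V}, S \subset Y -> #|S| = d -> (m_threshold d k #|Y| <= sdeg E S Y)%N) ->
  exists M, [/\ is_matching E M, cover M \subset Y & #|M| = (#|Y| %/ k)%N].
Proof.
move=> uE dY deg.
have [f finj fY] : exists2 f : 'I_(#|Y|) -> V, injective f & codom f \subset Y.
  by apply: inj_into_set; rewrite card_ord.
have fT : f @: [set: 'I_(#|Y|)] = Y.
  apply/eqP; rewrite eqEcard card_imset // cardsT card_ord leqnn andbT.
  by apply/subsetP => v /imsetP[i _ ->]; apply: (subsetP fY); apply: codom_f.
pose E' := [set a : {set 'I_(#|Y|)} | f @: a \in E].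
have uE' : uniform k E'.
  apply/forall_inP => a; rewrite inE => aE; rewrite -(card_imset _ finj).
  by move/forall_inP: uE; apply.
have preK (e : {set V}) : e \subset Y -> f @: (f @^-1: e) = e.
  move=> eY; apply/setP => v; apply/imsetP/idP => [[i]|ve]; first by rewrite inE => ? ->.
  have := subsetP eY _ ve; rewrite -{1}fT => /imsetP[i _ vi].
  by exists i => //; rewrite inE -vi.
have deg' : (m_threshold d k #|Y| <= min_degree d E')%N.
  apply: leq_min_degree; first by rewrite card_ord.
  move=> S cS; pose S1 := f @: S.
  have S1Y : S1 \subset Y by rewrite -fT; apply: imsetS; apply: subsetT.
  have cS1 : #|S1| = d by rewrite card_imset.
  apply: leq_trans (deg S1 S1Y cS1) _; rewrite /sdeg /degree.
  have sub (e : {set V}) : (S1 \subset e) && (e :\: S1 \subset Y) -> e \subset Y.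
    move=> /andP[S1e h]; rewrite -(setID e S1) (setIidPr S1e) subUset S1Y; exact: h.
  rewrite -(card_in_imset (f := fun e : {set V} => f @^-1: e)
    (D := [set e in E | (S1 \subset e) && (e :\: S1 \subset Y)])); last first.
    move=> e e'; rewrite !inE => /andP[_ /sub h] /andP[_ /sub h'] eq.
    by rewrite -(preK e h) -(preK e' h') eq.
  apply: subset_leq_card; apply/subsetP => a /imsetP[e]; rewrite !inE => /andP[eE he] ->.
  rewrite preK ?(sub e he) // eE /=; apply/subsetP => i iS; rewrite inE.
  have /andP[S1e _] := he; apply: (subsetP S1e); exact: imset_f.
have : forces_optimal_matching d k #|Y| (m_threshold d k #|Y|).
  by rewrite /m_threshold; case: ex_minnP.
move=> /forallP/(_ E')/implyP; rewrite uE' deg' => /(_ isT)/existsP[M' /andP[/andP[ME' tM'] /eqP cM']].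
have fi : injective (fun a : {set 'I_(#|Y|)} => f @: a) := imset_inj finj.
exists [set f @: (a : {set 'I_(#|Y|)}) | a in M']; split.
- apply/andP; split.
    by apply/subsetP => e /imsetP[a /(subsetP ME')]; rewrite inE => aE ->.
  apply/trivIsetP => e e' /imsetP[a aM ->] /imsetP[a' aM' ->] ne.
  have ane : a != a' by apply: contra ne => /eqP ->.
  have := trivIsetP tM' _ _ aM aM' ane => dis.
  rewrite disjoints_subset; apply/subsetP => v /imsetP[i ia ->]; rewrite inE.
  by rewrite mem_imset // (disjointFr dis ia).
- apply/bigcupsP => e /imsetP[a _ ->].
  by apply: subset_trans (imsetS f (subsetT a)) _; rewrite fT.
- by rewrite card_imset // cM' card_ord.
Qed.

Lemma subhypergraph_probE (R : realType) (V : finType) (E : {set {set V}}) (p : R) (A : pred {set {set V}}) :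
  subhypergraph_prob E p A = \sum_(F | A F) bern (fun e => if e \in E then p else 0) F.
Proof.
rewrite /subhypergraph_prob [RHS](bigID (fun F : {set {set V}} => F \subset E)) /=.
rewrite [X in _ = _ + X]big1 ?addr0; last first.
  move=> F /andP[_ /subsetPn[e eF eE]]; rewrite /bern (bigD1 e) //= eF (negbTE eE).
  by rewrite mul0r.
apply: eq_big => F; first by rewrite andbC.
move=> /andP[FE _]; rewrite /bern [RHS](bigID [in E]) /= [X in _ = _ * X]big1 ?mulr1; last first.
  move=> e eE; rewrite (negbTE eE) subr0; case: ifP => // /(subsetP FE).
  by rewrite (negbTE eE).
by apply: eq_bigr => e ->.
Qed.

Lemma optimal_matching_prob (R : realType) (V : finType) (E : {set {set V}}) (k : nat)
    (K p : R) (N : nat) :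
  0 <= K -> 4 * K < 1 -> (4 * N)%:R * K <= p -> p <= 1 -> (0 < k)%N ->
  has_spread (fun=> K) (fun M : {set {set V}} => is_matching E M /\ #|M| = (#|V| %/ k)%N) ->
  1 - #|V|%:R / 2 ^+ N <= subhypergraph_prob E p (has_optimal_matching k).
Proof.
move=> K0 K1 Kp p1 k0 sp.
have := has_spread_support (E := E) (fun=> K0) (fun M (h : _ /\ _) => proj1 (andP (proj1 h))) sp.
move=> [mu [dm spm mP]].
have p0 : 0 <= p by apply: le_trans Kp; rewrite mulr_ge0.
pose y e := if e \in E then p else 0.
have y01 e : 0 <= y e <= 1 by rewrite /y; case: ifP => _; rewrite ?p0 ?p1 ?lexx ?ler01.
have := @spread_threshold R _ N _ y mu #|V|%:R _ _ _ dm spm _ => H.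
rewrite subhypergraph_probE -/y lerBlDr -[X in X <= _](bern_sum1 y).
rewrite (bigID (has_optimal_matching k)) /= lerD2l.
apply: le_trans (H _ _ _ _) => {H}.
- rewrite [X in _ <= X]big_mkcond [X in X <= _]big_mkcond /=; apply: ler_sum => F _.
  case: ifP => [nF|_]; last by case: ifP => _ //; apply: bern_ge0.
  rewrite ifT //; apply/forallP => M; apply/implyP => /mP[/andP[ME tM] cM].
  apply: contra nF => MF; apply/existsP; exists M.
  by rewrite /is_matching MF tM cM eqxx.
- by move=> e; case: ifP.
- by move=> e; case: ifP => _ //; rewrite mulr0.
- by move=> e; rewrite /y; case: ifP => _; rewrite ?Kp ?p1 ?mulr0 ?lexx ?ler01.
- by move=> M /mP[_ ->]; rewrite ler_nat leq_div.
Qed.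

From mathcomp Require Import all_classical all_reals all_analysis.
Import Order.TTheory GRing.Theory Num.Theory numFieldNormedType.Exports.
Local Open Scope ring_scope.

(** * From the limsup to densities, and the final choice of constants *)

Lemma ffact_ge_pow n d k r : (d + r <= k)%N -> ((n - k) ^ r <= (n - d) ^_ r)%N.
Proof.
elim: r d => [|r IH] d dr; first by rewrite ffactn0.
rewrite ffactnS expnS leq_mul //; first by apply: leq_sub2l; lia.
have -> : ((n - d).-1 = n - d.+1)%N by lia.
by apply: IH; lia.
Qed.

Lemma pow_sub_ge (R : realType) (n k r : nat) : (k <= n)%N ->
  (n%:R - r%:R * k%:R) * n%:R ^+ r <= (n - k)%:R ^+ r * n%:R :> R.
Proof.
move=> kn; elim: r => [|r IH]; first by rewrite !expr0 mul0r subr0 mulr1 mul1r.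
rewrite [X in _ <= X * _]exprS -mulrA; apply: le_trans (ler_wpM2l _ IH); last by [].
rewrite natrB // -natr1 exprS.
have h : 0 <= r%:R * k%:R * k%:R * n%:R ^+ r :> R by rewrite !mulr_ge0 ?exprn_ge0.
rewrite -subr_ge0; apply: le_trans h _; rewrite le_eqVlt; apply/orP; left; apply/eqP; ring.
Qed.

(** For a bounded sequence the limsup is the infimum of the tail suprema, so some tail stays below
    it plus [gamma]. Boundedness, here by 2, has to be shown first. *)
Lemma matchable_above_mu_sup (R : realType) (k d s : nat) (gamma : R) :
  (d < k)%N -> (s < k)%N -> 0 < gamma ->
  0 <= mu_sup R d k s + gamma /\
  exists y0, matchable_above k d s (mu_sup R d k s + gamma) y0.
Proof.
move=> dk sk g0; have k0 : (0 < k)%N by apply: leq_ltn_trans dk.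
pose u : nat -> R := fun j => (m_threshold d k (j * k + s))%:R / 'C(j * k + s - d, k - d)%:R.
have u0 j : 0 <= u j by rewrite divr_ge0.
have u2 j : u j <= 2.
  rewrite /u; set n := (j * k + s)%N.
  have [->|C0] := posnP 'C(n - d, k - d); first by rewrite invr0 mulr0.
  have dn : (d <= n)%N by move: C0; rewrite bin_gt0; lia.
  rewrite ler_pdivrMr ?ltr0n // -natrM ler_nat.
  by apply: leq_trans (m_threshold_le_bin k dn) _; lia.
have ub : has_ubound (range u) by exists 2 => _ [j _ <-].
have lb : has_lbound (range u) by exists 0 => _ [j _ <-].
have muE : mu_sup R d k s = inf (range (sups u)).
  rewrite /mu_sup -/u /limn_sup; apply/cvg_lim => //; exact: cvg_sups_inf.
have sups_ge n j : (n <= j)%N -> u j <= sups u n.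
  by move=> nj; apply: ub_le_sup; [apply/has_ubound_sdrop|exists j].
have hinf : has_inf (range (sups u)).
  split; first by exists (sups u 0%N); exists 0%N.
  by exists 0 => _ [n _ <-]; apply: le_trans (sups_ge n n (leqnn n)).
have [_ [n _ <-] hn] := inf_adherent g0 hinf.
rewrite -muE in hn; set beta := mu_sup R d k s + gamma in hn *.
have beta0 : 0 <= beta by apply/ltW; apply: le_lt_trans hn; apply: le_trans (sups_ge n n (leqnn n)).
(* [n] fixes the tail; one more multiple of [k] ensures k <= |Y| also for n = 0. *)
split=> //; exists (n.+1 * k)%N => V E Y uE yY res deg.
have kY : (k <= #|Y|)%N by apply: leq_trans yY; rewrite leq_pmull.
apply: (@optimal_matching_above_threshold V d k E Y uE); first by apply: leq_trans kY; apply: ltnW.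
move=> S SY cS; have YE : #|Y| = (#|Y| %/ k * k + s)%N.
  by rewrite {1}(divn_eq #|Y| k) res modn_small.
have := sups_ge n (#|Y| %/ k)%N _; rewrite leq_divRL // => /(_ _).
have nY : (n * k <= #|Y|)%N by apply: leq_trans yY; rewrite leq_mul2r leqnSn orbT.
rewrite nY /u -YE => /(_ isT) h.
have C0 : 0 < 'C(#|Y| - d, k - d)%:R :> R by rewrite ltr0n bin_gt0 leq_sub2r.
have F0 : 0 < (k - d)`!%:R :> R by rewrite ltr0n fact_gt0.
have {h} := le_trans h (ltW hn); rewrite ler_pdivrMr // => h.
rewrite -(ler_nat R); apply: le_trans h _; rewrite -(ler_pM2l F0).
(* The falling factorial is at most the power, so the bound normalised by powers is the stronger
   one. *)
apply: le_trans (deg S SY cS); rewrite mulrCA; apply: ler_wpM2l => //.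
rewrite -natrM -natrX ler_nat mulnC bin_ffact; apply: leq_trans (ffact_le_pow _ _) _.
by rewrite leq_expn_base // leq_subr.
Qed.

Lemma up_log_le_ln (R : realType) (n : nat) : (1 < n)%N ->
  (up_log 2 n)%:R <= 2 / ln 2 * ln n%:R :> R.
Proof.
move=> n1; have l2 : 0 < ln 2 :> R by rewrite ln_gt0 // ltr1n.
have nR : 0 < n%:R :> R by rewrite ltr0n ltnW.
rewrite mulrAC ler_pdivlMr //.
have u0 : (0 < up_log 2 n)%N by rewrite up_log_gt0.
have h1 : (up_log 2 n).-1%:R * ln 2 <= ln n%:R :> R.
  rewrite mulr_natl -lnXn // ler_ln ?posrE ?exprn_gt0 // -natrX ler_nat ltnW //.
  exact: up_log_gtn.
have h2 : ln 2 <= ln n%:R :> R by rewrite ler_ln ?posrE // ler_nat.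
by rewrite -(prednK u0) -natr1 mulrDl mul1r [2 * _]mulr_natl mulr2n lerD.
Qed.

(** The binomial is at least (n - k)^r / r!, and (n - k)^r is at least (1 - r k / n) n^r; for large
    n the gap between [a] and [b] pays for this. *)
Lemma codegree_density (R : realType) (V : finType) (E : {set {set V}}) (k d : nat) (a b : R) :
  (d < k)%N -> 0 <= a -> b < a -> (k <= #|V|)%N ->
  a * ((k - d)%:R * k%:R) / (a - b) <= #|V|%:R ->
  a * 'C(#|V| - d, k - d)%:R <= (min_degree d E)%:R ->
  forall S : {set V}, #|S| = d ->
    b * #|V|%:R ^+ (k - d) <= (k - d)`!%:R * (sdeg E S [set: V]%SET)%:R.
Proof.
move=> dk a0 ba kV large hmin S cS; set r := (k - d)%N in large hmin *; set n := #|V| in large kV hmin *.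
have F0 : 0 < r`!%:R :> R by rewrite ltr0n fact_gt0.
have n0 : 0 < n%:R :> R by rewrite ltr0n; apply: leq_trans kV; apply: leq_ltn_trans dk.
have h1 : r`!%:R * (min_degree d E)%:R <= r`!%:R * (sdeg E S [set: V]%SET)%:R :> R.
  by rewrite ler_pM2l // ler_nat sdeg_setT min_degree_le_degree.
apply: le_trans h1; apply: le_trans (ler_wpM2l (ltW F0) hmin).
rewrite mulrCA -natrM mulnC bin_ffact.
apply: (@le_trans _ _ (a * (n - k)%:R ^+ r)); last first.
  apply: ler_wpM2l => //; rewrite -natrX ler_nat; apply: ffact_ge_pow.
  by rewrite subnKC // ltnW.
rewrite -(ler_pM2r n0) -[X in _ <= X]mulrA; apply: le_trans (ler_wpM2l a0 (pow_sub_ge R r kV)).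
rewrite -/n -/r mulrAC [X in _ <= X]mulrA; apply: ler_wpM2r; first exact: exprn_ge0.
by move: large; rewrite ler_pdivrMr ?subr_gt0 // => large; lra.
Qed.

(** The asymptotic statement in uniform form: [n0] depends on [eps] and the fixed parameters, not on
    [p] or the hypergraph. *)
Theorem theorem1p1 (R : realType) (d k s : nat)
    (hk : (3 <= k)%N) (hd1 : (1 <= d)%N) (hdk : (d <= k - 1)%N)
    (hs : (s <= k - 1)%N) (gamma : R) (hgamma : 0 < gamma) :
  exists2 C : R, 0 < C &
    forall eps : R, 0 < eps ->
    exists n0 : nat, forall n : nat, (n0 <= n)%N -> (n = s %[mod k])%N ->
    forall p : R, 0 <= p <= 1 -> C * ln n%:R / n%:R ^+ (k - 1) <= p ->
    forall (V : finType) (E : {set {set V}}), #|V| = n -> uniform k E ->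
      (mu_sup R d k s + gamma) * 'C(n - d, k - d)%:R <= (min_degree d E)%:R ->
      1 - eps <= subhypergraph_prob E p (has_optimal_matching k).
Proof.
have k0 : (0 < k)%N by apply: leq_trans hk.
have dk : (d < k)%N by lia.
have sk : (s < k)%N by lia.
(* Split of [gamma]: one half lifts the density above the limsup, up to 3/8 feed the three [delta]
   of the vortex, 1/8 pays for binomials versus powers. *)
have g2 : 0 < gamma / 2 by rewrite divr_gt0.
have [beta0 [y0 hm]] := matchable_above_mu_sup dk sk g2.
set mu := mu_sup R d k s in beta0 hm *.
pose delta : R := Num.min (gamma / 8) 1.
have delta0 : 0 < delta by rewrite /delta lt_min divr_gt0 ?ltr01.
have delta1 : delta <= 1 by rewrite /delta ge_min lexx orbT.
have delta8 : delta <= gamma / 8 by rewrite /delta ge_min lexx.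
have [K [n1 [K0 hK]]] := spread_optimal_matching hd1 dk beta0 delta0 delta1 hm.
have l2 : 0 < ln 2 :> R by rewrite ln_gt0 // ltr1n.
(* The number of rounds will be at most 4 log n / log 2, so 4 N K <= 16 K log n / log 2; the summand
   1 makes the constant positive even for K = 0. *)
exists (16 * K / ln 2 + 1).
  by rewrite ltr_wpDl // divr_ge0 ?mulr_ge0 // ltW.
move=> eps eps0.
have [n2 hn2] := nat_above eps^-1.
have [n3 hn3] := nat_above (4 * K + 1).
have [n4 hn4] := nat_above ((mu + gamma) * ((k - d)%:R * k%:R) / ((mu + gamma) - (mu + gamma * 7 / 8))).
exists (n1 + n2 + n3 + n4 + k)%N => n nn res p /andP[p0 p1] hp V E cV uE hmin.
have [N1 N2 N3 [N4 Nk]] : [/\ (n1 <= n)%N, (n2 <= n)%N, (n3 <= n)%N & (n4 <= n)%N /\ (k <= n)%N].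
  by clear -nn; split; [lia|lia|lia|split; lia].
have n1' : (1 < n)%N by apply: leq_trans Nk; apply: ltnW.
have nR : 0 < n%:R :> R by rewrite ltr0n ltnW.
have P0 : 0 < n%:R ^+ (k - 1) :> R by rewrite exprn_gt0.
have sp : has_spread (fun=> K / n%:R ^+ (k - 1) : R)
      (fun M => is_matching E M /\ #|M| = (#|V| %/ k)%N).
  rewrite -{1}cV; apply: hK => //; rewrite ?cV // => S cS.
  have := @codegree_density R V E k d (mu + gamma) (mu + gamma * 7 / 8) dk.
  rewrite cV => cd; apply: le_trans (cd _ _ Nk _ hmin S cS).
  - apply: ler_wpM2r; first exact: exprn_ge0.
    lra.
  - by move: beta0 g2; lra.
  - by move: hgamma; lra.
  - by apply: le_trans hn4 _; rewrite ler_nat.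
(* This gives 2^N >= n^2, so the failure probability n / 2^N is at most 1 / n. *)
pose N := (2 * up_log 2 n)%N.
have K1 : 4 * (K / n%:R ^+ (k - 1)) < 1.
  rewrite mulrA ltr_pdivrMr // mul1r; apply: (@lt_le_trans _ _ n%:R).
    by apply: (@lt_le_trans _ _ (4 * K + 1)); [rewrite ltrDl|apply: le_trans hn3 _; rewrite ler_nat].
  have [j ->] : exists j, (k - 1 = j.+1)%N by exists (k - 2)%N; clear -hk; lia.
  by rewrite exprS ler_peMr ?exprn_ege1 // ler1n ltnW.
have Kp : (4 * N)%:R * (K / n%:R ^+ (k - 1)) <= p.
  apply: le_trans hp; rewrite mulrA ler_pM2r ?invr_gt0 //.
  have L0 : 0 <= ln n%:R :> R by rewrite ln_ge0 // ler1n ltnW.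
  apply: (@le_trans _ _ (16 * K / ln 2 * ln n%:R)); last by rewrite ler_wpM2r // lerDl.
  rewrite /N !natrM; have := up_log_le_ln R n1' => hu.
  have := ler_wpM2l (mulr_ge0 (ler0n R 8) K0) hu.
  congr (_ <= _); first by ring.
  by field; rewrite lt0r_neq0.
have K0' : 0 <= K / n%:R ^+ (k - 1) by rewrite divr_ge0 // ltW.
apply: le_trans (optimal_matching_prob K0' K1 Kp p1 k0 sp).
rewrite lerD2l lerN2 cV.
have e1 : n%:R ^+ 2 <= 2 ^+ N :> R.
  rewrite /N mulnC exprM lerXn2r ?nnegrE ?exprn_ge0 // -natrX ler_nat.
  exact: up_logP.
rewrite ler_pdivrMr ?exprn_gt0 //.
apply: (@le_trans _ _ (eps * n%:R ^+ 2)); last by rewrite ler_wpM2l // ltW.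
rewrite expr2 mulrA ler_peMl //.
rewrite -ler_pdivrMl // mulr1; apply: le_trans hn2 _; by rewrite ler_nat.
Qed.
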